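(* Let $M$ be a smooth manifold of dimension $n+1$. There exists a one-to-one correspondence between Veronese webs $\{\mathcal{F}_\lambda\}_{\lambda\in\mathbb{P}^1}$ on $M$ and partial Nijenhuis operators $(\mathcal{F},\bar{J})$ of generic type on $M$, such that $\mathcal{F}_\infty=\mathcal{F}$ and $T\mathcal{F}_0=\bar{J}(T\mathcal{F})$. Moreover, locally one can choose $\bar{J}=J|_{T\mathcal{F}}$ for a Nijenhuis operator $J:TM\to TM$ such that $J|_{T\mathcal{F}}:T\mathcal{F}\to TM$ is injective and $J(T\mathcal{F})\subset TM$ is an integrable distribution.
   Context: All objects are smooth and real; $\mathbb{P}^1=\mathbb{R}\cup\{\infty\}$. A Veronese web on $M^{n+1}$ is a collection $\{\mathcal{F}_\lambda\}_{\lambda\in\mathbb{P}^1}$ of foliations of codimension 1 such that for every $x\in M$ there is a local coframe $(\alpha_0,\dots,\alpha_n)$ of 1-forms near $x$ with $(T\mathcal{F}_\lambda)^\perp=\langle\alpha_0+\lambda\alpha_1+\dots+\lambda^n\alpha_n\rangle$ for all $\lambda$ (so $(T\mathcal{F}_0)^\perp=\langle\alpha_0\rangle$, $(T\mathcal{F}_\infty)^\perp=\langle\alpha_n\rangle$). Here $^\perp$ denotes the annihilator. A partial Nijenhuis operator on $M$ is a pair $(\mathcal{F},\bar{J})$, where $\mathcal{F}$ is a foliation on $M$ and $\bar{J}:T\mathcal{F}\to TM$ is a vector bundle morphism (partial $(1,1)$-tensor) such that for all $X,Y\in\Gamma(T\mathcal{F})$: (1) $[X,Y]_{\bar{J}}:=[\bar{J}X,Y]+[X,\bar{J}Y]-\bar{J}[X,Y]\in\Gamma(T\mathcal{F})$;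 (2) $[\bar{J}X,\bar{J}Y]-\bar{J}[X,Y]_{\bar{J}}=0$. It is of generic type if there exist local frames $v_1,\dots,v_n\in\Gamma(T\mathcal{F})$ and $w_0,\dots,w_n\in\Gamma(TM)$ with $\bar{J}v_i=w_{i-1}$ and $I v_i=w_i$ for $i=1,\dots,n$, where $I:T\mathcal{F}\hookrightarrow TM$ is the canonical inclusion (i.e. the pair $\bar{J},I$ has a unique Kronecker block in its Jordan–Kronecker decomposition). A Nijenhuis operator is a $(1,1)$-tensor $J:TM\to TM$ with vanishing Nijenhuis tensor $N_J(X,Y)=[JX,JY]-J[JX,Y]-J[X,JY]+J^2[X,Y]$. *)

(* Defs.v *)
From HB Require Import structures.
From mathcomp Require Import all_boot all_order all_algebra.
From mathcomp Require Import all_classical all_reals all_analysis.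
Import Order.TTheory GRing.Theory Num.Theory.
Import numFieldNormedType.Exports.

Set Implicit Arguments.
Unset Strict Implicit.
Unset Printing Implicit Defensive.

Local Open Scope classical_set_scope.
Local Open Scope ring_scope.

(* Meaningful for U open: f is C^k on U when it is continuous there and its
   first partial derivatives exist and are C^(k-1) on U. *)
Fixpoint Ck_on (R : realType) (n k : nat) (U : set 'rV[R]_n.+1)
    (f : 'rV[R]_n.+1 -> R) : Prop :=
  (forall x, U x -> {for x, continuous f}) /\
  match k with
  | 0%N => True
  | k'.+1 => forall i : 'I_n.+1,
      (forall x, U x -> derivable f x (delta_mx 0 i)) /\
      Ck_on k' U (fun x => 'D_(delta_mx 0 i) f x)
  end.

Definition Cinf_on (R : realType) (n : nat) (U : set 'rV[R]_n.+1)
    (f : 'rV[R]_n.+1 -> R) : Prop :=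
  forall k, Ck_on k U f.

(* A smooth manifold of dimension n+1. The atlas consists of one chart around
   each point x, with domain [chart_dom x]; every smooth structure is given by
   such an atlas. [chart x] and [chart_inv x] are total functions whose values
   matter only on [chart_dom x] and on its image. *)
Record smoothManifold (R : realType) (n : nat) := SmoothManifold {
  carrier :> topologicalType;
  carrier_hausdorff : hausdorff_space carrier;
  carrier_second_countable : @second_countable carrier;
  chart_dom : carrier -> set carrier;
  chart : carrier -> carrier -> 'rV[R]_n.+1;
  chart_inv : carrier -> 'rV[R]_n.+1 -> carrier;
  chart_dom_open : forall x, open (chart_dom x);
  chart_dom_center : forall x, chart_dom x x;
  chart_image_open : forall x, open (chart x @` chart_dom x);
  chartK : forall x y, chart_dom x y -> chart_inv x (chart x y) = y;
  chart_continuous :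
    forall x y, chart_dom x y -> {for y, continuous (chart x)};
  chart_inv_continuous :
    forall x u, (chart x @` chart_dom x) u -> {for u, continuous (chart_inv x)};
  chart_transition_smooth : forall x y (i : 'I_n.+1),
    Cinf_on (chart x @` (chart_dom x `&` chart_dom y))
            (fun u => chart y (chart_inv x u) 0 i)
}.

(* The tangent space at x is identified with R^(n+1) through the chart
   [chart x] centred at x: the row vector v is the tangent vector at x with
   components v in that chart. So 'End('rV[R]_n.+1) stands for End(T_x M) and
   'Hom('rV[R]_n.+1, R^o) for the cotangent space at x. Tangent vectors at
   distinct points are compared only through their action on functions. *)

(* Vector fields, 1-forms and distributions are total on M; when they are used
   over an open set U, their values outside U are irrelevant. *)
Definition vectorField (R : realType) (n : nat) (M : smoothManifold R n) :=
  M -> 'rV[R]_n.+1.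
Definition oneForm (R : realType) (n : nat) (M : smoothManifold R n) :=
  M -> 'Hom('rV[R]_n.+1, R^o).
Definition tensor11 (R : realType) (n : nat) (M : smoothManifold R n) :=
  M -> 'End('rV[R]_n.+1).
Definition distribution (R : realType) (n : nat) (M : smoothManifold R n) :=
  M -> {vspace 'rV[R]_n.+1}.

Definition smooth_fun_on (R : realType) (n : nat) (M : smoothManifold R n)
    (U : set M) (f : M -> R) : Prop :=
  forall x, Cinf_on (chart x @` (U `&` chart_dom x))
                    (fun u => f (chart_inv x u)).

(* [tder f x v] is df_x(v), the derivative of f along the tangent vector v. *)
Definition tder (R : realType) (n : nat) (M : smoothManifold R n)
    (f : M -> R) (x : M) (v : 'rV[R]_n.+1) : R :=
  'D_v (fun u => f (chart_inv x u)) (chart x x).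

Definition vf_act (R : realType) (n : nat) (M : smoothManifold R n)
    (X : vectorField M) (f : M -> R) : M -> R :=
  fun x => tder f x (X x).

Definition smooth_vf_on (R : realType) (n : nat) (M : smoothManifold R n)
    (U : set M) (X : vectorField M) : Prop :=
  forall (V : set M) (f : M -> R), open V -> V `<=` U ->
    smooth_fun_on V f -> smooth_fun_on V (vf_act X f).

Definition smooth_form_on (R : realType) (n : nat) (M : smoothManifold R n)
    (U : set M) (a : oneForm M) : Prop :=
  forall (V : set M) (X : vectorField M), open V -> V `<=` U ->
    smooth_vf_on V X -> smooth_fun_on V (fun x => a x (X x)).

Definition smooth_tensor11_on (R : realType) (n : nat)
    (M : smoothManifold R n) (U : set M) (J : tensor11 M) : Prop :=
  forall (V : set M) (X : vectorField M), open V -> V `<=` U ->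
    smooth_vf_on V X -> smooth_vf_on V (fun x => J x (X x)).

(* The derivation f |-> X(Yf) - Y(Xf) evaluated at x: its components in the
   chart at x are its values on the coordinate functions of that chart. *)
Definition bracket (R : realType) (n : nat) (M : smoothManifold R n)
    (X Y : vectorField M) : vectorField M :=
  fun x => \row_(i < n.+1)
    (vf_act X (vf_act Y (fun y => chart x y 0 i)) x
     - vf_act Y (vf_act X (fun y => chart x y 0 i)) x).

(* Smooth sections of the subbundle D of TM over U. *)
Definition section_on (R : realType) (n : nat) (M : smoothManifold R n)
    (U : set M) (D : distribution M) (X : vectorField M) : Prop :=
  smooth_vf_on U X /\ forall x, U x -> X x \in D x.

(* A foliation is represented by its tangent distribution D. It is a foliation
   of codimension q on U when, locally, the leaves are the fibres of a
   submersion (f_1, ..., f_q) to R^q, so that D is the common kernel of the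
   differentials df_i. *)
Definition foliation_on (R : realType) (n : nat) (M : smoothManifold R n)
    (U : set M) (q : nat) (D : distribution M) : Prop :=
  forall x, U x -> exists (V : set M) (f : 'I_q -> M -> R),
    [/\ open V, V x, V `<=` U,
        forall i, smooth_fun_on V (f i) &
        forall y, V y ->
          (forall c : 'I_q -> R, exists v : 'rV[R]_n.+1,
             forall i, tder (f i) y v = c i) /\
          (forall v : 'rV[R]_n.+1,
             v \in D y <-> forall i, tder (f i) y v = 0)].

Definition integrable_on (R : realType) (n : nat) (M : smoothManifold R n)
    (U : set M) (D : distribution M) : Prop :=
  exists q, foliation_on U q D.

(* The covector a spans the annihilator of the subspace W. *)
Definition spans_annihilator (R : realType) (n : nat)
    (a : 'Hom('rV[R]_n.+1, R^o)) (W : {vspace 'rV[R]_n.+1}) : Prop :=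
  forall b : 'Hom('rV[R]_n.+1, R^o),
    b \in <[a]>%VS <-> (forall v, v \in W -> b v = 0).

(* The projective line R u {oo} is [option R], with [None] for oo. *)
Record veroneseWeb (R : realType) (n : nat) (M : smoothManifold R n) :=
  VeroneseWeb {
    web_leaf :> option R -> distribution M;
    web_foliation : forall l, foliation_on setT 1 (web_leaf l);
    web_coframe : forall x : M,
      exists (U : set M) (a : 'I_n.+1 -> oneForm M),
        [/\ open U, U x, forall i, smooth_form_on U (a i) &
            forall y, U y ->
              [/\ basis_of fullv [tuple a i y | i < n.+1],
                  forall l : R,
                    spans_annihilator (\sum_(i < n.+1) l ^+ i *: a i y)
                                      (web_leaf (Some l) y) &
                  spans_annihilator (a ord_max y) (web_leaf None y)]]
  }.

(* Bundle morphisms T F -> TM, with D = T F. *)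
Definition partialTensor (R : realType) (n : nat) (M : smoothManifold R n)
    (D : distribution M) :=
  forall x : M, 'Hom(subvs_of (D x), 'rV[R]_n.+1).

(* [papp J X] is the vector field JX for a section X of D: [vsproj (D x)] is
   the inverse of the inclusion of D x, and is applied only to vectors of
   D x. *)
Definition papp (R : realType) (n : nat) (M : smoothManifold R n)
    (D : distribution M) (J : partialTensor D) (X : vectorField M) :
    vectorField M :=
  fun x => J x (vsproj (D x) (X x)).

Definition pbracket (R : realType) (n : nat) (M : smoothManifold R n)
    (D : distribution M) (J : partialTensor D) (X Y : vectorField M) :
    vectorField M :=
  fun x => bracket (papp J X) Y x + bracket X (papp J Y) x
           - papp J (bracket X Y) x.

(* Gamma(T F) is the sheaf of sections: U ranges over all open subsets. *)
Record partialNijenhuis (R : realType) (n : nat) (M : smoothManifold R n) :=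
  PartialNijenhuis {
    pn_fol : distribution M;
    pn_map : partialTensor pn_fol;
    pn_integrable : integrable_on setT pn_fol;
    pn_smooth : forall (U : set M) (X : vectorField M), open U ->
      section_on U pn_fol X -> smooth_vf_on U (papp pn_map X);
    pn_bracket : forall (U : set M) (X Y : vectorField M), open U ->
      section_on U pn_fol X -> section_on U pn_fol Y ->
      section_on U pn_fol (pbracket pn_map X Y);
    pn_torsion : forall (U : set M) (X Y : vectorField M), open U ->
      section_on U pn_fol X -> section_on U pn_fol Y ->
      forall x, U x ->
        bracket (papp pn_map X) (papp pn_map Y) x
        - papp pn_map (pbracket pn_map X Y) x = 0
  }.

(* The frame v_1, ..., v_n is indexed from 0, so [v i] below is v_(i+1). *)
Definition generic_type (R : realType) (n : nat) (M : smoothManifold R n)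
    (P : partialNijenhuis M) : Prop :=
  forall x : M, exists (U : set M) (v : 'I_n -> vectorField M)
      (w : 'I_n.+1 -> vectorField M),
    [/\ open U, U x,
        forall i, section_on U (pn_fol P) (v i),
        forall i, smooth_vf_on U (w i) &
        forall y, U y ->
          [/\ basis_of (pn_fol P y) [tuple v i y | i < n],
              basis_of fullv [tuple w i y | i < n.+1],
              forall i : 'I_n,
                papp (pn_map P) (v i) y = w (widen_ord (leqnSn n) i) y &
              forall i : 'I_n, v i y = w (lift ord0 i) y]].

Definition tapp (R : realType) (n : nat) (M : smoothManifold R n)
    (J : tensor11 M) (X : vectorField M) : vectorField M :=
  fun x => J x (X x).

Definition nijenhuis_torsion (R : realType) (n : nat)
    (M : smoothManifold R n) (J : tensor11 M) (X Y : vectorField M) :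
    vectorField M :=
  fun x => bracket (tapp J X) (tapp J Y) x
           - tapp J (bracket (tapp J X) Y) x
           - tapp J (bracket X (tapp J Y)) x
           + tapp J (tapp J (bracket X Y)) x.

Definition nijenhuis_on (R : realType) (n : nat) (M : smoothManifold R n)
    (U : set M) (J : tensor11 M) : Prop :=
  smooth_tensor11_on U J /\
  forall (V : set M) (X Y : vectorField M), open V -> V `<=` U ->
    smooth_vf_on V X -> smooth_vf_on V Y ->
    forall x, V x -> nijenhuis_torsion J X Y x = 0.

(* Main.v *)
Require Import Defs.
From HB Require Import structures.
From mathcomp Require Import all_boot all_order all_algebra.
From mathcomp Require Import all_classical all_reals all_analysis.
From mathcomp Require Import ring lra zify.
Import Order.TTheory GRing.Theory Num.Theory.
Import numFieldNormedType.Exports.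

Set Implicit Arguments.
Unset Strict Implicit.
Unset Printing Implicit Defensive.

Local Open Scope classical_set_scope.
Local Open Scope ring_scope.

(** The web and the operator determine each other through T F_l = (J - l)(T F_oo).
    Given the web, u = J v means that u - l v is tangent to F_l for every l; in
    an adapted coframe this reads alpha_(i+1)(u) = alpha_i(v), which has exactly
    one solution u for each v in T F_oo. If f is a first integral of F_l, then
    (JX) f = l X f, and expanding the brackets shows that [JX, JY] - l [X, Y]_J
    kills f; being true for all l, this is both axioms of a partial Nijenhuis
    operator. Conversely, vanishing torsion makes the image of J - l involutive,
    and the Frobenius theorem provides the leaves. Finally, first integrals
    f_0, ..., f_n of n+1 distinct leaves are local coordinates, and the operator
    with df_i (J u) = l_i df_i (u) has constant eigenvalues in them, hence
    vanishing torsion, and extends the partial operator.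

    The Frobenius theorem is needed in codimension one only. Horizontal lifts of
    straight lines towards a transversal line solve a scalar equation; the point
    where the transversal is reached depends smoothly on the initial point and is
    a first integral, because its derivative along the kernel satisfies a linear
    homogeneous equation. *)

(** * Derivatives along lines and the Gronwall inequality *)

(** A tangent vector is known here through its action on functions, so every identity between
    brackets is tested on first integrals, where the operator becomes multiplication by a constant
    and passes through derivations. The main analytic obstacle is smooth dependence of a flow on its
    initial point. The derivative is obtained as a limit of difference quotients, shown to be Cauchy
    by Gronwall; the variational equation is thus verified, never solved. Since the tangent lift of
    a flow is again a flow, all higher orders follow by induction from a mere Lipschitz estimate. In
    the Frobenius theorem the direction of the line is carried as a second component of the initial
    point, so dependence on it is covered by the same result. In the pencil, a polynomial identity
    in l of degree n+1 is exploited: its top coefficient is what forces [X, Y]_J to be tangent to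
    F_oo, without a separate argument at infinity. The eigenvalues of the local extension are 0,
    ..., n. They are distinct, and the presence of 0 makes J(T F) the kernel of df_0 on the very
    neighbourhood where J lives. *)

Definition has_der (R : realType) (V W : normedModType R)
    (f : V -> W) (x v : V) (d : W) : Prop :=
  forall e : R, 0 < e -> exists2 r : R, 0 < r &
    forall h : R, `|h| < r -> `|f (x + h *: v) - f x - h *: d| <= e * `|h|.

Lemma is_derive_has_der (R : realType) (V W : normedModType R)
    (f : V -> W) (x v : V) (d : W) : is_derive x v f d <-> has_der f x v d.
Proof.
split.
- move=> [df <-] e e0.
  have /cvgrPdist_le /(_ e e0) := df.
  rewrite -/(derive f x v) near_withinE /= => /nbhs_ballP[r /= r0 Hr].
  exists r => // h hr.
  have [->|h0] := eqVneq h 0.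
    by rewrite !scale0r addr0 subrr subr0 !normr0 mulr0.
  have := Hr h; rewrite /ball /= sub0r normrN => /(_ hr h0).
  rewrite distrC => H.
  have -> : f (x + h *: v) - f x - h *: 'D_v f x =
      h *: (h^-1 *: (f (h *: v + x) - f x) - 'D_v f x).
    by rewrite scalerBr scalerA mulfV // scale1r (addrC (h *: v)).
  by rewrite normrZ mulrC ler_wpM2r.
- move=> H.
  have cv : h^-1 *: ((f \o shift x) (h *: v) - f x) @[h --> 0^'] --> d.
    apply/cvgrPdist_le => e e0; have [r r0 Hr] := H e e0.
    rewrite near_withinE; apply/nbhs_ballP; exists r => // h.
    rewrite /ball /= sub0r normrN => hr h0.
    rewrite distrC -(@ler_pM2r _ `|h|) ?normr_gt0 // mulrC -normrZ.
    apply: le_trans (Hr h hr); rewrite scalerBr scalerA mulfV // scale1r.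
    by rewrite (addrC (h *: v)).
  by apply: DeriveDef; [apply: cvgP cv | exact: cvg_lim cv].
Qed.

Lemma has_derE (R : realType) (V W : normedModType R)
    (f : V -> W) (x v : V) (d : W) : has_der f x v d -> 'D_v f x = d.
Proof. by move=> /is_derive_has_der H; rewrite derive_val. Qed.

Lemma derivable_has_der (R : realType) (V W : normedModType R)
    (f : V -> W) (x v : V) : derivable f x v -> has_der f x v ('D_v f x).
Proof. by move=> /derivableP /is_derive_has_der. Qed.

Lemma has_der_derivable (R : realType) (V W : normedModType R)
    (f : V -> W) (x v : V) (d : W) : has_der f x v d -> derivable f x v.
Proof. by move=> /is_derive_has_der H; exact: ex_derive. Qed.

Lemma continuous_epsP (R : realType) (V W : normedModType R)
    (f : V -> W) (x : V) : {for x, continuous f} <->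
  (forall e : R, 0 < e -> exists2 r : R, 0 < r &
    forall y : V, `|y - x| < r -> `|f y - f x| < e).
Proof.
split=> [/cvgrPdist_lt H e e0|H].
  have /nbhs_ballP[r /= r0 Hr] := H e e0; exists r => // y yx.
  by rewrite distrC; apply: Hr; rewrite -ball_normE /ball_ /= distrC.
apply/cvgrPdist_lt => e e0; have [r r0 Hr] := H e e0.
apply/nbhs_ballP; exists r => // y; rewrite -ball_normE /ball_ /= distrC => yx.
by rewrite distrC; exact: Hr.
Qed.

Lemma has_der_continuousR (R : realType) (W : normedModType R)
    (f : R -> W) (x : R) (d : W) : has_der f x 1 d -> {for x, continuous f}.
Proof.
move=> /is_derive_has_der H.
have /derivable1_diffP /differentiable_continuous // : derivable f x 1.
exact: ex_derive.
Qed.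

(* The comparison is propagated along [0, T] by a continuity argument: at the
   first time where it could fail the strict inequality of speeds protects it. *)
Lemma norm_le_comparison (R : realType) (W : normedModType R) (T : R)
    (u du : R -> W) (p dp : R -> R) :
  (forall t, 0 <= t <= T -> has_der u t 1 (du t)) ->
  (forall t, 0 <= t <= T -> has_der p t 1 (dp t)) ->
  `|u 0| <= p 0 ->
  (forall t, 0 <= t <= T -> (forall s, 0 <= s <= t -> `|u s| <= p s) ->
     `|du t| < dp t) ->
  forall t, 0 <= t <= T -> `|u t| <= p t.
Proof.
move=> ud pd up0 step t tT; apply: contrapT => bad.
pose B := [set s : R | 0 <= s <= T /\ p s < `|u s|].
have Bt : B t by split=> //; rewrite ltNge; apply/negP.
have Blb : lbound B 0 by move=> s [/andP[]].
have hB : has_inf B by split; [exists t | exists 0].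
pose s := inf B.
have s0 : 0 <= s by apply: lb_le_inf => //; exists t.
have st : s <= t by apply: ge_inf => //; exists 0.
have sT : s <= T by move: tT => /andP[_]; apply: le_trans.
have good r : 0 <= r -> r < s -> `|u r| <= p r.
  move=> r0 rs; rewrite leNgt; apply/negP => rB.
  have : B r by split=> //; rewrite r0 (le_trans (ltW rs)).
  move=> /(ge_inf (proj2 hB)); rewrite -/s; lra.
have cw : {for s, continuous (fun r => p r - `|u r|)}.
  apply: cvgB; first by apply: has_der_continuousR (pd s _); apply/andP.
  by apply: cvg_norm; apply: has_der_continuousR (ud s _); apply/andP.
have goods : `|u s| <= p s.
  rewrite leNgt; apply/negP => sB.
  have [s00|sn0] := eqVneq s 0; first by move: sB; rewrite s00 ltNge up0.
  have spos : 0 < s by rewrite lt_neqAle eq_sym sn0.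
  have e0 : 0 < `|u s| - p s by rewrite subr_gt0.
  have /continuous_epsP /(_ _ e0)[r r0 Hr] := cw.
  pose q := Num.max 0 (s - r / 2).
  have qs : q < s by rewrite gt_max spos /= gtrBl divr_gt0.
  have q0 : 0 <= q by rewrite le_max lexx.
  have qr : `|q - s| < r.
    rewrite ltr0_norm ?subr_lt0 // opprB.
    have : s - r / 2 <= q by rewrite le_max lexx orbT.
    lra.
  have := Hr q qr; have := good q q0 qs; rewrite ltr_norml; lra.
have dlt : `|du s| < dp s.
  apply: step; first exact/andP.
  by move=> r /andP[r0]; rewrite le_eqVlt => /orP[/eqP->//|]; exact: good.
(* Half of the gap between the speeds is spent on each of [u] and [p]. The bound then survives
   slightly beyond [s], so [s + r] is a lower bound of [B], against [s = inf B]. *)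
have e0 : 0 < (dp s - `|du s|) / 2 by rewrite divr_gt0 // subr_gt0.
have [r1 r10 Hr1] := ud s (introT andP (conj s0 sT)) _ e0.
have [r2 r20 Hr2] := pd s (introT andP (conj s0 sT)) _ e0.
pose r := Num.min r1 r2.
have r0 : 0 < r by rewrite lt_min r10.
have : s + r <= s.
  apply: lb_le_inf; first by exists t.
  move=> q [/andP[q0 qT] qB]; rewrite leNgt; apply/negP => qr.
  have sq : s <= q by apply: ge_inf; [exists 0|split=> //; apply/andP].
  have h0 : `|q - s| = q - s by rewrite ger0_norm // subr_ge0.
  have := Hr1 (q - s); have := Hr2 (q - s); rewrite h0.
  have -> : q - s < r1.
    by have : r <= r1; [rewrite ge_min lexx|lra].
  have -> : q - s < r2.
    by have : r <= r2; [rewrite ge_min lexx orbT|lra].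
  have -> : s + (q - s)%:A = q by rewrite scaler1 subrKC.
  move=> /(_ isT) C /(_ isT) A.
  have := ler_normD (u q - u s - (q - s) *: du s) ((q - s) *: du s + u s).
  have := ler_normD ((q - s) *: du s) (u s).
  rewrite addrA !subrK normrZ h0 => X Y.
  move: C; rewrite ler_norml => /andP[C _].
  have {}C : - ((dp s - `|du s|) / 2 * (q - s)) <= p q - p s - (q - s) * dp s := C.
  move: qB; nra.
lra.
Qed.

Lemma has_der_cst (R : realType) (V W : normedModType R) (a : W) (x v : V) :
  has_der (cst a) x v 0.
Proof. by apply/is_derive_has_der. Qed.

Lemma has_derD (R : realType) (V W : normedModType R) (f g : V -> W) (x v : V) a b :
  has_der f x v a -> has_der g x v b -> has_der (fun y => f y + g y) x v (a + b).
Proof. by move=> /is_derive_has_der ? /is_derive_has_der ?; apply/is_derive_has_der. Qed.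

Lemma has_derB (R : realType) (V W : normedModType R) (f g : V -> W) (x v : V) a b :
  has_der f x v a -> has_der g x v b -> has_der (fun y => f y - g y) x v (a - b).
Proof. by move=> /is_derive_has_der ? /is_derive_has_der ?; apply/is_derive_has_der. Qed.

Lemma has_derZ (R : realType) (V W : normedModType R) (k : R) (f : V -> W) (x v : V) a :
  has_der f x v a -> has_der (fun y => k *: f y) x v (k *: a).
Proof. by move=> /is_derive_has_der ?; apply/is_derive_has_der. Qed.

Lemma has_der_ext (R : realType) (V W : normedModType R) (f g : V -> W) (x v : V) a :
  (forall h : R, f (x + h *: v) = g (x + h *: v)) ->
  has_der f x v a -> has_der g x v a.
Proof.
move=> fg H e e0; have [r r0 Hr] := H e e0; exists r => // h hr.
by rewrite -fg -[g x]/(g x) -(addr0 x) -[in g _](scale0r v) -fg scale0r addr0; exact: Hr.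
Qed.

Lemma has_der_near (R : realType) (V W : normedModType R) (f g : V -> W) (x v : V) a :
  (exists2 r : R, 0 < r & forall h : R, `|h| < r -> f (x + h *: v) = g (x + h *: v)) ->
  has_der f x v a -> has_der g x v a.
Proof.
move=> [s s0 fg] H e e0; have [r r0 Hr] := H e e0.
exists (Num.min r s); first by rewrite lt_min r0.
move=> h; rewrite lt_min => /andP[hr hs].
have := fg 0; rewrite normr0 scale0r addr0 => /(_ s0) <-.
by rewrite -fg //; exact: Hr.
Qed.

Lemma has_der_affine (R : realType) (V W : normedModType R) (f : V -> W) (x v : V) a :
  (forall h : R, f (x + h *: v) = f x + h *: a) -> has_der f x v a.
Proof.
move=> H e e0; exists 1 => // h _.
by rewrite H [f x + _]addrC addrK subrr normr0 mulr_ge0 // ltW.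
Qed.

Lemma has_der_expMl (R : realType) (c K t : R) :
  has_der (fun s : R => c * expR (K * s)) t (1 : R) (K * (c * expR (K * t))).
Proof.
apply/is_derive_has_der; apply: is_derive_eq.
rewrite /GRing.scale /=; ring.
Qed.

(** The comparison lemma wants a strict inequality of speeds, hence the slope [K + e / (T + 1)]; the
    excess at time T is e T / (T + 1), at most e. The denominator [T + 1] covers T = 0. *)
Lemma norm_mean_value (R : realType) (W : normedModType R) (T K : R) (u du : R -> W) :
  0 <= T -> (forall t, 0 <= t <= T -> has_der u t 1 (du t)) ->
  (forall t, 0 <= t <= T -> `|du t| <= K) -> `|u T - u 0| <= K * T.
Proof.
move=> T0 ud dK; apply/ler_addgt0Pr => e e0.
have e1 : 0 < e / (T + 1) by rewrite divr_gt0 // ltr_wpDl.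
have := @norm_le_comparison R W T (fun t => u t - u 0) du
  (fun t => (K + e / (T + 1)) * t) (fun=> K + e / (T + 1)).
have dl t : has_der (fun t : R => (K + e / (T + 1)) * t) t (1 : R) (K + e / (T + 1)).
  by apply: has_der_affine => h; rewrite scaler1 /GRing.scale /= mulrDr (mulrC h).
move=> /(_ _ (fun t _ => dl t) _ _ T) H.
apply: (@le_trans _ _ ((K + e / (T + 1)) * T)).
  apply: H; last by rewrite T0 lexx.
  - by move=> t /ud H; rewrite -[du t]subr0; apply: has_derB H _; exact: has_der_cst.
  - by rewrite subrr normr0 mulr0.
  - by move=> t /dK dt _; rewrite (le_lt_trans dt) // ltrDl.
rewrite mulrDl lerD2l mulrAC ler_pdivrMr ?ltr_wpDl //.
by rewrite ler_pM2l // lerDl.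
Qed.

(** Comparison with p(t) = (a + eta) exp((L + 1) t): since p >= eta > e for t >= 0, its speed (L +
    1) p strictly exceeds L p + e. The differential inequality is assumed only while |u| <= rho; the
    comparison itself keeps [u] in that tube, so an estimate valid near a trajectory is enough. *)
Lemma gronwall (R : realType) (W : normedModType R) (T L a eta e rho : R) (u du : R -> W) :
  0 <= L -> 0 <= a -> e < eta -> 0 < eta ->
  (forall t, 0 <= t <= T -> has_der u t 1 (du t)) ->
  `|u 0| <= a -> (a + eta) * expR ((L + 1) * T) <= rho ->
  (forall t, 0 <= t <= T -> `|u t| <= rho -> `|du t| <= L * `|u t| + e) ->
  forall t, 0 <= t <= T -> `|u t| <= (a + eta) * expR ((L + 1) * T).
Proof.
move=> L0 a0 ee eta0 ud ua rhoE duE.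
have L1 : 0 < L + 1 by rewrite ltr_wpDl.
have aeta : 0 < a + eta by rewrite ltr_wpDl.
have mono t : t <= T ->
    (a + eta) * expR ((L + 1) * t) <= (a + eta) * expR ((L + 1) * T).
  by move=> tT; rewrite ler_pM2l // ler_expR ler_pM2l.
have H := @norm_le_comparison R W T u du
  (fun t => (a + eta) * expR ((L + 1) * t))
  (fun t => (L + 1) * ((a + eta) * expR ((L + 1) * t))) ud
  (fun t _ => has_der_expMl (a + eta) (L + 1) t).
move=> t tT; apply: le_trans (mono t _); last by case/andP: tT.
apply: H tT.
  rewrite mulr0 expR0 mulr1; lra.
move=> s sT good.
have us : `|u s| <= (a + eta) * expR ((L + 1) * s).
  by apply: good; case/andP: sT => -> _ /=.
have ur : `|u s| <= rho.
  by apply: le_trans us (le_trans (mono s _) rhoE); case/andP: sT.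
have e1 : 1 <= expR ((L + 1) * s).
  rewrite -[X in X <= _]expR0 ler_expR; apply: mulr_ge0; first exact: ltW.
  by case/andP: sT.
have := duE s sT ur; nra.
Qed.

(** * Maps of class C^k on normed modules *)

Definition tangent_map (R : realType) (V W : normedModType R) (f : V -> W)
  (p : V * V) : W := 'D_(p.2) f p.1.

Definition tangent_lift (R : realType) (V W : normedModType R) (f : V -> W)
  (p : V * V) : W * W := (f p.1, 'D_(p.2) f p.1).

(* C^k through iterated tangent maps V * V -> W: no norm on spaces of linear maps
   is involved, and the tangent map of a flow is again a flow. *)
Fixpoint Ck (R : realType) (k : nat) : forall V W : normedModType R,
    set V -> (V -> W) -> Prop :=
  match k with
  | 0%N => fun V W U f => forall x, U x -> {for x, continuous f}
  | k'.+1 => fun V W U f =>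
      [/\ forall x, U x -> {for x, continuous f},
          forall x v, U x -> derivable f x v &
          Ck k' (fst @^-1` U) (tangent_map f)]
  end.

Definition Csmooth (R : realType) (V W : normedModType R) (U : set V)
  (f : V -> W) : Prop := forall k, Ck k U f.

Section CkTheory.
Context {R : realType}.
Implicit Types (V W Z : normedModType R) (k : nat).

Lemma Ck_continuous V W k (U : set V) (f : V -> W) x :
  Ck k U f -> U x -> {for x, continuous f}.
Proof. by case: k => [H /H|k [H _ _] /H]. Qed.

Lemma Ck_has_der V W k (U : set V) (f : V -> W) x v :
  Ck k.+1 U f -> U x -> has_der f x v (tangent_map f (x, v)).
Proof. by case=> _ H _ Ux; apply: derivable_has_der; exact: H. Qed.

Lemma open_line V (U : set V) x v : open U -> U x ->
  exists2 r : R, 0 < r & forall h : R, `|h| < r -> U (x + h *: v).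
Proof.
move=> oU Ux; have /nbhs_ballP[d /= d0 Hd] : nbhs x U by exact: open_nbhs_nbhs.
exists (d / (`|v| + 1)); first by rewrite divr_gt0 // ltr_wpDl.
move=> h; rewrite ltr_pdivlMr ?ltr_wpDl // => hd.
apply: Hd; rewrite -ball_normE /ball_ /= opprD addNKr normrN normrZ.
by apply: le_lt_trans hd; rewrite ler_wpM2l // lerDl.
Qed.

Lemma open_ball_subset V (U : set V) x : open U -> U x ->
  exists2 r : R, 0 < r & forall y, `|y - x| < r -> U y.
Proof.
move=> oU Ux; have /nbhs_ballP[d /= d0 Hd] : nbhs x U by exact: open_nbhs_nbhs.
exists d => // y yx; apply: Hd; by rewrite -ball_normE /ball_ /= distrC.
Qed.

Lemma open_of_balls V (U : set V) :
  (forall x, U x -> exists2 r : R, 0 < r & forall y, `|y - x| < r -> U y) ->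
  open U.
Proof.
move=> H; rewrite openE => x /H[r r0 Hr]; apply/nbhs_ballP; exists r => // y.
by rewrite -ball_normE /ball_ /= distrC => /Hr.
Qed.

Lemma open_fst V W (U : set V) : open U -> open (fst @^-1` U : set (V * W)).
Proof. by move=> oU; apply: open_comp => // p _; exact: cvg_fst. Qed.

Lemma Ck_eq V W k (U : set V) (f g : V -> W) : open U ->
  (forall x, U x -> f x = g x) -> Ck k U f -> Ck k U g.
Proof.
elim: k V W U f g => [|k IH] V W U f g oU fg.
  move=> H x Ux; have := H x Ux; rewrite /prop_for /continuous_at -fg //.
  apply: cvg_trans; apply: near_eq_cvg.
  by have := open_nbhs_nbhs (conj oU Ux); apply: filterS => y /fg.
have loc x v d : U x -> has_der f x v d -> has_der g x v d.
  move=> Ux; apply: has_der_near; have [r r0 Hr] := open_line v oU Ux.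
  by exists r => // h /Hr /fg.
case=> cf df Tf; split.
- move=> x Ux; have := cf x Ux; rewrite /prop_for /continuous_at -fg //.
  apply: cvg_trans; apply: near_eq_cvg.
  by have := open_nbhs_nbhs (conj oU Ux); apply: filterS => y /fg.
- move=> x v Ux; apply: has_der_derivable (loc x v _ Ux _).
  by apply: derivable_has_der; exact: df.
- apply: IH Tf; first exact: open_fst.
  move=> [x v] /= Ux; apply/esym/has_derE/loc => //.
  by apply: derivable_has_der; exact: df.
Qed.

Lemma Ck_subset V W k (U U' : set V) (f : V -> W) :
  U' `<=` U -> Ck k U f -> Ck k U' f.
Proof.
elim: k V W U U' f => [|k IH] V W U U' f sU; first by move=> H x /sU /H.
case=> cf df Tf; split; [by move=> x /sU /cf|by move=> x v /sU /df|].
by apply: IH Tf => -[x v] /= /sU.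
Qed.

(** The sets [U'] may be arbitrary: each clause of [Ck] speaks of continuity and derivatives at a
    point in the ambient space, not in the subspace topology. *)
Lemma Ck_local V W k (U : set V) (f : V -> W) :
  (forall x, U x -> exists2 U' : set V, U' x & Ck k U' f) -> Ck k U f.
Proof.
elim: k V W U f => [|k IH] V W U f H; first by move=> x /H[U' U'x]; exact.
split.
- by move=> x /H[U' U'x [+ _ _]]; exact.
- by move=> x v /H[U' U'x [_ + _]]; exact.
- apply: IH => -[x v] /= /H[U' U'x [_ _ T]]; by exists (fst @^-1` U').
Qed.

Lemma Ck_pred V W k (U : set V) (f : V -> W) : Ck k.+1 U f -> Ck k U f.
Proof.
elim: k V W U f => [|k IH] V W U f; first by case.
by case=> cf df Tf; split=> //; exact: IH.
Qed.

Lemma Csmooth_eq V W (U : set V) (f g : V -> W) : open U ->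
  (forall x, U x -> f x = g x) -> Csmooth U f -> Csmooth U g.
Proof. by move=> oU fg H k; exact: Ck_eq (H k). Qed.

Lemma Csmooth_subset V W (U U' : set V) (f : V -> W) :
  U' `<=` U -> Csmooth U f -> Csmooth U' f.
Proof. by move=> sU H k; exact: Ck_subset (H k). Qed.

Lemma Csmooth_tangent V W (U : set V) (f : V -> W) :
  Csmooth U f -> Csmooth (fst @^-1` U) (tangent_map f).
Proof. by move=> H k; have [] := H k.+1. Qed.

(** [A'] is the linear part of [A]. Its own additivity and continuity are part of the definition so
    that the class is stable under tangent maps, which the inductions on [k] require. *)
Definition affine_map V W (A A' : V -> W) :=
  [/\ continuous A, continuous A',
      forall x v (h : R), A (x + h *: v) = A x + h *: A' v &
      forall x v (h : R), A' (x + h *: v) = A' x + h *: A' v].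

Lemma affine_map_continuous V W (A A' : V -> W) : affine_map A A' -> continuous A.
Proof. by case. Qed.

Lemma affine_map_tangent V W (A A' : V -> W) : affine_map A A' ->
  affine_map (fun p : V * V => (A p.1, A' p.2)) (fun p => (A' p.1, A' p.2)).
Proof.
case=> cA cA' dA dA'; split.
- move=> p; apply: cvg_pair => /=.
    by apply: continuous_comp; [exact: cvg_fst|exact: cA].
  by apply: continuous_comp; [exact: cvg_snd|exact: cA'].
- move=> p; apply: cvg_pair => /=.
    by apply: continuous_comp; [exact: cvg_fst|exact: cA'].
  by apply: continuous_comp; [exact: cvg_snd|exact: cA'].
- by move=> x v h; rewrite /= dA dA'.
- by move=> x v h; rewrite /= !dA'.
Qed.

Lemma has_der_affine_comp V W Z (f : W -> Z) (A A' : V -> W) x v d :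
  affine_map A A' -> has_der f (A x) (A' v) d -> has_der (f \o A) x v d.
Proof.
case=> _ _ dA _ H e e0; have [r r0 Hr] := H e e0; exists r => // h hr.
by rewrite /= dA; exact: Hr.
Qed.

(** An affine map sends lines to lines, so this case of the chain rule is exact and needs no
    estimate. It is available before strict differentiability and is used to prove the general
    rule. *)
Lemma Ck_affine_comp V W Z k (U : set W) (f : W -> Z) (A A' : V -> W) :
  open U -> affine_map A A' -> Ck k U f -> Ck k (A @^-1` U) (f \o A).
Proof.
elim: k V W Z U f A A' => [|k IH] V W Z U f A A' oU aA.
  move=> H x Ux; apply: continuous_comp; [exact: affine_map_continuous aA _|exact: H].
have der x v : Ck k.+1 U f -> U (A x) ->
    has_der (f \o A) x v (tangent_map f (A x, A' v)).
  by move=> H Ux; apply: (has_der_affine_comp aA); exact: Ck_has_der H _.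
move=> fk; have [cf df Tf] := fk; split.
- move=> x Ux; apply: continuous_comp; [exact: affine_map_continuous aA _|exact: cf].
- by move=> x v Ux; apply: has_der_derivable (der x v fk Ux).
- have := IH _ _ _ _ _ _ _ (open_fst oU) (affine_map_tangent aA) Tf.
  apply: Ck_eq; first apply: open_comp.
  + by move=> p _; exact: affine_map_continuous (affine_map_tangent aA) _.
  + exact: open_fst.
  + by move=> [x v] /= Ux; apply/esym; exact: has_derE (der x v fk Ux).
Qed.

Lemma Ck_affine V W k (U : set V) (A A' : V -> W) : affine_map A A' -> Ck k U A.
Proof.
elim: k V W U A A' => [|k IH] V W U A A' aA; first by move=> x _; exact: affine_map_continuous aA _.
have der x v : has_der A x v (A' v).
  by apply: has_der_affine => h; case: aA.
split; [by move=> x _; exact: affine_map_continuous aA _|by move=> x v _; apply: has_der_derivable (der x v)|].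
have -> : tangent_map A = A' \o snd.
  by apply/funext => -[x v]; exact: has_derE (der x v).
apply: (IH _ _ _ _ (A' \o snd)); case: aA => cA cA' dA dA'; split=> //.
- by move=> p; apply: continuous_comp; [exact: cvg_snd|exact: cA'].
- by move=> p; apply: continuous_comp; [exact: cvg_snd|exact: cA'].
- by move=> x v h /=; rewrite dA'.
- by move=> x v h /=; rewrite dA'.
Qed.

Lemma affine_map_cst V W (a : W) : affine_map (cst a : V -> W) (cst 0).
Proof.
split; [by move=> x; exact: cvg_cst|by move=> x; exact: cvg_cst| |].
- by move=> x v h /=; rewrite scaler0 addr0.
- by move=> x v h /=; rewrite scaler0 addr0.
Qed.

Arguments affine_map_cst {V W} a.

Lemma Ck_cst V W k (U : set V) (a : W) : Ck k U (fun=> a).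
Proof. exact: Ck_affine (affine_map_cst a). Qed.

Lemma affine_map_id V : affine_map (@id V) id.
Proof. by split=> // x; exact: cvg_id. Qed.

Lemma affine_map_fst V W : affine_map (@fst V W) fst.
Proof. by split=> // x; exact: cvg_fst. Qed.

Lemma affine_map_snd V W : affine_map (@snd V W) snd.
Proof. by split=> // x; exact: cvg_snd. Qed.

Lemma affine_map_pair V W Z (A A' : V -> W) (B B' : V -> Z) :
  affine_map A A' -> affine_map B B' ->
  affine_map (fun x => (A x, B x)) (fun x => (A' x, B' x)).
Proof.
case=> cA cA' dA dA' [cB cB' dB dB']; split.
- by move=> x; apply: cvg_pair; [exact: cA|exact: cB].
- by move=> x; apply: cvg_pair; [exact: cA'|exact: cB'].
- by move=> x v h; rewrite dA dB.
- by move=> x v h; rewrite dA' dB'.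
Qed.

Lemma affine_map_comp V W Z (A A' : V -> W) (B B' : W -> Z) :
  affine_map A A' -> affine_map B B' -> affine_map (B \o A) (B' \o A').
Proof.
case=> cA cA' dA dA' [cB cB' dB dB']; split.
- by move=> x; apply: continuous_comp; [exact: cA|exact: cB].
- by move=> x; apply: continuous_comp; [exact: cA'|exact: cB'].
- by move=> x v h /=; rewrite dA dB.
- by move=> x v h /=; rewrite dA' dB'.
Qed.

Lemma affine_mapD V W (A A' B B' : V -> W) :
  affine_map A A' -> affine_map B B' ->
  affine_map (fun x => A x + B x) (fun x => A' x + B' x).
Proof.
case=> cA cA' dA dA' [cB cB' dB dB']; split.
- by move=> x; apply: cvgD; [exact: cA|exact: cB].
- by move=> x; apply: cvgD; [exact: cA'|exact: cB'].
- by move=> x v h; rewrite dA dB scalerDr addrACA.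
- by move=> x v h; rewrite dA' dB' scalerDr addrACA.
Qed.

Lemma affine_mapZ V W (c : R) (A A' : V -> W) :
  affine_map A A' -> affine_map (fun x => c *: A x) (fun x => c *: A' x).
Proof.
case=> cA cA' dA dA'; split.
- by move=> x; apply: cvgZr; exact: cA.
- by move=> x; apply: cvgZr; exact: cA'.
- by move=> x v h; rewrite dA scalerDr !scalerA mulrC.
- by move=> x v h; rewrite dA' scalerDr !scalerA mulrC.
Qed.

Lemma affine_map_scalel V (a : V) : affine_map (fun t : R => t *: a) (fun t => t *: a).
Proof.
split=> [t|t|t v h|t v h]; try exact: scalel_continuous.
- by rewrite scalerDl -scalerA.
- by rewrite scalerDl -scalerA.
Qed.

Lemma affine_map_line V (p v : V) :
  affine_map (fun t : R => p + t *: v) (fun t : R => t *: v).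
Proof.
have [c0 _ d0 _] := affine_map_scalel v; split=> // [t|t w h].
- by apply: cvgD; [exact: cvg_cst|exact: c0].
- by rewrite d0 addrA.
Qed.

End CkTheory.

(** * Strict differentiability, the chain rule and algebraic operations on C^k maps *)

Section CkChain.
Context {R : realType}.
Implicit Types (V W Z : normedModType R) (k : nat).

Lemma has_der_scalev V W (f : V -> W) x v d (c : R) :
  has_der f x v d -> has_der f x (c *: v) (c *: d).
Proof.
move=> H e e0; have c1 : 0 < `|c| + 1 by rewrite ltr_wpDl.
have [r r0 Hr] := H _ (divr_gt0 e0 c1); exists (r / (`|c| + 1)).
  by rewrite divr_gt0.
move=> h hr; have hc : `|h * c| <= `|h| * (`|c| + 1).
  by rewrite normrM ler_wpM2l // lerDl.
rewrite !scalerA; apply: le_trans (Hr (h * c) _) _.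
  by apply: le_lt_trans hc _; rewrite -ltr_pdivlMr.
rewrite mulrAC ler_pdivrMr // -mulrA ler_pM2l //.
Qed.

Lemma tangent_map_scale V W (U : set V) (f : V -> W) x v (c : R) :
  Ck 1 U f -> U x -> tangent_map f (x, c *: v) = c *: tangent_map f (x, v).
Proof.
move=> f1 Ux; apply: has_derE; apply: has_der_scalev.
exact: Ck_has_der f1 Ux.
Qed.

(** Mean value inequality along the segment from p to p + h v, combined with joint continuity of the
    tangent map at (q0, v0). Both the base point and the direction may move; this uniformity is what
    gives the chain rule and the additivity of the derivative. *)
Lemma strict_differentiability V W (U : set V) (f : V -> W) q0 v0 (e : R) :
  open U -> Ck 1 U f -> U q0 -> 0 < e ->
  exists2 r : R, 0 < r & forall p v (h : R),
    `|p - q0| < r -> `|v - v0| < r -> `|h| < r ->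
    `|f (p + h *: v) - f p - h *: tangent_map f (q0, v0)| <= e * `|h|.
Proof.
move=> oU f1 Uq e0; have [_ _ Tf] := f1.
have /continuous_epsP/(_ e e0)[d d0 Hd] := Tf (q0, v0) Uq.
have [m m0 Hm] := open_ball_subset oU Uq.
pose N := `|v0| + 1; have N0 : 0 < N by rewrite ltr_wpDl.
(* The bound [r <= 1] gives |v| <= N; then every point of the segment is within r (N + 1), hence
   within min(d, m), of [q0]. *)
pose r := Num.min 1 (Num.min d m / (N + 1)).
have dm0 : 0 < Num.min d m by rewrite lt_min d0.
have N1 : 0 < N + 1 by lra.
have r0 : 0 < r by rewrite lt_min ltr01 divr_gt0.
have r1 : r <= 1 by rewrite ge_min lexx.
have rm : r * (N + 1) <= Num.min d m.
  by rewrite -ler_pdivlMr // ge_min lexx orbT.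
have rd : r <= Num.min d m by apply: le_trans rm; rewrite ler_peMr ?ltW //; lra.
exists r => // p v h pr vr hr.
have vN : `|v| <= N.
  have := ler_normD (v - v0) v0; rewrite subrK /N; lra.
have inU t : 0 <= t <= 1 -> `|p + (t * h) *: v - q0| < Num.min d m.
  move=> /andP[t0 t1]; rewrite addrAC.
  apply: le_lt_trans (ler_normD _ _) _; rewrite normrZ normrM (ger0_norm t0).
  have : t * `|h| <= r by have := normr_ge0 h; nra.
  have := normr_ge0 v; have := normr_ge0 h; nra.
pose u (t : R) := f (p + (t * h) *: v) - t *: (h *: tangent_map f (q0, v0)).
pose du (t : R) := h *: tangent_map f (p + (t * h) *: v, v)
  - h *: tangent_map f (q0, v0).
have Up t : 0 <= t <= 1 -> U (p + (t * h) *: v).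
  by move=> /inU H; apply: Hm; apply: lt_le_trans H _; rewrite ge_min lexx orbT.
have ud t : 0 <= t <= 1 -> has_der u t 1 (du t).
  move=> t01; apply: has_derB.
    have -> : h *: tangent_map f (p + (t * h) *: v, v) =
       tangent_map f (p + t *: (h *: v), 1 *: (h *: v)).
      by rewrite scale1r scalerA (tangent_map_scale _ _ f1) //; exact: Up.
    have aff : affine_map (fun s : R => p + s *: (h *: v))
        (fun s : R => s *: (h *: v)) := affine_map_line _ _.
    apply: (@has_der_ext _ _ _ (f \o (fun s : R => p + s *: (h *: v)))).
      by move=> s /=; rewrite scalerA.
    apply: (has_der_affine_comp aff).
    by apply: Ck_has_der f1 _; rewrite scalerA; exact: Up.
  apply: has_der_affine => s; rewrite scaler1 scalerDl //.
have := norm_mean_value ler01 ud _ => /(_ (e * `|h|)).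
rewrite /u !mul1r !mul0r !scale0r scale1r !subr0 addr0 mulr1.
rewrite addrAC; apply => t t01.
rewrite /du -scalerBr normrZ mulrC ler_wpM2r // ltW // Hd //.
rewrite prod_normE /= gt_max; apply/andP; split.
  by apply: lt_le_trans (inU t t01) _; rewrite ge_min lexx.
by apply: lt_le_trans vr _; apply: le_trans rd _; rewrite ge_min lexx.
Qed.

Lemma has_der_comp V W Z (U : set W) (f : W -> Z) (g : V -> W) x v d :
  open U -> Ck 1 U f -> U (g x) -> has_der g x v d ->
  has_der (f \o g) x v (tangent_map f (g x, d)).
Proof.
move=> oU f1 Ug gd e e0.
have [r r0 Hr] := strict_differentiability d oU f1 Ug e0.
have [s s0 Hs] := gd _ (divr_gt0 r0 (ltr0Sn R 1)).
exists (Num.min r s); first by rewrite lt_min r0.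
move=> h; rewrite lt_min => /andP[hr hs].
have [->|h0] := eqVneq h 0.
  by rewrite !scale0r addr0 subrr subr0 !normr0 mulr0.
(* The increment of [g] is exactly h w with [w] close to [d], so [f] is differentiated along a
   direction that varies with [h]. *)
pose w := h^-1 *: (g (x + h *: v) - g x).
have wE : g (x + h *: v) = g x + h *: w.
  by rewrite scalerA mulfV // scale1r subrKC.
have wd : `|w - d| < r.
  have := Hs h hs; rewrite wE [g x + _]addrC addrK -scalerBr normrZ mulrC.
  rewrite ler_pM2r ?normr_gt0 // => /le_lt_trans; apply.
  by rewrite ltr_pdivrMr // ltr_pMr // ltrDl.
by rewrite /= wE; apply: Hr => //; rewrite subrr normr0.
Qed.

Lemma has_der_pair V W Z (f : V -> W) (g : V -> Z) x v a b :
  has_der f x v a -> has_der g x v b -> has_der (fun y => (f y, g y)) x v (a, b).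
Proof.
move=> fa gb e e0; have [r r0 Hr] := fa e e0; have [s s0 Hs] := gb e e0.
exists (Num.min r s); first by rewrite lt_min r0.
move=> h; rewrite lt_min => /andP[hr hs].
by rewrite prod_normE /= ge_max Hr // Hs.
Qed.

Lemma Ck_pair V W Z k (U : set V) (f : V -> W) (g : V -> Z) : open U ->
  Ck k U f -> Ck k U g -> Ck k U (fun x => (f x, g x)).
Proof.
elim: k V W Z U f g => [|k IH] V W Z U f g oU fk gk.
  by move=> x Ux; apply: cvg_pair; [exact: fk|exact: gk].
have [cf df Tf] := fk; have [cg dg Tg] := gk.
have der x v : U x -> has_der (fun y => (f y, g y)) x v
    (tangent_map f (x, v), tangent_map g (x, v)).
  by move=> Ux; apply: has_der_pair;
    [exact: Ck_has_der fk Ux|exact: Ck_has_der gk Ux].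
split.
- by move=> x Ux; apply: cvg_pair; [exact: cf|exact: cg].
- by move=> x v /(der x v); exact: has_der_derivable.
- apply: Ck_eq (IH _ _ _ _ _ _ _ Tf Tg); try exact: open_fst.
  by move=> [x v] Ux; apply/esym; exact: has_derE (der x v Ux).
Qed.

Lemma Ck_fst_comp V W Z k (U : set V) (f : V -> Z) : open U -> Ck k U f ->
  Ck k (fst @^-1` U) (fun p : V * W => f p.1).
Proof. by move=> oU; exact: Ck_affine_comp (affine_map_fst V W). Qed.

Lemma Ck_comp V W Z k (U : set W) (U' : set V) (f : W -> Z) (g : V -> W) :
  open U -> open U' -> (forall x, U' x -> U (g x)) ->
  Ck k U f -> Ck k U' g -> Ck k U' (f \o g).
Proof.
elim: k V W Z U U' f g => [|k IH] V W Z U U' f g oU oU' sub fk gk.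
  by move=> x Ux; apply: continuous_comp; [exact: gk|apply: fk; exact: sub].
have [cf df Tf] := fk; have [cg dg Tg] := gk.
have f1 : Ck 1 U f.
  by elim: k {IH gk Tf Tg} fk => // k IH /Ck_pred.
have der x v : U' x -> has_der (f \o g) x v
    (tangent_map f (g x, tangent_map g (x, v))).
  by move=> Ux; apply: (has_der_comp oU f1 (sub x Ux)); exact: Ck_has_der gk Ux.
split.
- by move=> x Ux; apply: continuous_comp; [exact: cg|apply: cf; exact: sub].
- by move=> x v /(der x v); exact: has_der_derivable.
- have gT : Ck k (fst @^-1` U') (fun p : V * V => (g p.1, tangent_map g p)).
    by apply: Ck_pair Tg; [exact: open_fst|apply: Ck_fst_comp => //; exact: Ck_pred].
  apply: Ck_eq (IH _ _ _ _ _ _ _ _ _ _ Tf gT).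
  + exact: open_fst.
  + by move=> [x v] Ux; apply/esym; exact: has_derE (der x v Ux).
  + exact: open_fst.
  + exact: open_fst.
  + by move=> [x v] /= /sub.
Qed.

Lemma CkD V W k (U : set V) (f g : V -> W) : open U ->
  Ck k U f -> Ck k U g -> Ck k U (fun x => f x + g x).
Proof.
move=> oU fk gk; pose A := fun p : W * W => p.1 + p.2.
apply: (@Ck_comp _ _ _ _ setT U A (fun x => (f x, g x))) => //.
- exact: openT.
- have aA : affine_map A A := affine_mapD (affine_map_fst W W) (affine_map_snd W W).
  exact: Ck_affine aA.
- exact: Ck_pair.
Qed.

Lemma Ck_affine_post V W Z k (U : set V) (f : V -> W) (A A' : W -> Z) : open U ->
  affine_map A A' -> Ck k U f -> Ck k U (fun x => A (f x)).
Proof.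
move=> oU aA fk; apply: (@Ck_comp _ _ _ _ setT U A f) => //; first exact: openT.
exact: Ck_affine aA.
Qed.

Lemma CkM V k (U : set V) (f g : V -> R) : open U ->
  Ck k U f -> Ck k U g -> Ck k U (fun x => f x * g x).
Proof.
elim: k V U f g => [|k IH] V U f g oU fk gk.
  by move=> x Ux; apply: cvgM; [exact: fk|exact: gk].
have [cf df Tf] := fk; have [cg dg Tg] := gk.
have der x v : U x -> has_der (fun y => f y * g y) x v
    (f x * tangent_map g (x, v) + tangent_map f (x, v) * g x).
  move=> Ux; have /is_derive_has_der Hf := Ck_has_der v fk Ux.
  have /is_derive_has_der Hg := Ck_has_der v gk Ux.
  apply/is_derive_has_der; apply: is_derive_eq; rewrite /GRing.scale /=; ring.
split.
- by move=> x Ux; apply: cvgM; [exact: cf|exact: cg].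
- by move=> x v /(der x v); exact: has_der_derivable.
- have oF : open (fst @^-1` U : set (V * V)) := open_fst oU.
  apply: (@Ck_eq _ _ _ _ _ (fun p : V * V => f p.1 * tangent_map g p +
     tangent_map f p * g p.1)) => //.
    by move=> [x v] Ux; apply/esym; exact: has_derE (der x v Ux).
  apply: CkD => //; apply: IH => //.
    by apply: Ck_fst_comp => //; exact: Ck_pred.
  by apply: Ck_fst_comp => //; exact: Ck_pred.
Qed.

Lemma CkV V k (U : set V) (f : V -> R) : open U ->
  (forall x, U x -> f x != 0) -> Ck k U f -> Ck k U (fun x => (f x)^-1).
Proof.
elim: k V U f => [|k IH] V U f oU f0 fk.
  by move=> x Ux; apply: cvgV; [exact: f0|exact: fk].
have [cf df Tf] := fk.
have der x v : U x -> has_der (fun y => (f y)^-1) x v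
    ((-1) * ((f x)^-1 * ((f x)^-1 * tangent_map f (x, v)))).
  move=> Ux; apply/is_derive_has_der; have Hd := df x v Ux.
  apply: DeriveDef; first by apply: derivableV => //; exact: f0.
  rewrite deriveV ?f0 // /tangent_map /= /GRing.scale /= expr2 invfM.
  by rewrite mulN1r mulNr mulrA.
split.
- by move=> x Ux; apply: cvgV; [exact: f0|exact: cf].
- by move=> x v /(der x v); exact: has_der_derivable.
- have oF : open (fst @^-1` U : set (V * V)) := open_fst oU.
  have fV : Ck k (fst @^-1` U) (fun p : V * V => (f p.1)^-1).
    apply: IH => //; first by move=> p /f0.
    by apply: Ck_fst_comp => //; exact: Ck_pred.
  apply: (@Ck_eq _ _ _ _ _ (fun p : V * V =>
      (-1) * ((f p.1)^-1 * ((f p.1)^-1 * tangent_map f p)))) => //.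
    by move=> [x v] Ux; apply/esym; exact: has_derE (der x v Ux).
  apply: CkM => //; first exact: Ck_cst.
  by do 2!apply: CkM => //.
Qed.

(** [Ck] only asks for derivatives in each direction separately, so additivity needs an argument:
    the step h v is made first, and the step h w starts at the displaced point x + h v, where strict
    differentiability still applies. *)
Lemma tangent_mapD V W (U : set V) (f : V -> W) x v w :
  open U -> Ck 1 U f -> U x ->
  tangent_map f (x, v + w) = tangent_map f (x, v) + tangent_map f (x, w).
Proof.
move=> oU f1 Ux; apply: has_derE => e e0.
have e2 : 0 < e / 2 by rewrite divr_gt0.
have [r r0 Hr] := Ck_has_der v f1 Ux e2.
have [s s0 Hs] := strict_differentiability w oU f1 Ux e2.
have v1 : 0 < `|v| + 1 by rewrite ltr_wpDl.
exists (Num.min r (Num.min s (s / (`|v| + 1)))).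
  by rewrite !lt_min r0 s0 divr_gt0.
move=> h; rewrite !lt_min => /and3P[hr hs]; rewrite ltr_pdivlMr // => hv.
have A := Hr h hr; have := Hs (x + h *: v) w h.
rewrite subrr normr0 [x + _ - x]addrC addKr normrZ => /(_ _ s0 hs) B.
have {}B := B (le_lt_trans (ler_wpM2l (normr_ge0 h) (ler_wpDr ler01 (lexx _))) hv).
have -> : f (x + h *: (v + w)) - f x
    - h *: (tangent_map f (x, v) + tangent_map f (x, w)) =
  (f (x + h *: v) - f x - h *: tangent_map f (x, v)) +
  (f (x + h *: v + h *: w) - f (x + h *: v) - h *: tangent_map f (x, w)).
  rewrite !scalerDr addrA; move: (f _) (f _) (f _) => a b c.
  by rewrite opprD [RHS](AC (3*3) ((4*2*(3*6))*(1*5))) /= subrr addr0.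
apply: le_trans (ler_normD _ _) _; nra.
Qed.

End CkChain.

(** * Flows and their dependence on initial conditions *)

Section LocalEstimates.
Context {R : realType}.
Implicit Types (V W E : normedModType R).

Lemma tangent_map0 V W (U : set V) (f : V -> W) x :
  Ck 1 U f -> U x -> tangent_map f (x, 0) = 0.
Proof. by move=> f1 Ux; rewrite -(scale0r 0) (tangent_map_scale _ _ f1) // scale0r. Qed.

(** Strict differentiability at the direction 0, where the tangent map vanishes. The difference p -
    p' is written h v with |v| = r / 2 and h = 2 |p - p'| / r; the bound r^2 / 4 on the radius
    ensures h < r. *)
Lemma C1_locally_lipschitz V W (U : set V) (f : V -> W) q0 :
  open U -> Ck 1 U f -> U q0 ->
  exists2 r : R, 0 < r & forall p p', `|p - q0| < r -> `|p' - q0| < r ->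
    `|f p - f p'| <= r^-1 * `|p - p'|.
Proof.
move=> oU f1 Uq; have [r r0 Hr] := strict_differentiability 0 oU f1 Uq ltr01.
pose s := Num.min r (Num.min (r ^+ 2 / 4) (r / 2)).
have s0 : 0 < s by rewrite !lt_min r0 !divr_gt0 // exprn_gt0.
have sr : s <= r by rewrite ge_min lexx.
have srr : s <= r ^+ 2 / 4 by rewrite !ge_min lexx !orbT.
have sr2 : s <= r / 2 by rewrite !ge_min lexx !orbT.
exists s => // p p' ps p's.
have [->|pp] := eqVneq p p'; first by rewrite !subrr !normr0 mulr0.
have n0 : 0 < `|p - p'| by rewrite normr_gt0 subr_eq0.
have nn : `|p - p'| < 2 * s.
  have := ler_distD q0 p p'; rewrite (distrC q0 p'); lra.
pose h := 2 * `|p - p'| / r; pose v := (r / 2 / `|p - p'|) *: (p - p').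
have h0 : 0 < h by rewrite divr_gt0 // mulr_gt0.
have hv : h *: v = p - p'.
  rewrite scalerA /h; have -> : 2 * `|p - p'| / r * (r / 2 / `|p - p'|) = 1.
    by field; rewrite !gt_eqF.
  by rewrite scale1r.
have := Hr p' v h (lt_le_trans p's sr).
rewrite hv subrKC (tangent_map0 f1) // scaler0 !subr0 mul1r gtr0_norm //.
rewrite normrZ gtr0_norm ?divr_gt0 // mulfVK ?gt_eqF //.
move=> /(_ _ _)/le_trans; apply.
- lra.
- rewrite ltr_pdivrMr //; move: srr; rewrite expr2; lra.
- rewrite /h mulrAC ler_pM2r //.
  by rewrite ler_pdivrMr // mulrC ler_pdivlMr //; lra.
Qed.

(* The single radius r also bounds the constants, by 1/r; so the estimates are
   monotone in r and can be made uniform along a compact segment. *)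
Definition C2_estimates V W (U : set V) (f : V -> W) (q0 : V) (r : R) :=
  forall p, `|p - q0| < r ->
  [/\ U p,
      forall p', `|p' - q0| < r -> `|f p - f p'| <= r^-1 * `|p - p'|,
      forall w, `|tangent_map f (p, w)| <= r^-1 * `|w| &
      forall w, `|w| < r ->
        `|f (p + w) - f p - tangent_map f (p, w)| <= r^-1 * `|w| ^+ 2].

Lemma C2_estimates_le V W (U : set V) (f : V -> W) q0 q1 (r s : R) :
  0 < s -> s + `|q1 - q0| <= r -> C2_estimates U f q0 r -> C2_estimates U f q1 s.
Proof.
move=> s0 sr H p ps.
have near z : `|z - q1| < s -> `|z - q0| < r.
  move=> zs; have := ler_distD q1 z q0; lra.
have sr' : s <= r by have := normr_ge0 (q1 - q0); lra.
have rs : r^-1 <= s^-1 by rewrite lef_pV2 // posrE; lra.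
have [Up Lp Tp Qp] := H p (near p ps); split=> //.
- by move=> p' /near /Lp /le_trans; apply; rewrite ler_wpM2r.
- by move=> w; apply: le_trans (Tp w) _; rewrite ler_wpM2r.
- move=> w ws; apply: le_trans (Qp w (lt_le_trans ws sr')) _.
  by rewrite ler_wpM2r // exprn_ge0.
Qed.

(** The tangent map is C^1, hence Lipschitz near (q0, 0). Homogeneity in the direction extends this
    to vectors of any length, after rescaling them to length r2 / 2; the quadratic remainder then
    comes from the mean value inequality on the segment from p to p + w. *)
Lemma C2_locally V W (U : set V) (f : V -> W) q0 :
  open U -> Ck 2 U f -> U q0 -> exists2 r : R, 0 < r & C2_estimates U f q0 r.
Proof.
move=> oU f2 Uq; have f1 := Ck_pred f2; have [_ _ T1] := f2.
have [r1 r10 H1] := C1_locally_lipschitz oU f1 Uq.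
have [m m0 Hm] := open_ball_subset oU Uq.
have oF : open (fst @^-1` U : set (V * V)) := open_fst oU.
have [r2 r20 H2] := @C1_locally_lipschitz _ _ _ _ (q0, 0) oF T1 Uq.
have H3 y y' w : `|y - q0| < r2 -> `|y' - q0| < r2 -> U y -> U y' ->
    `|tangent_map f (y, w) - tangent_map f (y', w)|
      <= 2 / r2 ^+ 2 * `|w| * `|y - y'|.
  move=> yr y'r Uy Uy'; have [->|w0] := eqVneq w 0.
    by rewrite !(tangent_map0 f1) // subrr !normr0 mulr0 mul0r.
  have nw : 0 < `|w| by rewrite normr_gt0.
  have c0 : 0 < r2 / 2 / `|w| by rewrite !divr_gt0.
  have ncw : `|r2 / 2 / `|w| *: w| < r2.
    rewrite normrZ gtr0_norm // mulfVK ?gt_eqF //; lra.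
  have := H2 (y, r2 / 2 / `|w| *: w) (y', r2 / 2 / `|w| *: w).
  rewrite !prod_normE /= !gt_max !subr0 ncw yr y'r subrr normr0 => /(_ isT isT).
  rewrite !(tangent_map_scale _ _ f1) // -scalerBr normrZ gtr0_norm //.
  rewrite max_l // -ler_pdivlMl // => /le_trans; apply.
  by rewrite le_eqVlt; apply/orP; left; apply/eqP; field; rewrite !gt_eqF.
have H4 y w : `|y - q0| < r2 -> U y -> `|tangent_map f (y, w)| <= r2^-1 * `|w|.
  move=> yr Uy; have [->|w0] := eqVneq w 0.
    by rewrite !(tangent_map0 f1) // !normr0 mulr0.
  have nw : 0 < `|w| by rewrite normr_gt0.
  have c0 : 0 < r2 / 2 / `|w| by rewrite !divr_gt0.
  have ncw : `|r2 / 2 / `|w| *: w| < r2.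
    rewrite normrZ gtr0_norm // mulfVK ?gt_eqF //; lra.
  have := H2 (y, r2 / 2 / `|w| *: w) (y, 0).
  rewrite !prod_normE /= !gt_max !subr0 ncw yr subrr normr0 r20 => /(_ isT isT).
  rewrite !(tangent_map_scale _ _ f1) // (tangent_map0 f1) // subr0 normrZ gtr0_norm //.
  rewrite max_r // normrZ gtr0_norm // mulfVK ?gt_eqF // -ler_pdivlMl // => /le_trans; apply.
  by rewrite le_eqVlt; apply/orP; left; apply/eqP; field; rewrite !gt_eqF.
pose r := Num.min r1 (Num.min (m / 2) (Num.min (r2 / 2) (r2 ^+ 2 / 2))).
have r0 : 0 < r by rewrite !lt_min r10 !divr_gt0 // exprn_gt0.
have rr1 : r <= r1 by rewrite ge_min lexx.
have rm : r <= m / 2 by rewrite !ge_min lexx !orbT.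
have rr2 : r <= r2 / 2 by rewrite !ge_min lexx !orbT.
have rr3 : 2 / r2 ^+ 2 <= r^-1.
  rewrite -[2 / _]invrK lef_pV2 ?posrE ?invr_gt0 ?divr_gt0 ?exprn_gt0 //.
  by rewrite invf_div !ge_min lexx !orbT.
exists r => // p pr; have Up : U p by apply: Hm; lra.
split=> //.
- move=> p' p'r; apply: le_trans (H1 p p' _ _) _; try lra.
  by rewrite ler_wpM2r // lef_pV2 ?posrE.
- move=> w; apply: le_trans (H4 p w _ Up) _; first lra.
  by rewrite ler_wpM2r // lef_pV2 ?posrE //; lra.
- move=> w wr.
  have near t : 0 <= t <= 1 -> `|p + t *: w - q0| < 2 * r.
    move=> /andP[t0 t1]; rewrite addrAC; apply: le_lt_trans (ler_normD _ _) _.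
    rewrite normrZ ger0_norm //; have := normr_ge0 w; nra.
  have nearU t : 0 <= t <= 1 -> U (p + t *: w).
    by move=> /near ?; apply: Hm; lra.
  have := @norm_mean_value R W 1 (r^-1 * `|w| ^+ 2)
    (fun t => f (p + t *: w) - t *: tangent_map f (p, w))
    (fun t => tangent_map f (p + t *: w, w) - tangent_map f (p, w)) ler01.
  rewrite !scale1r !scale0r addr0 subr0 mulr1 [f (p + w) - _ - _]addrAC; apply.
    move=> t t01; apply: has_derB.
      apply: (has_der_affine_comp (affine_map_line p w)); rewrite scale1r.
      by apply: Ck_has_der f1 _; exact: nearU.
    by apply: has_der_affine => s; rewrite scaler1 scalerDl.
  move=> t t01; have := near t t01 => n1.
  apply: le_trans (H3 _ _ _ _ _ (nearU t t01) Up) _; try lra.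
  rewrite [p + _]addrC addrK normrZ ger0_norm; last by case/andP: t01.
  rewrite -mulrA; apply: ler_pM => //.
  - by rewrite divr_ge0 // exprn_ge0 // ltW.
  - by rewrite !mulr_ge0 //; case/andP: t01.
  - rewrite expr2 ler_wpM2l // ler_piMl //; by case/andP: t01.
Qed.

(** Compactness of [0, T] in its filter form: a property that holds near each t for all sufficiently
    small positive r holds on the whole segment for one r. *)
Lemma segment_uniform (T : R) (P : R -> R -> Prop) :
  (forall t, 0 <= t <= T -> exists2 d : R, 0 < d &
     forall s r, `|s - t| < d -> 0 < r < d -> P r s) ->
  exists2 r : R, 0 < r & forall t, 0 <= t <= T -> P r t.
Proof.
move=> H.
have /compact_near_coveringP/(_ R 0^'+ P _) := @segment_compact R 0 T.
have HH : forall x, `[0, T]%classic x -> \forall x' \near x & i \near 0^'+, P i x'.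
  move=> x; rewrite /= in_itv /= => /H[d d0 Hd].
  exists (ball x d, [set r | 0 < r < d]) => /=.
    split; first exact: nbhsx_ballx.
    by near=> r; apply/andP; split; near: r; [exact: nbhs_right_gt|exact: nbhs_right_lt].
  by move=> [s r] /= [xs rd]; apply: Hd => //; move: xs; rewrite /ball /= distrC.
move=> /(_ HH) H1.
have [r [r0 Hr]] : exists r : R, 0 < r /\ (`[0, T]%classic `<=` P r).
  apply: (@filter_ex _ (0 : R)^'+); apply: filterI => //; exact: nbhs_right_gt.
by exists r => // t tT; apply: Hr; rewrite /= in_itv.
Unshelve. all: by end_near.
Qed.

Lemma C2_estimates_along E (U : set E) (G : E -> E) (T : R) (g : R -> E) :
  open U -> Ck 2 U G ->
  (forall t, 0 <= t <= T -> U (g t) /\ {for t, continuous g}) ->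
  exists2 r : R, 0 < r & forall t, 0 <= t <= T -> C2_estimates U G (g t) r.
Proof.
move=> oU G2 Hg; apply: (@segment_uniform T (fun r t => C2_estimates U G (g t) r)).
move=> t /Hg[Ut ct]; have [r r0 Hr] := C2_locally oU G2 Ut.
have [d d0 Hd] := (continuous_epsP _ _).1 ct _ (divr_gt0 r0 (ltr0Sn R 1)).
exists (Num.min d (r / 2)); first by rewrite lt_min d0 divr_gt0.
move=> s r'; rewrite !lt_min => /andP[sd _] /and3P[r'0 _ r'r].
apply: C2_estimates_le Hr => //; have := Hd s sd; lra.
Qed.

End LocalEstimates.

(** Completeness in terms of sequences, a form that passes easily to E * E and so to all iterated
    tangent lifts. *)
Definition seq_complete (R : realType) (E : normedModType R) :=
  forall u : nat -> E,
    (forall e : R, 0 < e -> exists N, forall m n, (N <= m)%N -> (N <= n)%N ->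
       `|u m - u n| <= e) ->
    exists l, forall e : R, 0 < e -> exists N, forall n, (N <= n)%N -> `|u n - l| <= e.

Lemma seq_complete_prod (R : realType) (E F : normedModType R) :
  seq_complete E -> seq_complete F -> seq_complete (E * F)%type.
Proof.
move=> cE cF u Hu.
have [|l Hl] := cE (fst \o u).
  move=> e /Hu[N HN]; exists N => m n Nm Nn.
  by have := HN m n Nm Nn; rewrite prod_normE /= ge_max => /andP[].
have [|l' Hl'] := cF (snd \o u).
  move=> e /Hu[N HN]; exists N => m n Nm Nn.
  by have := HN m n Nm Nn; rewrite prod_normE /= ge_max => /andP[].
exists (l, l') => e e0; have [N HN] := Hl e e0; have [N' HN'] := Hl' e e0.
exists (maxn N N') => n; rewrite geq_max => /andP[n1 n2].
by rewrite prod_normE /= ge_max HN // HN'.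
Qed.

(** A family of integral curves with a common lifetime and no group law, so that its tangent lift is
    checked to be of the same kind clause by clause. *)
Definition is_flow (R : realType) (E : normedModType R) (U : set E) (G : E -> E)
    (a : R) (Q : set E) (Phi : R -> E -> E) :=
  [/\ forall q, Q q -> Phi 0 q = q,
      forall t q, `|t| < a -> Q q -> U (Phi t q) &
      forall t q, `|t| < a -> Q q -> has_der (Phi^~ q) t 1 (G (Phi t q))].

Section Flows.
Context {R : realType}.
Implicit Types (E V W : normedModType R).

Lemma has_der_reverse E (f : R -> E) t d :
  has_der f (- t) 1 d -> has_der (fun s => f (- s)) t 1 (- d).
Proof.
move=> H.
have aff : affine_map (-%R : R -> R) -%R.
  split=> [x|x|x v h|x v h]; try exact: opp_continuous.
  - by rewrite opprD scalerN.
  - by rewrite opprD scalerN.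
apply: (has_der_affine_comp aff).
by have := has_der_scalev (-1) H; rewrite !scaleN1r.
Qed.

Lemma is_flow_reverse E (U Q : set E) G (a : R) Phi : is_flow U G a Q Phi ->
  is_flow U (fun q => - G q) a Q (fun t => Phi (- t)).
Proof.
case=> F0 FU Fd; split=> [q Vq|t q ta Vq|t q ta Vq].
- by rewrite oppr0 F0.
- by apply: FU => //; rewrite normrN.
- apply: (@has_der_reverse E (Phi^~ q)); by apply: Fd => //; rewrite normrN.
Qed.

Lemma CkN V W k (U : set V) (f : V -> W) : open U -> Ck k U f ->
  Ck k U (fun x => - f x).
Proof.
move=> oU fk; apply: (@Ck_affine_post R _ _ _ _ _ _ -%R -%R) fk => //.
split=> [x|x|x v h|x v h]; try exact: opp_continuous.
- by rewrite opprD scalerN.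
- by rewrite opprD scalerN.
Qed.

Lemma tangent_mapN V W (U : set V) (f : V -> W) p : Ck 1 U f -> U p.1 ->
  tangent_map (fun x => - f x) p = - tangent_map f p.
Proof.
case: p => x v f1 Ux; apply: has_derE; have /is_derive_has_der H := Ck_has_der v f1 Ux.
by apply/is_derive_has_der.
Qed.

(** Gronwall is applied twice: first against the trajectory of [q], to confine nearby trajectories
    to the tube where the estimates for [G] are uniform; then between two trajectories of that
    tube. *)
Lemma flow_lipschitz_forward E (U Q : set E) G (a T : R) Phi q :
  open U -> open Q -> Ck 2 U G -> is_flow U G a Q Phi -> Q q -> 0 <= T < a ->
  exists r C : R, [/\ 0 < r, 0 < C & forall x y, `|x - q| < r -> `|y - q| < r ->
    [/\ Q x, Q y & forall t, 0 <= t <= T -> `|Phi t x - Phi t y| <= C * `|x - y|]].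
Proof.
move=> oU oV G2 [F0 FU Fd] Vq /andP[T0 Ta].
have ta t : 0 <= t <= T -> `|t| < a.
  by move=> /andP[t0 tT]; rewrite ger0_norm //; lra.
have [|r r0 Hr] := @C2_estimates_along R E U G T (Phi^~ q) oU G2.
  move=> t /ta tT; split; first exact: FU.
  by apply: has_der_continuousR; exact: Fd.
pose K := expR ((r^-1 + 1) * T); have K0 : 0 < K by exact: expR_gt0.
have r'0 : 0 <= r^-1 by rewrite invr_ge0 ltW.
have [m m0 Hm] := open_ball_subset oV Vq.
(* With |x - q| and the slack of Gronwall both at most r / (8 K), the deviation stays below r / 4,
   inside the radius r / 2 where the inequality is used. *)
pose s := Num.min m (r / (8 * K)).
have rK : 0 < r / (8 * K) by rewrite divr_gt0 // mulr_gt0.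
have s0 : 0 < s by rewrite lt_min m0.
have sK : s <= r / (8 * K) by rewrite ge_min lexx orbT.
have inV x : `|x - q| < s -> Q x.
  by move=> xs; apply: Hm; apply: lt_le_trans xs _; rewrite ge_min lexx.
have tube x : `|x - q| < s -> forall t, 0 <= t <= T -> `|Phi t x - Phi t q| < r.
  move=> xs; have Vx := inV x xs.
  have := @gronwall R E T r^-1 `|x - q| (r / (8 * K)) 0 (r / 2)
    (fun t => Phi t x - Phi t q) (fun t => G (Phi t x) - G (Phi t q)).
  have bnd : (`|x - q| + r / (8 * K)) * K <= r / 4.
    have -> : r / 4 = (r / (8 * K) + r / (8 * K)) * K.
      by field; rewrite gt_eqF.
    by rewrite ler_pM2r //; lra.
  move=> H t tT; apply: (@le_lt_trans _ _ (r / 4)); last lra.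
  have bnd' := bnd; apply: le_trans bnd'; apply: H => //.
  - by move=> t' /ta t'T; apply: has_derB; exact: Fd.
  - by rewrite !F0.
  - rewrite -/K; apply: le_trans bnd _; lra.
  - move=> t' t'T ur; rewrite addr0.
    have [|_ L _ _] := Hr t' t'T (Phi t' x); first lra.
    by apply: L; rewrite subrr normr0.
exists s, (2 * K); split=> //; first by rewrite mulr_gt0.
move=> x y xs ys; have Vx := inV x xs; have Vy := inV y ys; split=> // t tT.
have [->|xy] := eqVneq x y; first by rewrite !subrr !normr0 mulr0.
have n0 : 0 < `|x - y| by rewrite normr_gt0 subr_eq0.
have := @gronwall R E T r^-1 `|x - y| `|x - y| 0 (2 * K * `|x - y|)
    (fun t => Phi t x - Phi t y) (fun t => G (Phi t x) - G (Phi t y)).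
have E2 : (`|x - y| + `|x - y|) * K = 2 * K * `|x - y| by ring.
rewrite -/K E2 => H; apply: H => //.
- by move=> t' /ta t'T; apply: has_derB; exact: Fd.
- by rewrite !F0.
- move=> t' t'T _; rewrite addr0.
  have [_ L _ _] := Hr t' t'T (Phi t' x) (tube x xs t' t'T).
  by apply: L; exact: tube.
Qed.

Definition diff_quotient E (Phi : R -> E -> E) q v (h t : R) : E :=
  h^-1 *: (Phi t (q + h *: v) - Phi t q).

(** The quotients solve the variational equation up to O(h), and they are Cauchy as h tends to 0,
    both uniformly for t in [D]. *)
Definition quotient_estimates E (Q : set E) G (Phi : R -> E -> E) q v
    (D : set R) (h0 C : R) :=
  forall h, 0 < `|h| < h0 -> Q (q + h *: v) /\ forall t, D t ->
    `|diff_quotient (fun t x => G (Phi t x)) q v h t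
      - tangent_map G (Phi t q, diff_quotient Phi q v h t)| <= C * `|h| /\
    (forall k, 0 < `|k| < h0 ->
      `|diff_quotient Phi q v h t - diff_quotient Phi q v k t| <= C * (`|h| + `|k|)).

Lemma diff_quotient_has_der E (U Q : set E) G (a : R) Phi q v (h t : R) :
  is_flow U G a Q Phi -> Q q -> Q (q + h *: v) -> `|t| < a ->
  has_der (diff_quotient Phi q v h) t 1 (diff_quotient (fun t x => G (Phi t x)) q v h t).
Proof.
by case=> _ _ Fd Vq Vh ta; apply: has_derZ; apply: has_derB; exact: Fd.
Qed.

(** The first estimate is the quadratic Taylor remainder of [G], applied to a displacement of size
    O(h) and divided by h. For the second, the difference of two quotients vanishes at time 0, where
    both equal [v], and solves a linear inequality with error C1 (|h| + |k|); Gronwall concludes. *)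
Lemma quotient_estimates_forward E (U Q : set E) G (a T : R) Phi q v :
  open U -> open Q -> Ck 2 U G -> is_flow U G a Q Phi -> Q q -> 0 <= T < a ->
  exists h0 C : R, [/\ 0 < h0, 0 < C &
    quotient_estimates Q G Phi q v [set t | 0 <= t <= T] h0 C].
Proof.
move=> oU oV G2 HF Vq TT; have [F0 FU Fd] := HF; have /andP[T0 Ta] := TT.
have G1 := Ck_pred G2.
have ta t : 0 <= t <= T -> `|t| < a.
  by move=> /andP[t0 tT]; rewrite ger0_norm //; lra.
have [s [C [s0 C0 HC]]] := flow_lipschitz_forward oU oV G2 HF Vq TT.
have [|r r0 Hr] := @C2_estimates_along R E U G T (Phi^~ q) oU G2.
  move=> t /ta tT; split; first exact: FU.
  by apply: has_der_continuousR; exact: Fd.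
pose K := expR ((r^-1 + 1) * T); have K0 : 0 < K by exact: expR_gt0.
have r'0 : 0 < r^-1 by rewrite invr_gt0.
pose N := `|v| + 1; have N0 : 0 < N by rewrite ltr_wpDl.
have vN : `|v| <= N by rewrite lerDl.
pose h0 := Num.min (s / N) (r / (C * N)).
have h00 : 0 < h0 by rewrite lt_min !divr_gt0 // mulr_gt0.
pose C1 := r^-1 * (C * N) ^+ 2.
have C10 : 0 < C1 by rewrite mulr_gt0 // exprn_gt0 // mulr_gt0.
have close h : 0 < `|h| < h0 -> `|q + h *: v - q| < s.
  move=> /andP[_]; rewrite lt_min ltr_pdivlMr // => /andP[hs _].
  rewrite addrC addKr normrZ; apply: le_lt_trans hs.
  by rewrite ler_wpM2l.
have Lip h t : 0 < `|h| < h0 -> 0 <= t <= T ->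
    `|Phi t (q + h *: v) - Phi t q| <= C * N * `|h|.
  move=> hh tT; have [|_ _ L] := HC (q + h *: v) q (close h hh).
    by rewrite subrr normr0.
  apply: le_trans (L t tT) _; rewrite [q + _]addrC addrK normrZ.
  by rewrite -mulrA ler_pM2l // mulrC ler_wpM2r.
have E1 h t : 0 < `|h| < h0 -> 0 <= t <= T ->
    `|diff_quotient (fun t x => G (Phi t x)) q v h t
      - tangent_map G (Phi t q, diff_quotient Phi q v h t)| <= C1 * `|h|.
  move=> hh tT; have /andP[hpos] := hh; rewrite lt_min => /andP[_].
  rewrite ltr_pdivlMr ?mulr_gt0 // => hr.
  have L := Lip h t hh tT; have Ut := FU _ _ (ta t tT) Vq.
  have [|_ _ _ Qd] := Hr t tT (Phi t q); first by rewrite subrr normr0.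
  have := Qd (Phi t (q + h *: v) - Phi t q); rewrite subrKC => {}Qd.
  rewrite /diff_quotient (tangent_map_scale _ _ G1) // -scalerBr normrZ normfV.
  rewrite mulrC ler_pdivrMr //; apply: le_trans (Qd _) _.
    by apply: le_lt_trans L _; rewrite mulrC.
  rewrite /C1 -!mulrA ler_pM2l // -expr2.
  have -> : C * (N * (C * (N * `|h| ^+ 2))) = (C * N * `|h|) ^+ 2 by ring.
  have CN0 : 0 <= C * N by rewrite mulr_ge0 // ltW.
  by apply: lerXn2r L => //; rewrite nnegrE // mulr_ge0.
exists h0, (Num.max C1 (2 * C1 * K)); split=> //.
  by rewrite lt_max C10.
move=> h hh; split.
  by have [|] := HC (q + h *: v) q (close h hh); rewrite ?subrr ?normr0.
move=> t tT; split.
  apply: le_trans (E1 h t hh tT) _; rewrite ler_pM2r ?le_max ?lexx //.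
  by case/andP: hh.
move=> k kk; have Vh : Q (q + h *: v).
  by have [|] := HC (q + h *: v) q (close h hh); rewrite ?subrr ?normr0.
have Vk : Q (q + k *: v).
  by have [|] := HC (q + k *: v) q (close k kk); rewrite ?subrr ?normr0.
have hpos : 0 < `|h| by case/andP: hh.
have kpos : 0 < `|k| by case/andP: kk.
have e0 : 0 < C1 * (`|h| + `|k|) by rewrite mulr_gt0 // addr_gt0.
pose dG h t := diff_quotient (fun t x => G (Phi t x)) q v h t.
have := @gronwall R E T r^-1 0 (2 * (C1 * (`|h| + `|k|))) (C1 * (`|h| + `|k|))
  (2 * (C1 * (`|h| + `|k|)) * K)
  (fun t => diff_quotient Phi q v h t - diff_quotient Phi q v k t)
  (fun t => dG h t - dG k t).
rewrite add0r -/K => H.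
apply: (@le_trans _ _ (2 * (C1 * (`|h| + `|k|)) * K)).
  apply: H => //; try lra.
  - move=> t' /ta t'T; apply: has_derB;
    exact: diff_quotient_has_der HF _ _ _.
  - rewrite /diff_quotient !F0 // [q + h *: v]addrC [q + k *: v]addrC !addrK.
    rewrite !scalerA !mulVf; last 2 first.
    + by rewrite -normr_eq0 gt_eqF.
    + by rewrite -normr_eq0 gt_eqF.
    by rewrite subrr normr0.
  - move=> t' t'T _.
    have A := E1 h t' hh t'T; have B := E1 k t' kk t'T.
    have Ut := FU _ _ (ta t' t'T) Vq.
    have [|_ _ L _] := Hr t' t'T (Phi t' q); first by rewrite subrr normr0.
    have := L (diff_quotient Phi q v h t' - diff_quotient Phi q v k t').
    rewrite (tangent_mapD _ _ oU G1) // -scaleN1r (tangent_map_scale _ (-1) G1) // !scaleN1r.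
    set X := tangent_map _ _; set Y := tangent_map _ _; set Z := `|_ - _| => {}L.
    have -> : dG h t' - dG k t' = (dG h t' - X) - (dG k t' - Y) + (X - Y).
      by rewrite opprB [RHS](AC (2*2*2) ((1*4)*((2*5)*(3*6)))) /= addNr subrr !addr0.
    apply: le_trans (ler_normD _ _) _.
    have := ler_normB (dG h t' - X) (dG k t' - Y).
    have {}A : `|dG h t' - X| <= C1 * `|h| := A.
    have {}B : `|dG k t' - Y| <= C1 * `|k| := B.
    rewrite -/Z mulrDr; lra.
have -> : 2 * (C1 * (`|h| + `|k|)) * K = 2 * C1 * K * (`|h| + `|k|) by ring.
by rewrite ler_pM2r ?addr_gt0 // le_max lexx orbT.
Qed.

End Flows.

(** * The derivative of a flow in its initial point, and smoothness of all orders *)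

Section FlowSmoothness.
Context {R : realType}.
Implicit Types (E F V W : normedModType R).

(** Negative times are positive times of the reversed flow, whose field is -G. *)
Lemma flow_lipschitz E (U Q : set E) G (a T : R) Phi q :
  open U -> open Q -> Ck 2 U G -> is_flow U G a Q Phi -> Q q -> 0 <= T < a ->
  exists r C : R, [/\ 0 < r, 0 < C & forall x, `|x - q| < r ->
    Q x /\ forall t, `|t| <= T -> `|Phi t x - Phi t q| <= C * `|x - q|].
Proof.
move=> oU oQ G2 HF Qq TT.
have [r1 [C1 [r10 C10 H1]]] := flow_lipschitz_forward oU oQ G2 HF Qq TT.
have [r2 [C2 [r20 C20 H2]]] :=
  flow_lipschitz_forward oU oQ (CkN oU G2) (is_flow_reverse HF) Qq TT.
exists (Num.min r1 r2), (Num.max C1 C2).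
rewrite lt_min lt_max r10 r20 C10; split=> // x; rewrite lt_min => /andP[x1 x2].
have [|Qx _ L1] := H1 x q x1; first by rewrite subrr normr0.
have [|_ _ L2] := H2 x q x2; first by rewrite subrr normr0.
split=> // t; have [t0|t0] := leP 0 t.
  rewrite ger0_norm // => tT; apply: le_trans (L1 t _) _; first by rewrite t0.
  by rewrite ler_wpM2r // le_max lexx.
rewrite ltr0_norm // => tT; have := L2 (- t); rewrite opprK => {}L2.
apply: le_trans (L2 _) _; first by rewrite tT andbT; lra.
by rewrite ler_wpM2r // le_max lexx orbT.
Qed.

Lemma flow_quotient_estimates E (U Q : set E) G (a T : R) Phi q v :
  open U -> open Q -> Ck 2 U G -> is_flow U G a Q Phi -> Q q -> 0 <= T < a ->
  exists h0 C : R, [/\ 0 < h0, 0 < C &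
    quotient_estimates Q G Phi q v [set t | `|t| <= T] h0 C].
Proof.
move=> oU oQ G2 HF Qq TT; have [F0 FU Fd] := HF.
have [h1 [C1 [h10 C10 H1]]] := quotient_estimates_forward v oU oQ G2 HF Qq TT.
have [h2 [C2 [h20 C20 H2]]] :=
  quotient_estimates_forward v oU oQ (CkN oU G2) (is_flow_reverse HF) Qq TT.
exists (Num.min h1 h2), (Num.max C1 C2).
rewrite lt_min lt_max h10 h20 C10; split=> // h.
rewrite lt_min => /and3P[h00 hh1 hh2].
have [|Qh {}H1] := H1 h; first by rewrite h00.
have [|_ {}H2] := H2 h; first by rewrite h00.
split=> // t /= tT; have [t0|t0] := leP 0 t.
  rewrite ger0_norm // in tT; have [|A B] := H1 t; first by rewrite /= t0.
  split; first by apply: le_trans A _; rewrite ler_wpM2r // le_max lexx.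
  move=> k; rewrite lt_min => /and3P[k0 k1 k2]; apply: le_trans (B k _) _.
    by rewrite k0.
  by rewrite ler_wpM2r ?addr_ge0 // le_max lexx.
have ta : `|t| < a by case/andP: TT => _; exact: le_lt_trans.
rewrite ltr0_norm // in tT; have [|A B] := H2 (- t).
  by rewrite /= tT andbT; lra.
split.
  have -> : `|diff_quotient (fun t x => G (Phi t x)) q v h t -
     tangent_map G (Phi t q, diff_quotient Phi q v h t)| =
   `|diff_quotient (fun t x => - G (Phi (- t) x)) q v h (- t) -
       tangent_map (fun x => - G x)
         (Phi (- - t) q, diff_quotient (fun t => Phi (- t)) q v h (- t))|.
    rewrite (tangent_mapN (Ck_pred G2)) /diff_quotient opprK /=; last exact: FU.
    by rewrite -opprD scalerN -opprD normrN.
  by apply: le_trans A _; rewrite ler_wpM2r // le_max lexx orbT.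
move=> k; rewrite lt_min => /and3P[k0 k1 k2]; have := B k; rewrite k0 k2.
rewrite /diff_quotient opprK => /(_ isT) {}B; apply: le_trans B _.
by rewrite ler_wpM2r ?addr_ge0 // le_max lexx orbT.
Qed.

Lemma has_der_of_diff_quotient E F (f : E -> F) x v d :
  (forall e : R, 0 < e -> exists2 r, 0 < r & forall h, 0 < `|h| < r ->
     `|h^-1 *: (f (x + h *: v) - f x) - d| <= e) -> has_der f x v d.
Proof.
move=> H e e0; have [r r0 Hr] := H e e0; exists r => // h hr.
have [->|h0] := eqVneq h 0.
  by rewrite !scale0r addr0 subrr subr0 !normr0 mulr0.
have hn : 0 < `|h| by rewrite normr_gt0.
have := Hr h; rewrite hn hr => /(_ isT).
rewrite -(ler_pM2r hn) mulrC -normrZ scalerBr scalerA mulfV // scale1r //.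
Qed.

Lemma diff_quotient_of_has_der E F (f : E -> F) x v d :
  has_der f x v d -> forall e : R, 0 < e -> exists2 r, 0 < r & forall h, 0 < `|h| < r ->
     `|h^-1 *: (f (x + h *: v) - f x) - d| <= e.
Proof.
move=> H e e0; have [r r0 Hr] := H e e0; exists r => // h /andP[hn hr].
rewrite -(ler_pM2r hn) mulrC -normrZ scalerBr scalerA mulfV -?normr_gt0 // scale1r //.
exact: Hr.
Qed.

Lemma flow_directional_derivative E (U Q : set E) G (a : R) Phi q v t :
  seq_complete E ->
  open U -> open Q -> Ck 2 U G -> is_flow U G a Q Phi -> Q q -> `|t| < a ->
  derivable (Phi t) q v.
Proof.
move=> cE oU oQ G2 HF Qq ta.
have [|h0 [C [h00 C0 H]]] := @flow_quotient_estimates _ _ _ _ _ `|t| _ _ v oU oQ G2 HF Qq.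
  by rewrite normr_ge0.
(* A concrete sequence tending to 0; starting at the denominator 2 keeps every term strictly below
   [h0]. *)
pose s (n : nat) : R := h0 / n.+2%:R.
have s0 n : 0 < s n by rewrite divr_gt0.
have sh n : 0 < `|s n| < h0.
  by rewrite gtr0_norm // s0 /= ltr_pdivrMr // ltr_pMr // ltr1n.
have sN (e : R) : 0 < e -> exists N, forall n, (N <= n)%N -> s n <= e.
  move=> e0; exists (Num.truncn (h0 / e)) => n Nn.
  rewrite ler_pdivrMr // mulrC -ler_pdivrMr //.
  have := truncnS_gt (h0 / e); move=> /ltW/le_trans; apply.
  by rewrite ler_nat; apply: leq_trans (leqnSn _).
have dq h k : 0 < `|h| < h0 -> 0 < `|k| < h0 ->
    `|diff_quotient Phi q v h t - diff_quotient Phi q v k t| <= C * (`|h| + `|k|).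
  by move=> /H[_ {}H] kk; have [|_] := H t; [exact: lexx|apply].
have [e e0|l Hl] := cE (fun n => diff_quotient Phi q v (s n) t).
  have [|N HN] := sN (e / (2 * C)); first by rewrite divr_gt0 // mulr_gt0.
  exists N => m n Nm Nn; apply: le_trans (dq _ _ (sh m) (sh n)) _.
  rewrite !gtr0_norm //.
  have -> : e = C * (e / (2 * C) + e / (2 * C)) by field; rewrite gt_eqF.
  by rewrite ler_pM2l // lerD // HN.
apply: (@has_der_derivable _ _ _ _ _ _ l); apply: has_der_of_diff_quotient => e e0.
exists (Num.min h0 (e / (4 * C))); first by rewrite lt_min h00 divr_gt0 ?mulr_gt0.
move=> h /andP[h1]; rewrite lt_min => /andP[h2 h3].
have [|N HN] := sN (e / (4 * C)); first by rewrite divr_gt0 // mulr_gt0.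
have e2 : 0 < e / 2 by rewrite divr_gt0.
have [N' HN'] := Hl _ e2; pose n := maxn N N'.
have := dq h (s n); rewrite h1 h2 => /(_ isT (sh n)).
rewrite (gtr0_norm (s0 n)) => A.
have := HN' n (leq_maxr _ _) => B; have := HN n (leq_maxl _ _) => D.
have : C * (`|h| + s n) <= e / 2.
  have -> : e / 2 = C * (e / (4 * C) + e / (4 * C)) by field; rewrite gt_eqF.
  by rewrite ler_pM2l // lerD // ltW.
have := ler_distD (diff_quotient Phi q v (s n) t) (diff_quotient Phi q v h t) l.
rewrite /diff_quotient in A B *; lra.
Qed.

(** The quotients converge to the derivative [w] at the rate C |h|, uniformly in time. For a fixed
    [h] the mean value inequality in time controls the quotient over [t, t + s]; then [h] is chosen
    in terms of [s], so that passing to [w] at both ends costs only a fraction of e |s|. *)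
Lemma flow_variation E (U Q : set E) G (a : R) Phi q v t :
  seq_complete E ->
  open U -> open Q -> Ck 2 U G -> is_flow U G a Q Phi -> Q q -> `|t| < a ->
  has_der (fun s => 'D_v (Phi s) q) t 1 (tangent_map G (Phi t q, 'D_v (Phi t) q)).
Proof.
move=> cE oU oQ G2 HF Qq ta; have [F0 FU Fd] := HF.
pose w s := 'D_v (Phi s) q; rewrite -/(w t).
pose T := (`|t| + a) / 2.
have tT : `|t| < T by rewrite /T; lra.
have Ta : T < a by rewrite /T; lra.
have T0 : 0 <= T by apply: le_trans (ltW tT).
have [|h0 [C [h00 C0 H]]] := @flow_quotient_estimates _ _ _ _ _ T _ _ v oU oQ G2 HF Qq.
  by rewrite T0.
have dqw h s : 0 < `|h| < h0 -> `|s| <= T -> `|diff_quotient Phi q v h s - w s| <= C * `|h|.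
  move=> hh sT; apply/ler_addgt0Pr => e e0.
  have e2 : 0 < e / 2 by rewrite divr_gt0.
  have sa : `|s| < a by lra.
  have D : derivable (Phi s) q v.
    exact: flow_directional_derivative cE oU oQ G2 HF Qq sa.
  have [r r0 Hr] := diff_quotient_of_has_der (derivable_has_der D) e2.
  pose k := Num.min (r / 2) (Num.min (h0 / 2) (e / (2 * C))).
  have k0 : 0 < k by rewrite !lt_min !divr_gt0 // mulr_gt0.
  have kr : k <= r / 2 by rewrite ge_min lexx.
  have kh : k <= h0 / 2 by rewrite !ge_min lexx !orbT.
  have ke : k <= e / (2 * C) by rewrite !ge_min lexx !orbT.
  have kk : 0 < `|k| < h0 by rewrite gtr0_norm // k0 /=; lra.
  have [_ /(_ s sT)[_ /(_ k kk)]] := H h hh; rewrite (gtr0_norm k0) => A.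
  have := Hr k; rewrite gtr0_norm // k0 /= => /(_ _) B.
  have {}B : `|diff_quotient Phi q v k s - w s| <= e / 2 by apply: B; lra.
  have : C * k <= e / 2.
    have -> : e / 2 = C * (e / (2 * C)) by field; rewrite gt_eqF.
    by rewrite ler_pM2l.
  have := ler_distD (diff_quotient Phi q v k s) (diff_quotient Phi q v h s) (w s).
  rewrite mulrDr in A; lra.
set p0 := (Phi t q, w t); move=> e e0.
have UT : (fst @^-1` U) p0 by apply: FU.
have [_ _ [T1 _ _]] := G2.
have e4 : 0 < e / 4 by rewrite divr_gt0.
have /continuous_epsP/(_ _ e4)[rho rho0 Hrho] := T1 p0 UT.
(* [k] is a reference step, fixed before [s]: continuity in time is used for the quotient of step
   [k] only, and the Cauchy estimate transfers it to every smaller step [h], which will depend on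
   [s]. *)
pose k := Num.min (h0 / 2) (Num.min (rho / (8 * C)) (e / (4 * C))).
have k0 : 0 < k by rewrite !lt_min !divr_gt0 // mulr_gt0.
have kh : k <= h0 / 2 by rewrite ge_min lexx.
have krho : C * k <= rho / 8.
  have -> : rho / 8 = C * (rho / (8 * C)) by field; rewrite gt_eqF.
  by rewrite ler_pM2l // !ge_min lexx !orbT.
have ke : C * k <= e / 4.
  have -> : e / 4 = C * (e / (4 * C)) by field; rewrite gt_eqF.
  by rewrite ler_pM2l // !ge_min lexx !orbT.
have kk : 0 < `|k| < h0 by rewrite gtr0_norm // k0 /=; lra.
have [Qk Hk] := H k kk.
have rho4 : 0 < rho / 4 by rewrite divr_gt0.
have /continuous_epsP/(_ _ rho4)[r1 r10 Hr1] :=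
  has_der_continuousR (diff_quotient_has_der HF Qq Qk ta).
have /continuous_epsP/(_ _ rho0)[r2 r20 Hr2] := has_der_continuousR (Fd t q ta Qq).
pose r := Num.min (T - `|t|) (Num.min r1 r2).
have Tt0 : 0 < T - `|t| by rewrite subr_gt0.
exists r; first by rewrite !lt_min r10 r20 Tt0.
move=> s; rewrite !lt_min => /and3P[sT sr1 sr2].
have [->|s0] := eqVneq s 0.
  by rewrite scaler1 addr0 scale0r subrr subr0 !normr0 mulr0.
have sn : 0 < `|s| by rewrite normr_gt0.
pose tau c := t + c * s.
have tauT c : 0 <= c <= 1 -> [/\ `|tau c| <= T, `|tau c - t| < r1 & `|tau c - t| < r2].
  move=> /andP[c0 c1]; have cs : `|c * s| <= `|s|.
    by rewrite normrM ger0_norm // ler_piMl.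
  have D : `|tau c - t| <= `|s| by rewrite /tau addrC addKr.
  split; try lra.
  by have := ler_normD t (c * s); rewrite -/(tau c); lra.
have key h : 0 < `|h| <= k ->
    `|diff_quotient Phi q v h (t + s) - diff_quotient Phi q v h t
      - s *: tangent_map G p0| <= (e / 2) * `|s|.
  move=> /andP[hpos hk]; have hh : 0 < `|h| < h0 by rewrite hpos /=; lra.
  have [Qh Hh] := H h hh.
  have := @norm_mean_value R E 1 (e / 2 * `|s|)
    (fun c => diff_quotient Phi q v h (tau c) - c *: (s *: tangent_map G p0))
    (fun c => s *: diff_quotient (fun t x => G (Phi t x)) q v h (tau c)
      - s *: tangent_map G p0) ler01.
  have -> : tau 1 = t + s by rewrite /tau mul1r.
  have -> : tau 0 = t by rewrite /tau mul0r addr0.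
  rewrite scale1r scale0r subr0 mulr1 addrAC; apply.
    move=> c c01; have [tc _ _] := tauT c c01.
    have tca : `|tau c| < a by lra.
    have := diff_quotient_has_der HF Qq Qh tca => D.
    apply: has_derB.
      have -> : tau = (fun c : R => t + c *: s) by [].
      apply: (has_der_affine_comp (affine_map_line t s)).
      rewrite -(mulr1 (1 *: s)) scale1r; exact: has_der_scalev D.
    by apply: has_der_affine => x; rewrite scaler1 scalerDl.
  move=> c c01; have [tc tr1 tr2] := tauT c c01.
  rewrite -scalerBr normrZ mulrC ler_pM2r //.
  have [E1 E2] := Hh (tau c) tc.
  have [_ E3] := Hk (tau c) tc; have := E3 h hh => {}E3.
  have E4 := Hr1 (tau c) tr1; have E5 := Hr2 (tau c) tr2.
  have E6 := dqw k t kk (ltW tT).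
  have near : `|(Phi (tau c) q, diff_quotient Phi q v h (tau c)) - p0| < rho.
    rewrite prod_normE /= gt_max E5 /=.
    have := ler_distD (diff_quotient Phi q v k (tau c))
      (diff_quotient Phi q v h (tau c)) (w t).
    have := ler_distD (diff_quotient Phi q v k t)
      (diff_quotient Phi q v k (tau c)) (w t).
    rewrite (distrC (diff_quotient Phi q v h (tau c)) (diff_quotient Phi q v k (tau c))).
    rewrite gtr0_norm // in E3 E6; have : C * `|h| <= C * k by rewrite ler_pM2l.
    rewrite mulrDr in E3; lra.
  have := Hrho _ near => E7.
  have := ler_distD (tangent_map G (Phi (tau c) q, diff_quotient Phi q v h (tau c)))
    (diff_quotient (fun t x => G (Phi t x)) q v h (tau c)) (tangent_map G p0).
  have : C * `|h| <= C * k by rewrite ler_pM2l.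
  lra.
(* Each replacement of a quotient by [w] costs at most C h <= e |s| / 4; with e |s| / 2 from [key]
   the total is e |s|. *)
pose h := Num.min k (e * `|s| / (4 * C)).
have hpos : 0 < h by rewrite lt_min k0 /= divr_gt0 // ?mulr_gt0.
have hk : h <= k by rewrite ge_min lexx.
have hC : C * h <= e * `|s| / 4.
  have -> : e * `|s| / 4 = C * (e * `|s| / (4 * C)) by field; rewrite gt_eqF.
  by rewrite ler_pM2l // ge_min lexx orbT.
have hh : 0 < `|h| < h0 by rewrite gtr0_norm // hpos /=; lra.
have := key h; rewrite gtr0_norm // hpos hk => /(_ isT) K1.
have := dqw h t hh (ltW tT); rewrite gtr0_norm // => K2.
have tsT : `|t + s| <= T by have := ler_normD t s; lra.
have := dqw h (t + s) hh tsT; rewrite gtr0_norm // => K3.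
have -> : t + s%:A = t + s by rewrite scaler1.
set A := diff_quotient Phi q v h (t + s) in K1 K3.
set B := diff_quotient Phi q v h t in K1 K2.
have -> : w (t + s) - w t - s *: tangent_map G p0 =
    (A - B - s *: tangent_map G p0) - (A - w (t + s)) + (B - w t).
  rewrite opprB [RHS](AC (3*2*2) ((4*7*3)*((1*5)*(2*6)))) /= subrr addNr !addr0 //.
apply: le_trans (ler_normD _ _) _.
have := ler_normB (A - B - s *: tangent_map G p0) (A - w (t + s)).
lra.
Qed.

Lemma is_flow_tangent E (U Q : set E) G (a : R) Phi : seq_complete E ->
  open U -> open Q -> Ck 2 U G -> is_flow U G a Q Phi ->
  is_flow (fst @^-1` U : set (E * E)) (tangent_lift G) a (fst @^-1` Q)
    (fun t => tangent_lift (Phi t)).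
Proof.
move=> cE oU oQ G2 HF; have [F0 FU Fd] := HF; split.
- move=> [q v] /= Qq; rewrite /tangent_lift /= F0 //; congr pair.
  apply: has_derE; apply: (@has_der_near _ _ _ id).
    have [r r0 Hr] := open_line v oQ Qq; exists r => // h /Hr /F0 -> //.
  by apply: has_der_affine.
- by move=> t [q v] ta /= Qq; exact: FU.
- move=> t [q v] ta /= Qq; apply: has_der_pair; first exact: Fd.
  exact: flow_variation oU oQ G2 HF Qq ta.
Qed.

Lemma Csmooth_tangent_lift E (U : set E) (G : E -> E) : open U ->
  Csmooth U G -> Csmooth (fst @^-1` U : set (E * E)) (tangent_lift G).
Proof.
move=> oU G8 k; apply: Ck_pair; first exact: open_fst.
  by apply: Ck_fst_comp => //; exact: G8.
exact: Csmooth_tangent.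
Qed.

(** The tangent map of the time-t map is the second component of the lifted flow on E * E. The
    induction hypothesis applies to that flow, so each order only asks for continuity and
    directional derivatives, which the Lipschitz and quotient estimates supply. *)
Theorem flow_smooth E (U Q : set E) G (a : R) Phi t : seq_complete E ->
  open U -> open Q -> Csmooth U G -> is_flow U G a Q Phi -> `|t| < a ->
  Csmooth Q (Phi t).
Proof.
move=> cE oU oQ G8 HF ta k.
elim: k E U Q G Phi cE oU oQ G8 HF => [|k IH] E U Q G Phi cE oU oQ G8 HF.
  all: have cont x : Q x -> {for x, continuous (Phi t)}.
  1,3: move=> Qx; apply/continuous_epsP => e e0;
    have [|r [C [r0 C0 H]]] := @flow_lipschitz _ _ _ _ _ `|t| _ _ oU oQ (G8 2) HF Qx;
    [by rewrite normr_ge0|];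
    exists (Num.min r (e / C)); first (by rewrite lt_min r0 divr_gt0);
    move=> y; rewrite lt_min ltr_pdivlMr // => /andP[yr ye];
    have [_ L] := H y yr; apply: le_lt_trans (L t (lexx _)) _; by rewrite mulrC.
  exact: cont.
split=> //.
  by move=> x v Qx; exact: flow_directional_derivative cE oU oQ (G8 2) HF Qx ta.
have := IH _ _ _ _ _ (seq_complete_prod cE cE) (open_fst oU) (open_fst oQ)
  (Csmooth_tangent_lift oU G8) (is_flow_tangent cE oU oQ (G8 2) HF).
exact: (Ck_affine_post (open_fst oQ) (affine_map_snd E E)).
Qed.

End FlowSmoothness.

(** * Existence for scalar equations *)

Section Picard.
Context {R : realType}.

Lemma seq_complete_of_cauchy_cvg (E : normedModType R) :
  (forall F : set_system E, ProperFilter F -> cauchy F -> cvg F) -> seq_complete E.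
Proof.
move=> cE u Hu.
have : cauchy (u @ \oo).
  apply: cauchy_exP => e e0; have [N HN] := Hu (e / 2) (divr_gt0 e0 (ltr0Sn R 1)).
  exists (u N); exists N => // n /= Nn; rewrite -ball_normE /ball_ /=.
  by apply: le_lt_trans (HN N n (leqnn N) Nn) _; rewrite ltr_pdivrMr // ltr_pMr // ltr1n.
move=> /cE/cvg_ex[l /cvgrPdist_le Hl]; exists l => e /Hl[N _ HN].
by exists N => n /HN; rewrite distrC.
Qed.

Lemma seq_complete_real : seq_complete (R : normedModType R).
Proof. by apply: seq_complete_of_cauchy_cvg => F FF /cauchy_cvgP. Qed.

Lemma seq_complete_rV n : seq_complete ('rV[R]_n.+1 : normedModType R).
Proof. by apply: seq_complete_of_cauchy_cvg => F FF /cauchy_cvgP. Qed.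

Lemma antiderivative (g : R -> R) : continuous g ->
  exists P : R -> R, P 0 = 0 /\ forall t, `|t| < 3 -> has_der P t 1 (g t).
Proof.
move=> cg; pose F x := \int[lebesgue_measure]_(t in [set` `[(-3 : R), x]]) (g t).
(* The integral starts at -3 so that the fundamental theorem gives two-sided derivatives on the
   whole of |t| < 3; later arguments are clamped to [-2, 2]. *)
exists (fun x => F x - F 0); split; first by rewrite subrr.
move=> t; rewrite ltr_norml => /andP[t1 t2].
have intg : (@lebesgue_measure R).-integrable `[(-3 : R), 3]%classic (EFin \o g).
  apply: continuous_compact_integrable; first exact: segment_compact.
  by apply: continuous_subspaceT.
have [dF FE] := continuous_FTC1_closed t2 intg t1 (cg t).
rewrite -(subr0 (g t)); apply: has_derB; last exact: has_der_cst.
by rewrite -FE derive1E; exact: derivable_has_der.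
Qed.

Lemma norm_mean_value_sym (W : normedModType R) (t K a : R) (u du : R -> W) :
  (forall s, `|s| < a -> has_der u s 1 (du s)) -> `|t| < a ->
  (forall s, `|s| < a -> `|du s| <= K) -> `|u t - u 0| <= K * `|t|.
Proof.
move=> ud ta dK; have [t0|t0] := leP 0 t.
  rewrite (ger0_norm t0); apply: (norm_mean_value (du := du)) => // s /andP[s0 st].
    by apply: ud; rewrite (ger0_norm s0); rewrite (ger0_norm t0) in ta; lra.
  by apply: dK; rewrite (ger0_norm s0); rewrite (ger0_norm t0) in ta; lra.
rewrite (ltr0_norm t0) in ta *.
have := @norm_mean_value R W (- t) K (fun s => u (- s)) (fun s => - du (- s)).
rewrite opprK oppr0; apply => [|s /andP[s0 st]|s /andP[s0 st]]; first lra.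
  by apply: has_der_reverse; apply: ud; rewrite normrN (ger0_norm s0); lra.
by rewrite normrN; apply: dK; rewrite normrN (ger0_norm s0); lra.
Qed.

Lemma lt_pow4 n : (n < 4 ^ n)%N.
Proof. exact: ltn_expl. Qed.

Lemma geometric_small (B e : R) : 0 <= B -> 0 < e ->
  exists n, B / 4 ^+ n <= e.
Proof.
move=> B0 e0; exists (Num.truncn (B / e)).+1.
rewrite ler_pdivrMr ?exprn_gt0 // mulrC -ler_pdivrMr //.
apply: ltW (lt_trans (truncnS_gt _) _).
by rewrite -natrX ltr_nat; exact: lt_pow4.
Qed.

(** Banach iteration from the zero function, with sup-norm bounds stated pointwise. The iterates
    stay below 2 B because B + 2 B / 4 <= 2 B; uniform convergence makes the limit continuous. *)
Lemma contraction_fixed_point (K : (R -> R) -> R -> R) (B : R) :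
  (forall z, continuous z -> continuous (K z)) ->
  (forall z z' D, continuous z -> continuous z' ->
     (forall t, `|z t - z' t| <= D) -> forall t, `|K z t - K z' t| <= D / 4) ->
  (forall t, `|K (cst 0) t| <= B) ->
  exists2 z : R -> R, continuous z & forall t, K z t = z t.
Proof.
move=> Kc Kl K0; pose zk n := iter n K (cst 0).
have B0 : 0 <= B by apply: le_trans (K0 0).
have zc n : continuous (zk n).
  by elim: n => [|n IH]; [move=> t; exact: cvg_cst|exact: Kc].
have z0 m t : `|zk m t - 0| <= 2 * B.
  elim: m t => [|m IH] t; first by rewrite /= subrr normr0 mulr_ge0.
  have := Kl _ _ _ (zc m) (zc 0%N) IH t; have := K0 t.
  have := ler_normD (K (zk m) t - K (zk 0%N) t) (K (zk 0%N) t).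
  rewrite subr0 subrK; lra.
have zd n m t : `|zk (n + m)%N t - zk n t| <= 2 * B / 4 ^+ n.
  elim: n t => [|n IH] t; first by rewrite expr0 divr1; exact: z0.
  by rewrite exprSr invfM mulrA; apply: (Kl (zk (n + m)%N) (zk n)).
have small (e : R) : 0 < e -> exists n, 2 * B / 4 ^+ n <= e.
  by apply: geometric_small; rewrite mulr_ge0.
have cv t : exists l, forall n, `|zk n t - l| <= 2 * B / 4 ^+ n.
  have [e e0|l Hl] := seq_complete_real (u := fun n => zk n t).
    have [|N HN] := small (e / 2); first by rewrite divr_gt0.
    exists N => m n /subnKC <- /subnKC <-.
    have := zd N (m - N)%N t; have := zd N (n - N)%N t.
    have := ler_distD (zk N t) (zk (N + (m - N))%N t) (zk (N + (n - N))%N t).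
    rewrite (distrC (zk N t)); lra.
  exists l => n; apply/ler_addgt0Pr => e /Hl[N HN].
  have := HN (n + N)%N (leq_addl _ _); have := zd n N t.
  have := ler_distD (zk (n + N)%N t) (zk n t) l.
  rewrite (distrC (zk n t) (zk (n + N)%N t)); lra.
have [z Hz] : {z : R -> R & forall t n, `|zk n t - z t| <= 2 * B / 4 ^+ n}.
  by exists (fun t => sval (cid (cv t))) => t; exact: svalP (cid (cv t)).
have cz : continuous z.
  move=> t; apply/continuous_epsP => e e0.
  have e4 : 0 < e / 4 by rewrite divr_gt0.
  have [n Hn] := small _ e4.
  have /continuous_epsP/(_ _ e4)[r r0 Hr] := zc n t.
  exists r => // s /Hr H; have := Hz t n; have := Hz s n.
  have := ler_distD (zk n s) (z s) (z t).
  have := ler_distD (zk n t) (zk n s) (z t); rewrite (distrC (z s) (zk n s)); lra.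
exists z => // t; apply/eqP; rewrite -subr_eq0 -normr_le0.
apply/ler_addgt0Pr => e e0; rewrite add0r.
have e2 : 0 < e / 2 by rewrite divr_gt0.
have [n Hn] := small _ e2.
have := Kl z (zk n) (e / 2) cz (zc n) _ t => H1.
have {}H1 : `|K z t - zk n.+1 t| <= e / 2 / 4.
  by apply: H1 => s; rewrite distrC; exact: le_trans (Hz s n) Hn.
have H2 : `|zk n.+1 t - z t| <= e / 2.
  apply: le_trans (Hz t n.+1) (le_trans _ Hn).
  rewrite ler_wpM2l ?mulr_ge0 // lef_pV2 ?posrE ?exprn_gt0 // ler_eXn2l //.
  by rewrite ltr1n.
have := ler_distD (zk n.+1 t) (K z t) (z t); lra.
Qed.

(** The retraction of the line onto [-b, b]. It lets the integral operator act on all continuous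
    functions of a real variable, instead of on a ball in a space of functions on an interval. *)
Definition clamp (b x : R) : R := Num.max (- b) (Num.min b x).

Lemma clamp_continuous b : continuous (clamp b).
Proof.
move=> x; apply: (@continuous_max R _ (cst (- b)) (fun x => Num.min b x)).
  exact: cvg_cst.
by apply: (@continuous_min R _ (cst b) id); [exact: cvg_cst|exact: cvg_id].
Qed.

Lemma clamp_bound b x : 0 <= b -> `|clamp b x| <= b.
Proof.
move=> b0; rewrite /clamp ler_norml le_max lexx /= ge_max ge_min lexx /= andbT; lra.
Qed.

Lemma clamp_id b x : `|x| <= b -> clamp b x = x.
Proof.
rewrite ler_norml => /andP[x1 x2]; rewrite /clamp.
by rewrite (min_idPr x2) (max_idPr x1).
Qed.

Lemma clamp_lipschitz b x y : 0 <= b -> `|clamp b x - clamp b y| <= `|x - y|.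
Proof.
move=> b0; rewrite /clamp.
have H (u v : R) : `|u - v| <= `|x - y| <-> (u - v <= `|x - y| /\ v - u <= `|x - y|).
  rewrite ler_norml; split=> [/andP[]|[]] *; last by apply/andP; split; lra.
  split; lra.
have h0 := normr_ge0 (x - y); have h1 := ler_norm (x - y); have := ler_norm (y - x); rewrite distrC => h2.
apply/H; rewrite !(maxElt, minElt).
by case: (ltP b x) => ?; case: (ltP b y) => ?; repeat (case: ltP => ?); split; lra.
Qed.

(** Picard iteration with clamped time and value. Over |t| <= 2 the constants 1/8 and d / 4 yield
    the contraction factor 1/4 and the bound d / 2 < d, so at the fixed point the clamps are
    inactive. The length 2 makes time 1 interior. *)
Lemma scalar_ode_solution (h : R -> R -> R) (d : R) : 0 < d ->
  (forall z, continuous z -> (forall t, `|z t| <= d) ->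
     continuous (fun t => h (clamp 2 t) (z t))) ->
  (forall t z z', `|t| <= 2 -> `|z| <= d -> `|z'| <= d ->
     `|h t z - h t z'| <= `|z - z'| / 8) ->
  (forall t z, `|t| <= 2 -> `|z| <= d -> `|h t z| <= d / 4) ->
  exists z : R -> R, [/\ z 0 = 0, forall t, `|t| < 2 -> `|z t| < d &
     forall t, `|t| < 2 -> has_der z t 1 (h t (z t))].
Proof.
move=> d0 hc hl hb; have d0' := ltW d0.
pose g z s := h (clamp 2 s) (clamp d (z s)).
have gc z : continuous z -> continuous (g z).
  move=> cz; apply: (hc (fun t => clamp d (z t))); last first.
    by move=> t; exact: clamp_bound.
  by move=> t; apply: continuous_comp; [exact: cz|exact: clamp_continuous].
have [I [I0 Id]] : exists I : (R -> R) -> R -> R, (forall z, continuous z -> I z 0 = 0) /\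
    (forall z, continuous z -> forall t, `|t| < 3 -> has_der (I z) t 1 (g z t)).
  have H z : exists P : R -> R, continuous z ->
      P 0 = 0 /\ forall t, `|t| < 3 -> has_der P t 1 (g z t).
    have [cz|ncz] := pselect (continuous z); last by exists (cst 0).
    by have [P HP] := antiderivative (gc z cz); exists P.
  exists (fun z => sval (cid (H z))); split=> z cz.
    by have [] := svalP (cid (H z)) cz.
  by have [] := svalP (cid (H z)) cz.
have c2 t : `|clamp 2 t| <= 2 by exact: clamp_bound.
have c3 t : `|clamp 2 t| < 3 by have := c2 t; lra.
have gb z t : `|g z t| <= d / 4 by apply: hb => //; exact: clamp_bound.
pose K z t := I z (clamp 2 t).
have Kb z t : continuous z -> `|I z (clamp 2 t)| <= d / 2.
  move=> cz; have := norm_mean_value_sym (Id z cz) (c3 t) (fun s _ => gb z s).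
  rewrite I0 // subr0 => /le_trans; apply; have := c2 t; nra.
have Kc z : continuous z -> continuous (K z).
  move=> cz t; apply: (@continuous_comp _ _ _ (clamp 2) (I z)).
    exact: clamp_continuous.
  by apply: has_der_continuousR; exact: Id.
have Kl z z' D : continuous z -> continuous z' ->
    (forall t, `|z t - z' t| <= D) -> forall t, `|K z t - K z' t| <= D / 4.
  move=> cz cz' zz' t.
  have := @norm_mean_value_sym R (clamp 2 t) (D / 8) 3 (fun s => I z s - I z' s)
    (fun s => g z s - g z' s) _ (c3 t).
  rewrite !I0 // subrr subr0 => H; apply: le_trans (H _ _) _.
  + by move=> s s3; apply: has_derB; exact: Id.
  + move=> s _; apply: le_trans (hl _ _ _ (c2 s) (clamp_bound _ d0') (clamp_bound _ d0')) _.
    have := clamp_lipschitz (z s) (z' s) d0'; have := zz' s; lra.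
  + have := c2 t; have := le_trans (normr_ge0 _) (zz' 0); nra.
have K0 t : `|K (cst 0) t| <= d / 2 by apply: Kb => s; exact: cvg_cst.
have [z cz Hz] := contraction_fixed_point Kc Kl K0; exists z; split.
  + by rewrite -Hz /K clamp_id ?normr0 // I0.
  + move=> t _; rewrite -Hz; apply: le_lt_trans (Kb z t cz) _; lra.
  + move=> t t2; have zt : `|z t| <= d.
      by rewrite -Hz; apply: le_trans (Kb z t cz) _; lra.
    have -> : h t (z t) = g z t by rewrite /g !clamp_id // ltW.
    have t3 : `|t| < 3 by lra.
    apply: (@has_der_near _ _ _ (I z)) (Id z cz t t3).
    exists (2 - `|t|); first by rewrite subr_gt0.
    move=> s s2; rewrite -Hz /K clamp_id // scaler1.
    by have := ler_normD t s; lra.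
Qed.

End Picard.

(** * The Frobenius theorem in codimension one *)

Section LinearPost.
Context {R : realType}.
Implicit Types (E V W : normedModType R).

Lemma tangent_map_affine V W (A A' : V -> W) p v :
  affine_map A A' -> tangent_map A (p, v) = A' v.
Proof. by case=> _ _ dA _; apply: has_derE; apply: has_der_affine => h. Qed.

Lemma has_der_affine_post E V W (A A' : V -> W) (f : E -> V) x v d :
  affine_map A A' -> has_der f x v d -> has_der (A \o f) x v (A' d).
Proof.
move=> aA fd; rewrite -(tangent_map_affine (f x) d aA).
exact: (has_der_comp (openT) (Ck_affine 1 setT aA)).
Qed.

Lemma open_affine_preimage V W (A A' : V -> W) (U : set W) :
  affine_map A A' -> open U -> open (A @^-1` U).
Proof. by move=> aA oU; apply: open_comp => // x _; exact: affine_map_continuous aA _. Qed.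

Lemma affine_map_pairl V W (w : W) :
  affine_map (fun v : V => (v, w)) (fun v => (v, 0 : W)).
Proof.
split=> [x|x|x v h|x v h].
- by apply: cvg_pair; [exact: cvg_id|exact: cvg_cst].
- by apply: cvg_pair; [exact: cvg_id|exact: cvg_cst].
- by rewrite -[X in (_, X) = _]addr0 -[X in (_, _ + X) = _](scaler0 W h).
- by rewrite -[X in (_, X) = _]addr0 -[X in (_, _ + X) = _](scaler0 W h).
Qed.

Lemma open_ballR V (x : V) (r : R) : open [set y | `|y - x| < r].
Proof.
rewrite (_ : [set y | _] = ball x r); first exact: ball_open.
by rewrite -ball_normE; apply/seteqP; split=> y; rewrite /ball_ /= distrC.
Qed.

Lemma Ck_open_neq0 V k (U : set V) (f : V -> R) : open U -> Ck k U f ->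
  open (U `&` [set x | f x != 0]).
Proof.
move=> oU fk; apply: open_of_balls => x [Ux fx].
have [r r0 Hr] := open_ball_subset oU Ux.
have f0 : 0 < `|f x| by rewrite normr_gt0.
have /continuous_epsP/(_ _ f0)[s s0 Hs] := Ck_continuous fk Ux.
exists (Num.min r s); first by rewrite lt_min r0.
move=> y; rewrite lt_min => /andP[yr ys]; split; first exact: Hr.
apply/eqP => fy; have := Hs y ys; rewrite fy sub0r normrN ltxx //.
Qed.

Lemma has_der_constant_zero (W : normedModType R) (a t : R) (u : R -> W) :
  (forall s, `|s| < a -> has_der u s 1 0) -> `|t| < a -> u t = u 0.
Proof.
move=> H ta; apply/eqP; rewrite -subr_eq0 -normr_le0.
rewrite -[X in _ <= X](mul0r `|t|); apply: (norm_mean_value_sym (du := fun=> 0) H ta) => s _.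
by rewrite normr0.
Qed.

(** The coefficient is bounded on [0, 1] by compactness; Gronwall with initial value 0 then bounds
    |u 1| by its slack alone, which is arbitrary. *)
Lemma linear_ode_zero (u c : R -> R) :
  (forall t, 0 <= t <= 1 -> {for t, continuous c}) ->
  (forall t, 0 <= t <= 1 -> has_der u t 1 (c t * u t)) -> u 0 = 0 -> u 1 = 0.
Proof.
move=> cc du u0.
have [t t01|r r0 Hr] := @segment_uniform R 1 (fun r t => `|c t| <= r^-1).
  have /continuous_epsP/(_ 1 ltr01)[s s0 Hs] := cc t t01.
  have c1 : 0 < `|c t| + 1 by rewrite ltr_wpDl.
  exists (Num.min s (`|c t| + 1)^-1); first by rewrite lt_min s0 invr_gt0.
  move=> s' r'; rewrite !lt_min => /andP[s's _] /and3P[r'0 _ r'c].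
  have := Hs s' s's; have := ler_normD (c s' - c t) (c t); rewrite subrK => A B.
  have : `|c t| + 1 <= r'^-1.
    by rewrite -[X in X <= _]invrK lef_pV2 ?posrE ?invr_gt0 // ltW.
  lra.
apply/eqP; rewrite -normr_le0; apply/ler_addgt0Pr => e e0; rewrite add0r.
pose K := expR ((r^-1 + 1) * 1); have K0 : 0 < K by exact: expR_gt0.
have := @gronwall R _ 1 r^-1 0 (e / K) 0 e u (fun t => c t * u t).
rewrite -/K add0r mulfVK ?gt_eqF // => H; apply: H => //.
- by rewrite invr_ge0 ltW.
- by rewrite divr_gt0.
- by rewrite divr_gt0.
- by rewrite u0 normr0.
- by move=> t t01 _; rewrite addr0 normrM ler_wpM2r // Hr.
- by rewrite ler01 lexx.
Qed.

End LinearPost.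

Section Frobenius.
Context {R : realType} (E : normedModType R) (cE : seq_complete E).
Context (U : set E) (q0 : E) (oU : open U) (Uq0 : U q0).
Context (e : E) (l : E -> R) (al : affine_map l l) (le1 : l e = 1).
Context (alpha : E -> E -> R).
Context (alphas : Csmooth (fst @^-1` U : set (E * E)) (fun p => alpha p.1 p.2)).
Context (alphaD : forall q v w (c : R), U q -> alpha q (v + c *: w) = alpha q v + c * alpha q w).
Context (alphae : forall q, U q -> alpha q e != 0).

Let ahat (p : E * E) : R := alpha p.1 p.2.
(** [v + B (q, v) *: e] is the horizontal lift of [v] at [q]: the vector of the kernel of alpha
    congruent to [v] modulo [e]. *)
Let B (p : E * E) : R := - (alpha p.1 p.2 * (alpha p.1 e)^-1).
(* The characteristic field: from (q, x) it moves q with horizontal lift of -x,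
   so that after time 1 the point q has been brought back to the line q0 + R e. *)
Let G (p : E * E) : E * E := (- (p.2 + B p *: e), 0).
Let pi (v : E) : E := v - l v *: e.

Let alpha0 q : U q -> alpha q 0 = 0.
Proof.
move=> Uq; have := alphaD 0 0 1 Uq; rewrite scaler0 addr0 mul1r.
by move/eqP; rewrite -subr_eq subrr eq_sym => /eqP.
Qed.

Let alphaZ q v (c : R) : U q -> alpha q (c *: v) = c * alpha q v.
Proof. by move=> Uq; have := alphaD 0 v c Uq; rewrite add0r alpha0 // add0r. Qed.

Let B0 q : U q -> B (q, 0) = 0.
Proof. by move=> Uq; rewrite /B /= alpha0 // mul0r oppr0. Qed.

Let BZ q v (c : R) : U q -> B (q, c *: v) = c * B (q, v).
Proof. by move=> Uq; rewrite /B /= alphaZ // mulrN mulrA. Qed.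

Let oF : open (fst @^-1` U : set (E * E)).
Proof. exact: open_fst. Qed.

Let Bs : Csmooth (fst @^-1` U : set (E * E)) B.
Proof.
move=> k; apply: CkN => //.
apply: (@CkM R _ k _ (fun p : E * E => alpha p.1 p.2)) => //.
apply: CkV => //; first by move=> p /alphae.
apply: (@Ck_fst_comp R E E R k U (fun q => alpha q e)) => //.
have aA : affine_map (fun q : E => (q, e)) (fun q => (q, 0)).
  exact: affine_map_pairl.
exact: (Ck_affine_comp oF aA (alphas k)).
Qed.

Let Gs : Csmooth (fst @^-1` U : set (E * E)) G.
Proof.
move=> k; apply: Ck_pair => //; last exact: Ck_cst.
apply: CkN => //; apply: CkD => //; first exact: (Ck_affine _ _ (affine_map_snd E E)).
exact: (Ck_affine_post oF (affine_map_scalel e) (Bs k)).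
Qed.

Let affine_pi : affine_map pi pi.
Proof.
apply: affine_mapD (affine_map_id E) _.
have a1 := affine_map_comp al (affine_map_scalel e).
have := affine_mapZ (-1) a1; rewrite (_ : (fun x => _) = fun x => - (l x *: e)) //.
by apply/funext => x /=; rewrite scaleN1r.
Qed.

Let lZ v (c : R) : l (c *: v) = c * l v.
Proof.
have [_ _ H _] := al; have l0 : l 0 = 0.
  by have := H 0 0 1; rewrite scaler0 addr0 scale1r => /eqP; rewrite -subr_eq subrr eq_sym => /eqP.
by have := H 0 v c; rewrite add0r l0 add0r.
Qed.

Let pi_e (c : R) : pi (c *: e) = 0.
Proof. by rewrite /pi lZ le1 mulr1 subrr. Qed.

(** The second component is constant along [G], so the first one is p.1 - t p.2 + z(t) e with a
    single unknown scalar z; this is why a scalar equation suffices. *)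
Let local_flow : exists2 r : R, 0 < r & exists2 Phi : R -> E * E -> E * E,
  is_flow (fst @^-1` U) G 2 [set p | `|p - (q0, 0)| < r] Phi &
  forall t p, `|p - (q0, 0)| < r -> `|t| < 2 ->
    (Phi t p).2 = p.2 /\ pi ((Phi t p).1) = pi (p.1 - t *: p.2).
Proof.
have [rho rho0 Hrho] := C1_locally_lipschitz oF (Bs 1) (Uq0 : (fst @^-1` U) (q0, 0)).
have [m m0 Hm] := open_ball_subset oU Uq0.
pose s := Num.min rho m; have s0 : 0 < s by rewrite lt_min rho0.
have srho : s <= rho by rewrite ge_min lexx.
have sU q : `|q - q0| < s -> U q.
  by move=> qs; apply: Hm; apply: lt_le_trans qs _; rewrite ge_min lexx orbT.
have Bb p x : `|p - q0| < s -> `|x| < s -> `|B (p, x)| <= rho^-1 * `|x|.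
  move=> ps xs; have Up := sU p ps.
  have := Hrho (p, x) (p, 0); rewrite !prod_normE /= !gt_max !subr0 !subrr !normr0.
  rewrite rho0 !(lt_le_trans ps srho) !(lt_le_trans xs srho) => /(_ isT isT).
  by rewrite B0 // subr0 max_r.
have Bl p p' x : `|p - q0| < s -> `|p' - q0| < s ->
    `|B (p, x) - B (p', x)| <= 2 * `|x| / rho ^+ 2 * `|p - p'|.
  move=> ps p's; have Up := sU p ps; have Up' := sU p' p's.
  have [->|x0] := eqVneq x 0; first by rewrite !B0 // subrr !normr0 mulr0 !mul0r.
  have nx : 0 < `|x| by rewrite normr_gt0.
  have c0 : 0 < rho / 2 / `|x| by rewrite !divr_gt0.
  have ncx : `|rho / 2 / `|x| *: x| < rho.
    rewrite normrZ gtr0_norm // mulfVK ?gt_eqF //; lra.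
  have := Hrho (p, rho / 2 / `|x| *: x) (p', rho / 2 / `|x| *: x).
  rewrite !prod_normE /= !gt_max !subr0 ncx subrr normr0.
  rewrite (lt_le_trans ps srho) (lt_le_trans p's srho) => /(_ isT isT).
  rewrite !BZ // -mulrBr normrM gtr0_norm // max_l // -ler_pdivlMl // => /le_trans; apply.
  by rewrite le_eqVlt; apply/orP; left; apply/eqP; field; rewrite !gt_eqF.
pose N := `|e| + 1; have N0 : 0 < N by rewrite ltr_wpDl.
have eN : `|e| <= N by rewrite lerDl.
pose d := s / (4 * N); have d0 : 0 < d by rewrite divr_gt0 // mulr_gt0.
(* The bound s / 8, together with the choice of [d], keeps the curve in the ball of radius [s]; rho
   d / 4 gives |B| <= d / 4; rho^2 / (16 N) gives the Lipschitz constant 1/8. These are the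
   hypotheses of [scalar_ode_solution]. *)
pose r := Num.min (s / 8) (Num.min (rho * d / 4) (rho ^+ 2 / (16 * N))).
have rhod0 : 0 < rho * d / 4 by rewrite divr_gt0 // mulr_gt0.
have rhoN0 : 0 < rho ^+ 2 / (16 * N) by rewrite divr_gt0 ?exprn_gt0 // mulr_gt0.
have r0 : 0 < r by rewrite !lt_min divr_gt0 //= rhod0.
have rs : r <= s / 8 by rewrite ge_min lexx.
have rd : r <= rho * d / 4 by rewrite !ge_min lexx !orbT.
have rN : r <= rho ^+ 2 / (16 * N) by rewrite !ge_min lexx !orbT.
pose Q := [set p : E * E | `|p - (q0, 0)| < r].
pose pos (p : E * E) (t z : R) := p.1 + t *: (- p.2) + z *: e.
have Qp p : Q p -> `|p.1 - q0| < r /\ `|p.2| < r.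
  by rewrite /Q /= prod_normE /= gt_max subr0 => /andP[].
have inB p t z : Q p -> `|t| <= 2 -> `|z| <= d -> `|pos p t z - q0| < s.
  move=> /Qp[p1 p2] t2 zd.
  have h1 : `|z *: e| <= s / 4.
    rewrite normrZ; apply: (@le_trans _ _ (d * N)); first exact: ler_pM.
    by rewrite /d le_eqVlt; apply/orP; left; apply/eqP; field; rewrite gt_eqF.
  have h2 : `|t *: (- p.2)| <= 2 * r.
    by rewrite normrZ normrN; apply: ler_pM => //; exact: ltW.
  have -> : pos p t z - q0 = p.1 - q0 + (t *: - p.2 + z *: e).
    by rewrite /pos [RHS](AC (2*2) (((1*3)*4)*2)).
  have := ler_normD (p.1 - q0) (t *: - p.2 + z *: e).
  have := ler_normD (t *: - p.2) (z *: e); lra.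
have Z p : Q p -> exists z : R -> R, [/\ z 0 = 0, forall t, `|t| < 2 -> `|z t| < d &
     forall t, `|t| < 2 -> has_der z t 1 (- B (pos p t (z t), p.2))].
  move=> Qpp; have [p1 p2] := Qp p Qpp.
  apply: (@scalar_ode_solution R (fun t z => - B (pos p t z, p.2))) => //.
  - move=> z cz zd t; apply: cvgN.
    have c2 : `|clamp 2 t| <= 2 by exact: clamp_bound.
    apply: (@continuous_comp _ _ _ (fun t => (pos p (clamp 2 t) (z t), p.2)) B).
      apply: cvg_pair; last exact: cvg_cst.
      apply: cvgD; last by apply: cvgZl; exact: cz.
      apply: cvgD; first exact: cvg_cst.
      by apply: cvgZl; exact: clamp_continuous.
    apply: Ck_continuous (Bs 0) _; apply: sU; exact: inB.
  - move=> t z z' t2 zd z'd; rewrite -opprD normrN.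
    apply: le_trans (Bl _ _ p.2 (inB p t z Qpp t2 zd) (inB p t z' Qpp t2 z'd)) _.
    have -> : pos p t z - pos p t z' = (z - z') *: e.
      by rewrite /pos opprD addrACA subrr add0r scalerBl.
    rewrite normrZ mulrCA ler_wpM2l //.
    apply: (@le_trans _ _ (2 * (rho ^+ 2 / (16 * N)) / rho ^+ 2 * N)).
      apply: ler_pM => //.
        by apply: divr_ge0; [rewrite mulr_ge0|rewrite exprn_ge0 // ltW].
      by rewrite ler_pM2r ?invr_gt0 ?exprn_gt0 // ler_pM2l // (le_trans (ltW p2)).
    by rewrite le_eqVlt; apply/orP; left; apply/eqP; field; rewrite !gt_eqF.
  - move=> t z t2 zd; rewrite normrN.
    apply: le_trans (Bb _ _ (inB p t z Qpp t2 zd) _) _.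
      by apply: lt_le_trans p2 _; lra.
    apply: (@le_trans _ _ (rho^-1 * (rho * d / 4))).
      by rewrite ler_pM2l ?invr_gt0 // (le_trans (ltW p2)).
    by rewrite le_eqVlt; apply/orP; left; apply/eqP; field; rewrite gt_eqF.
have [zf Hzf] : {zf : E * E -> R -> R & forall p, Q p ->
    [/\ zf p 0 = 0, forall t, `|t| < 2 -> `|zf p t| < d &
     forall t, `|t| < 2 -> has_der (zf p) t 1 (- B (pos p t (zf p t), p.2))]}.
  have Z' p : exists z : R -> R, Q p -> [/\ z 0 = 0, forall t, `|t| < 2 -> `|z t| < d &
     forall t, `|t| < 2 -> has_der z t 1 (- B (pos p t (z t), p.2))].
    by have [/Z[z Hz]|nQ] := pselect (Q p); [exists z|exists (cst 0)].
  by exists (fun p => sval (cid (Z' p))) => p; exact: svalP (cid (Z' p)).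
exists r => //; exists (fun t p => (pos p t (zf p t), p.2)); first split.
- move=> [q x] /Hzf[z0 _ _]; by rewrite /pos z0 !scale0r !addr0.
- move=> t p ta Qpp; have [_ zd _] := Hzf p Qpp; apply: sU; apply: inB => //; exact: ltW (zd _ _) || exact: ltW.
- move=> t p ta Qpp; have [_ _ zder] := Hzf p Qpp; apply: has_der_pair; last exact: has_der_cst.
  rewrite /= opprD; apply: has_derD.
    by apply: has_der_affine => h; rewrite scaler1 scalerDl addrA.
  rewrite -scaleNr; exact: (has_der_affine_post (affine_map_scalel e) (zder t ta)).
- move=> t p _ _; split=> //=; have [_ _ H _] := affine_pi.
  have pe : pi e = 0 by rewrite -(scale1r e) pi_e.
  by rewrite /pos H pe scaler0 addr0 scalerN.
Qed.

Let ahat_der q y v w : U q ->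
  has_der ahat (q, y) (v, w) (tangent_map ahat ((q, y), (v, w))).
Proof. by move=> Uq; exact: (Ck_has_der (v, w) (alphas 1) (Uq : (fst @^-1` U) (q, y))). Qed.

Let d1 (q v y : E) : R := tangent_map ahat ((q, y), (v, 0)).

Let d1E q v y : U q -> 'D_v (alpha^~ y) q = d1 q v y.
Proof.
move=> Uq; apply: has_derE.
apply: (has_der_affine_comp (f := ahat) (affine_map_pairl E y)).
exact: ahat_der.
Qed.

Let tangent_ahat q y v w : U q ->
  tangent_map ahat ((q, y), (v, w)) = d1 q v y + alpha q w.
Proof.
move=> Uq; have -> : (v, w) = (v, 0) + (0, w) :> E * E by congr pair; rewrite ?add0r ?addr0.
rewrite (tangent_mapD _ _ oF (alphas 1)) //; congr (_ + _).
apply: has_derE; apply: has_der_affine => h.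
have -> : (q, y) + h *: (0, w) = (q, y + h *: w) :> E * E.
  by rewrite -[X in (_, _) + _ = (X, _)]addr0 -[X in _ = (_ + X, _)](scaler0 E h).
by rewrite /ahat /= alphaD.
Qed.

Let d1_addl q v w (c : R) y : U q -> d1 q (v + c *: w) y = d1 q v y + c * d1 q w y.
Proof.
move=> Uq; have -> : d1 q (v + c *: w) y = tangent_map ahat ((q, y), (v, 0) + c *: (w, 0)).
  congr (tangent_map ahat (_, _)).
  by rewrite -[X in (_, X) = _]addr0 -[X in (_, _ + X) = _](scaler0 E c).
rewrite (tangent_mapD _ _ oF (alphas 1)) //; congr (_ + _).
exact: (tangent_map_scale _ _ (alphas 1)).
Qed.

Let d1_addr q v w (c : R) y : U q -> d1 q y (v + c *: w) = d1 q y v + c * d1 q y w.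
Proof.
move=> Uq; rewrite -d1E //; apply: has_derE.
have der z : has_der (alpha^~ z) q y (d1 q y z).
  apply: (has_der_affine_comp (f := ahat) (affine_map_pairl E z)).
  exact: ahat_der.
apply: (@has_der_near _ _ _ (fun p => alpha p v + c *: alpha p w)).
  by have [r r0 Hr] := open_line y oU Uq; exists r => // h /Hr Uh; rewrite alphaD.
by apply: has_derD; [exact: der|apply: has_derZ; exact: der].
Qed.

(** The integrability condition: d alpha vanishes on pairs of kernel vectors, that is, alpha wedge d
    alpha = 0. *)
Context (closed_on_kernel : forall q u v, U q -> alpha q u = 0 -> alpha q v = 0 ->
  'D_u (alpha^~ v) q = 'D_v (alpha^~ u) q).

Let G_horizontal p : U p.1 -> alpha p.1 (G p).1 = 0.
Proof.
move=> Up; rewrite /= -scaleN1r alphaZ // alphaD //.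
have -> : alpha p.1 p.2 + B p * alpha p.1 e = 0.
  by rewrite /B mulNr mulfVK ?alphae // subrr.
by rewrite mulr0.
Qed.

Let G_horizontal_der p v : U p.1 ->
  d1 p.1 v.1 (G p).1 + alpha p.1 (tangent_map G (p, v)).1 = 0.
Proof.
move=> Up; have GD := Ck_has_der v (Gs 1) Up.
have G1D := has_der_affine_post (affine_map_fst E E) GD.
have pD : has_der (fun z : E * E => (z.1, (G z).1)) p v (v.1, (tangent_map G (p, v)).1).
  apply: has_der_pair G1D; apply: (has_der_affine_post (affine_map_fst E E)).
  exact: has_der_affine.
have := has_der_comp oF (alphas 1) (Up : (fst @^-1` U) (p.1, (G p).1)) pD.
rewrite tangent_ahat // => /has_derE <-; apply: has_derE.
apply: (@has_der_near _ _ _ (cst 0)); last exact: has_der_cst.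
have [r r0 Hr] := open_line v oF (Up : (fst @^-1` U) p); exists r => // h /Hr Uh.
by apply/esym; exact: (@G_horizontal (p + h *: v)).
Qed.

Lemma frobenius_local : exists (V : set E) (f : E -> R),
  [/\ open V, V q0, V `<=` U, Csmooth V f &
    forall q, V q -> 'D_e f q != 0 /\ forall u, alpha q u = 0 -> 'D_u f q = 0].
Proof.
have [r r0 [Phi HF HP]] := local_flow.
pose Q := [set p : E * E | `|p - (q0, 0)| < r].
have oQ : open Q := open_ballR (q0, 0) r.
have cEE := seq_complete_prod cE cE.
have [F0 FU Fd] := HF.
have lt12 : `|1 : R| < 2 by rewrite normr1 ltr1n.
(* The displacement to be undone is the part of q - q0 transversal to [e]; at time 1 the first
   component lies on q0 + R e, and [f] reads its position there. *)
pose A q : E * E := (q, pi (q - q0)).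
have aA : affine_map A (fun v => (v, pi v)).
  have aq : affine_map (fun q => q - q0) (fun v : E => v).
    have := affine_mapD (affine_map_id E) (@affine_map_cst R E E (- q0)).
    by rewrite (_ : (fun x => id x + cst 0 x) = id) //; apply/funext => x /=; rewrite addr0.
  exact: affine_map_pair (affine_map_id E) (affine_map_comp aq affine_pi).
have smoothPhi := flow_smooth cEE oF oQ Gs HF lt12.
pose f q := l (Phi 1 (A q)).1.
pose V := A @^-1` Q `&` U.
have oV0 : open (A @^-1` Q) := open_affine_preimage aA oQ.
have oV : open V := openI oV0 oU.
have fs : Csmooth V f.
  move=> k; apply: (@Ck_subset _ _ _ _ (A @^-1` Q)); first by move=> q [].
  apply: (Ck_affine_post oV0 (affine_map_comp (affine_map_fst E E) al)).
  exact: (Ck_affine_comp oQ aA (smoothPhi k)).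
have pi0 : pi 0 = 0 by have := pi_e 0; rewrite scale0r.
have VQ0 : V q0.
  by split=> //; rewrite /= /Q /= /A subrr pi0 subrr normr0.
have fD q u : V q -> has_der f q u (l (tangent_map (Phi 1) (A q, (u, pi u))).1).
  move=> [Qq _]; apply: (has_der_affine_post (affine_map_comp (affine_map_fst E E) al)).
  apply: (has_der_affine_comp aA); exact: Ck_has_der (smoothPhi 1) Qq.
have De0 : has_der f q0 e 1.
  have [s s0 Hs] := open_line e oV VQ0.
  apply: (@has_der_near _ _ _ (fun q => l q)); last first.
    by rewrite -le1; apply: has_der_affine; case: al.
  exists s => // h /Hs [Qh Uh].
  have piA : pi (q0 + h *: e - q0) = 0 by rewrite addrC addKr pi_e.
  congr l; have -> : A (q0 + h *: e) = (q0 + h *: e, 0) by rewrite /A piA.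
  move: Qh; rewrite /= /A piA => Qh.
  (* On the line itself the displacement is 0, so the characteristic field vanishes and the flow is
     stationary. There [f] coincides with [l], whence its derivative 1 along [e]. *)
  suff -> : Phi 1 (q0 + h *: e, 0) = (q0 + h *: e, 0) by [].
  rewrite -[RHS]F0 //.
  apply: (has_der_constant_zero (u := Phi^~ (q0 + h *: e, 0)) _ lt12) => t t2.
  have := Fd t _ t2 Qh; rewrite /G; have [-> _] := HP t _ Qh t2.
  have -> : B (Phi t (q0 + h *: e, 0)) = B ((Phi t (q0 + h *: e, 0)).1, 0).
    by have [P2 _] := HP t _ Qh t2; rewrite [in LHS](surjective_pairing (Phi t _)) P2.
  by rewrite B0 ?scale0r ?add0r ?oppr0 //; exact: FU.
have key q u : V q -> alpha q u = 0 -> 'D_u f q = 0.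
  move=> Vq au; rewrite (has_derE (fD q u Vq)); have [Qq Uq] := Vq.
  pose xi := (u, pi u); pose w t := 'D_xi (Phi t) (A q).
  pose g t := Phi t (A q).
  have wD t : `|t| < 2 -> has_der (Phi t) (A q) xi (w t).
    move=> t2; apply: derivable_has_der.
    exact: flow_directional_derivative cEE oF oQ (Gs 2) HF Qq t2.
  have w0 : w 0 = xi.
    apply: has_derE; apply: (@has_der_near _ _ _ id); last exact: has_der_affine.
    by have [s s0 Hs] := open_line xi oQ Qq; exists s => // h /Hs /F0 ->.
  (* All end points at time 1 have a controlled projection pi(p.1 - p.2); along the image of [A] it
     does not vary, so the variation at time 1 is parallel to [e]. *)
  have pw : pi (w 1).1 = 0.
    have apf := affine_map_comp (affine_map_fst E E) affine_pi.
    rewrite -[LHS]/((pi \o fst) (w 1)) -(has_derE (has_der_affine_post apf (wD 1 lt12))).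
    apply: has_derE; apply: (@has_der_near _ _ _ (fun p : E * E => pi (p.1 - p.2))).
      have [s s0 Hs] := open_line xi oQ Qq; exists s => // h /Hs Qh.
      by have [_ P1] := HP 1 _ Qh lt12; rewrite /= P1 scale1r.
    have -> : 0 = pi ((u, pi u).1 - (u, pi u).2).
      by rewrite /= /pi opprB [u + _]addrC subrK lZ le1 mulr1 subrr.
    apply: (@has_der_affine R (E * E)%type E) => h /=.
    have [_ _ H _] := affine_pi; rewrite -H; congr pi.
    by rewrite opprD addrACA -scalerBr.
  pose a t := alpha (g t).1 (w t).1.
  (* The derivative of a = alpha(w) is d alpha(G, w). Splitting w into a horizontal part and (a /
     alpha(e)) e, closedness removes the horizontal part and leaves c a with this coefficient. Thus
     a(0) = 0 forces a(1) = 0, and since w(1) is parallel to [e], w(1) has no first component. *)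
  pose c t := (d1 (g t).1 (G (g t)).1 e - d1 (g t).1 e (G (g t)).1) / alpha (g t).1 e.
  have Ug t : `|t| < 2 -> U (g t).1 by move=> t2; exact: FU.
  have t01 (t : R) : 0 <= t <= 1 -> `|t| < 2.
    by move=> /andP[t0 t1]; rewrite ger0_norm //; lra.
  have gD t : `|t| < 2 -> has_der g t 1 (G (g t)) by move=> t2; exact: Fd.
  have aD t : 0 <= t <= 1 -> has_der a t 1 (c t * a t).
    move=> /t01 t2; have Ut := Ug t t2.
    have wV := flow_variation xi cEE oF oQ (Gs 2) HF Qq t2.
    have g1D := has_der_affine_post (affine_map_fst E E) (gD t t2).
    have w1D := has_der_affine_post (affine_map_fst E E) wV.
    have := has_der_comp oF (alphas 1) (Ut : (fst @^-1` U) ((g t).1, (w t).1))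
      (has_der_pair g1D w1D).
    rewrite tangent_ahat // -/(w t) -/(g t).
    have := G_horizontal_der (w t) (Ut : U (g t).1) => GE.
    have -> : alpha (g t).1 (tangent_map G (g t, w t)).1 = - d1 (g t).1 (w t).1 (G (g t)).1.
      by apply/eqP; rewrite -addr_eq0 addrC GE.
    set p := (g t).1 in Ut *; set G1 := (G (g t)).1.
    have aG : alpha p G1 = 0 by exact: G_horizontal.
    pose b := a t / alpha p e; pose wh := (w t).1 - b *: e.
    have wE : (w t).1 = wh + b *: e by rewrite subrK.
    have awh : alpha p wh = 0.
      by rewrite /wh -scaleNr alphaD // mulNr /b mulfVK ?alphae // subrr.
    have cl : d1 p G1 wh = d1 p wh G1.
      by rewrite -!d1E //; exact: closed_on_kernel.
    move=> D; have {D} : has_der a t 1 (d1 p G1 (w t).1 - d1 p (w t).1 G1) := D.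
    rewrite wE d1_addr // d1_addl // cl.
    suff -> : c t * a t = d1 p wh G1 + b * d1 p G1 e - (d1 p wh G1 + b * d1 p e G1) by [].
    rewrite /c /b -/p -/G1; ring.
  have cc t : 0 <= t <= 1 -> {for t, continuous c}.
    move=> /t01 t2; have Ut := Ug t t2.
    have cg : {for t, continuous g} := has_der_continuousR (gD t t2).
    have cg1 : {for t, continuous (fun t => (g t).1)}.
      by apply: (@continuous_comp _ _ _ g fst); [exact: cg|exact: cvg_fst].
    have cG1 : {for t, continuous (fun t => (G (g t)).1)}.
      apply: (@continuous_comp _ _ _ g (fun z => (G z).1)); first exact: cg.
      apply: (@continuous_comp _ _ _ G fst); last exact: cvg_fst.
      exact: Ck_continuous (Gs 0) Ut.
    have ccst (v : E) : {for t, continuous (fun=> v)} by exact: cvg_cst.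
    have cd (y v : R -> E) : {for t, continuous y} -> {for t, continuous v} ->
        {for t, continuous (fun t => d1 (g t).1 (v t) (y t))}.
      move=> cy cv; apply: (@continuous_comp _ _ _
         (fun t => (((g t).1, y t), (v t, 0))) (tangent_map ahat)).
        exact: (cvg_pair (cvg_pair cg1 cy) (cvg_pair cv (ccst 0))).
      exact: (Ck_continuous (Csmooth_tangent alphas 0)).
    apply: cvgM.
      by apply: cvgB; apply: cd => //; exact: ccst.
    apply: cvgV; first exact: alphae.
    apply: (@continuous_comp _ _ _ (fun t => ((g t).1, e)) ahat).
      exact: (cvg_pair cg1 (ccst e)).
    exact: (Ck_continuous (alphas 0)).
  have a1 : a 1 = 0.
    apply: (linear_ode_zero cc aD).
    by rewrite /a w0 /g F0.
  have U1 := Ug 1 lt12.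
  have w1E : (w 1).1 = l (w 1).1 *: e.
    by apply/eqP; rewrite -subr_eq0; apply/eqP; exact: pw.
  move: a1; rewrite /a w1E alphaZ // => /eqP; rewrite mulf_eq0 (negbTE (alphae U1)) orbF.
  by move=> /eqP ->; rewrite scale0r -(scale0r e) lZ mul0r.
have cDe : Ck 0 V (fun q => tangent_map f (q, e)).
  exact: (@Ck_affine_comp _ _ _ _ _ _ (tangent_map f) _ _ (open_fst oV) (affine_map_pairl E e)
   (Csmooth_tangent fs 0)).
exists (V `&` [set q | tangent_map f (q, e) != 0]), f; split.
- exact: Ck_open_neq0 cDe.
- by split=> //; rewrite /= /tangent_map /= (has_derE De0) oner_neq0.
- by move=> q [[]].
- by apply: Csmooth_subset fs => q [].
- by move=> q [Vq nz]; split=> // u; exact: key.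
Qed.

End Frobenius.

(** * Symmetry of second derivatives, and C^k by partial derivatives versus tangent maps *)

Section Coordinates.
Context {R : realType}.
Implicit Types (V W : normedModType R).

Lemma Ck_tangent_at V W k (U : set V) (f : V -> W) v : open U ->
  Ck k.+1 U f -> Ck k U (fun x => 'D_v f x).
Proof.
move=> oU [_ _ Tf].
exact: (@Ck_affine_comp R V _ W k _ (tangent_map f) _ _ (open_fst oU) (affine_map_pairl V v) Tf).
Qed.

(** The second difference [F] is symmetric in u and v. Strict differentiability of the first
    derivative, and the mean value inequality in the other direction, show that it is h^2 times
    either mixed derivative up to o(h^2). *)
Lemma schwarz V W (U : set V) (f : V -> W) q u v : open U -> Ck 2 U f -> U q ->
  'D_u (fun y => 'D_v f y) q = 'D_v (fun y => 'D_u f y) q.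
Proof.
move=> oU f2 Uq; have f1 := Ck_pred f2.
pose F u v (h : R) := f (q + h *: u + h *: v) - f (q + h *: u) - (f (q + h *: v) - f q).
have FC h : F u v h = F v u h.
  rewrite /F [q + _ + _]addrAC; move: (f _) (f _) (f _) (f _) => a b c d.
  by rewrite !opprB [LHS](AC (2*2) ((1*4)*(3*2))).
have key u' v' (e : R) : 0 < e -> exists2 r : R, 0 < r & forall h, `|h| < r ->
    `|F u' v' h - h ^+ 2 *: 'D_u' (fun y => 'D_v' f y) q| <= e * `|h| ^+ 2.
  move=> e0; have g1 : Ck 1 U (fun y => 'D_v' f y) by exact: Ck_tangent_at.
  have [r r0 Hr] := strict_differentiability u' oU g1 Uq e0.
  have [m m0 Hm] := open_ball_subset oU Uq.
  pose N := `|u'| + `|v'| + 1; have N0 : 0 < N by rewrite /N; have := normr_ge0 u'; have := normr_ge0 v'; lra.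
  pose s := Num.min r (Num.min (r / N) (m / N)).
  have s0 : 0 < s by rewrite !lt_min r0 !divr_gt0.
  exists s => // h; rewrite !lt_min => /and3P[hr]; rewrite !ltr_pdivlMr // => hrN hmN.
  have hu : `|h| * `|u'| <= `|h| * N.
    by rewrite ler_wpM2l // /N; have := normr_ge0 v'; lra.
  have near t : 0 <= t <= 1 -> `|t *: (h *: v')| <= `|h| * `|v'|.
    by move=> /andP[t0 t1]; rewrite !normrZ (ger0_norm t0) ler_piMl // mulr_ge0.
  have Nvu t : 0 <= t <= 1 -> `|t *: (h *: v')| + `|h *: u'| <= `|h| * N.
    move=> /near; rewrite [`|h *: u'|]normrZ /N !mulrDr mulr1; have := normr_ge0 h; lra.
  have U1 t : 0 <= t <= 1 -> U (q + t *: (h *: v')).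
    move=> t01; apply: Hm; rewrite addrC addKr; have := Nvu t t01; have := normr_ge0 (h *: u'); lra.
  have U2 t : 0 <= t <= 1 -> U (q + h *: u' + t *: (h *: v')).
    move=> t01; apply: Hm; rewrite (AC (3*1) ((1*4)*(2*3))) /= subrr add0r.
    have := ler_normD (h *: u') (t *: (h *: v')); have := Nvu t t01; lra.
  set S := 'D_u' _ q.
  pose g := tangent_map f.
  have := @norm_mean_value R W 1 (e * `|h| ^+ 2)
    (fun t => f (q + h *: u' + t *: (h *: v')) - f (q + t *: (h *: v')) - t *: (h ^+ 2 *: S))
    (fun t => g (q + h *: u' + t *: (h *: v'), h *: v') - g (q + t *: (h *: v'), h *: v')
       - h ^+ 2 *: S) ler01.
  rewrite !scale1r !scale0r !addr0 subr0 mulr1 => H.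
  have -> : F u' v' h - h ^+ 2 *: S = f (q + h *: u' + h *: v') - f (q + h *: v') - h ^+ 2 *: S
      - (f (q + h *: u') - f q).
    rewrite /F addrAC; move: (f _) (f _) (f _) (f _) => a b c d.
    by rewrite !opprB [LHS](AC (3*2) ((1*5*3)*(4*2))).
  apply: H => t t01.
    apply: has_derB; last by apply: has_der_affine => x; rewrite scaler1 scalerDl.
    apply: has_derB; apply: (has_der_affine_comp (affine_map_line _ _)); rewrite scale1r;
      by apply: Ck_has_der f1 _; auto.
  rewrite /g !(tangent_map_scale _ _ f1); [|exact: U1|exact: U2].
  rewrite -scalerBr expr2 -scalerA -scalerBr normrZ expr2 mulrCA ler_wpM2l //.
  have := Hr (q + t *: (h *: v')) u' h; rewrite subrr normr0 [q + _ + _]addrAC.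
  apply => //; rewrite addrC addKr; have := Nvu t t01; have := normr_ge0 (h *: u'); lra.
apply/eqP; rewrite -subr_eq0 -normr_le0; apply/ler_addgt0Pr => e e0; rewrite add0r.
have e2 : 0 < e / 2 by rewrite divr_gt0.
have [r r0 Hr] := key u v _ e2; have [s s0 Hs] := key v u _ e2.
pose h := Num.min r s / 2; have rs : 0 < Num.min r s by rewrite lt_min r0.
have h0 : 0 < h by rewrite divr_gt0.
have [hr hs] : h < r /\ h < s.
  have : Num.min r s <= r by rewrite ge_min lexx.
  have : Num.min r s <= s by rewrite ge_min lexx orbT.
  rewrite /h; lra.
have := Hr h; have := Hs h; rewrite gtr0_norm // => /(_ hs) A /(_ hr) C.
have h20 : 0 < h ^+ 2 by rewrite exprn_gt0.
rewrite -(ler_pM2l h20) -{1}(gtr0_norm h20) -normrZ scalerBr.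
have := ler_distD (F u v h) (h ^+ 2 *: 'D_u (fun y => 'D_v f y) q)
  (h ^+ 2 *: 'D_v (fun y => 'D_u f y) q).
rewrite distrC -FC in A *; rewrite (distrC (h ^+ 2 *: _) (F u v h)).
lra.
Qed.

(** One step of the passage from partial to directional derivatives: only the derivative along the
    added direction [w] has to exist near x and be continuous at x, since the mean value inequality
    is used along [w] alone. *)
Lemma has_der_add_dir V W (U : set V) (f g : V -> W) x v d w (c : R) : open U -> U x ->
  (forall y, U y -> has_der f y w (g y)) -> {for x, continuous g} ->
  has_der f x v d -> has_der f x (v + c *: w) (d + c *: g x).
Proof.
move=> oU Ux fg cg fd e e0.
have e2 : 0 < e / 2 by rewrite divr_gt0.
pose C := `|c| + 1; have C0 : 0 < C by rewrite ltr_wpDl.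
have e2C : 0 < e / (2 * C) by rewrite divr_gt0 // mulr_gt0.
have [r r0 Hr] := fd _ e2; have /continuous_epsP/(_ _ e2C)[s s0 Hs] := cg.
have [m m0 Hm] := open_ball_subset oU Ux.
pose N := `|v| + C * `|w| + 1.
have N0 : 0 < N.
  by have := normr_ge0 v; have := mulr_ge0 (ltW C0) (normr_ge0 w); rewrite /N; lra.
exists (Num.min r (Num.min (s / N) (m / N))); first by rewrite !lt_min r0 !divr_gt0.
move=> h; rewrite !lt_min => /and3P[hr]; rewrite !ltr_pdivlMr // => hs hm.
pose p t := x + h *: v + t *: ((h * c) *: w).
have near t : 0 <= t <= 1 -> `|p t - x| <= `|h| * N.
  move=> /andP[t0 t1]; rewrite /p (AC (3*1) ((1*4)*(2*3))) /= subrr add0r.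
  apply: le_trans (ler_normD _ _) _; rewrite !normrZ (ger0_norm t0) ?normrM.
  have : t * (`|h| * `|c| * `|w|) <= `|h| * (C * `|w|).
    rewrite -mulrA; apply: (@le_trans _ _ (`|h| * (`|c| * `|w|))).
      by rewrite ler_piMl // !mulr_ge0.
    by rewrite ler_wpM2l // ler_wpM2r // lerDl.
  rewrite /N !mulrDr mulr1; have := normr_ge0 h; lra.
have A := Hr h hr.
have := @norm_mean_value R W 1 (e / 2 * `|h|)
  (fun t => f (p t) - t *: ((h * c) *: g x))
  (fun t => (h * c) *: g (p t) - (h * c) *: g x) ler01.
rewrite /p !scale1r !scale0r !addr0 subr0 mulr1 -/p => H.
have {}H : `|f (x + h *: v + (h * c) *: w) - (h * c) *: g x - f (x + h *: v)| <= e / 2 * `|h|.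
  apply: H => t t01.
    apply: has_derB; last by apply: has_der_affine => y; rewrite scaler1 scalerDl.
    apply: (has_der_affine_comp (affine_map_line _ _)); rewrite scale1r.
    apply: has_der_scalev; apply: fg; apply: Hm; exact: le_lt_trans (near t t01) _.
  rewrite -scalerBr normrZ normrM mulrAC -mulrA mulrC.
  rewrite ler_wpM2r //.
  have B : `|g (p t) - g x| <= e / (2 * C).
    by apply/ltW/Hs; exact: le_lt_trans (near t t01) _.
  apply: (@le_trans _ _ (C * (e / (2 * C)))).
    by rewrite mulrC; apply: ler_pM => //; rewrite lerDl.
  by rewrite le_eqVlt; apply/orP; left; apply/eqP; field; rewrite gt_eqF.
have -> : f (x + h *: (v + c *: w)) - f x - h *: (d + c *: g x) =
   (f (x + h *: v + (h * c) *: w) - (h * c) *: g x - f (x + h *: v)) +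
   (f (x + h *: v) - f x - h *: d).
  rewrite !scalerDr !scalerA addrA; move: (f _) (f _) (f _) => a b b'.
  by rewrite opprD [RHS](AC (3*3) ((3*4)*((1*5)*(6*2)))) /= addNr add0r addrA.
by apply: le_trans (ler_normD _ _) _; lra.
Qed.

Lemma Ck_sum V W k (U : set V) (I : Type) (s : seq I) (f : I -> V -> W) : open U ->
  (forall i, Ck k U (f i)) -> Ck k U (fun x => \sum_(i <- s) f i x).
Proof.
move=> oU fk; elim: s => [|i s IH].
  by rewrite (_ : (fun x => _) = fun=> 0); [exact: Ck_cst|apply/funext => x; rewrite big_nil].
rewrite (_ : (fun x => _) = fun x => f i x + \sum_(j <- s) f j x); first exact: CkD.
by apply/funext => x; rewrite big_cons.
Qed.

Lemma affine_map_coord n (i : 'I_n.+1) :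
  affine_map (fun v : 'rV[R]_n.+1 => v 0 i) (fun v => v 0 i).
Proof.
split=> [x|x|x v h|x v h]; try exact: coord_continuous.
- by rewrite !mxE.
- by rewrite !mxE.
Qed.

Lemma has_der_partials n (U : set 'rV[R]_n.+1) (f : 'rV[R]_n.+1 -> R) x v :
  open U -> U x ->
  (forall i y, U y -> derivable f y (delta_mx 0 i)) ->
  (forall i, {for x, continuous (fun y => 'D_(delta_mx 0 i) f y)}) ->
  has_der f x v (\sum_i v 0 i * 'D_(delta_mx 0 i) f x).
Proof.
move=> oU Ux fd fc.
rewrite {1}(row_sum_delta v).
elim: (index_enum _) => [|i s IH].
  rewrite !big_nil; by apply: has_der_affine => h; rewrite !scaler0 !addr0.
rewrite !big_cons addrC [X in has_der _ _ _ X]addrC.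
apply: (has_der_add_dir (v 0 i) oU Ux _ (fc i) IH) => y Uy.
by apply: derivable_has_der; exact: fd.
Qed.

Lemma Ck_on_Ck n k (U : set 'rV[R]_n.+1) (f : 'rV[R]_n.+1 -> R) : open U ->
  Ck_on k U f <-> Ck k U f.
Proof.
move=> oU; elim: k f => [|k IH] f; first by split=> [[]|].
split=> [[cf df]|fk].
  have der x v : U x -> has_der f x v (\sum_i v 0 i * 'D_(delta_mx 0 i) f x).
    move=> Ux; apply: (has_der_partials v oU Ux) => [i y Uy|i].
      by have [H _] := df i; exact: H.
    by have [_ /IH/Ck_continuous] := df i; exact.
  split=> //; first by move=> x v Ux; apply: has_der_derivable (der x v Ux).
  apply: (@Ck_eq _ _ _ _ _ (fun p : 'rV[R]_n.+1 * 'rV[R]_n.+1 =>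
     \sum_i p.2 0 i * 'D_(delta_mx 0 i) f p.1)); first exact: open_fst.
    by move=> [x v] Ux; apply/esym; exact: has_derE (der x v Ux).
  apply: Ck_sum => [|i]; first exact: open_fst.
  apply: CkM; first exact: open_fst.
    exact: (Ck_affine _ _ (affine_map_comp (affine_map_snd _ _) (affine_map_coord i))).
  apply: (@Ck_fst_comp R _ _ _ k U (fun x => 'D_(delta_mx 0 i) f x)) => //.
  by apply/IH; have [_ H] := df i.
have [cf df Tf] := fk; split=> // i; split; first by move=> x /df.
by apply/IH; exact: Ck_tangent_at.
Qed.

Lemma Cinf_on_Csmooth n (U : set 'rV[R]_n.+1) (f : 'rV[R]_n.+1 -> R) : open U ->
  Cinf_on U f <-> Csmooth U f.
Proof. by move=> oU; split=> H k; apply/Ck_on_Ck. Qed.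

Lemma frobenius_rV n (U : set 'rV[R]_n.+1) (a : 'I_n.+1 -> 'rV[R]_n.+1 -> R) q0 j0 :
  open U -> U q0 -> (forall j, Csmooth U (a j)) -> a j0 q0 != 0 ->
  (forall q (u v : 'rV[R]_n.+1), U q -> \sum_j a j q * u 0 j = 0 -> \sum_j a j q * v 0 j = 0 ->
     \sum_j 'D_u (a j) q * v 0 j = \sum_j 'D_v (a j) q * u 0 j) ->
  exists (V : set 'rV[R]_n.+1) (f : 'rV[R]_n.+1 -> R),
  [/\ open V, V q0, V `<=` U, Csmooth V f &
    forall q, V q -> 'D_(delta_mx 0 j0) f q != 0 /\
      forall u : 'rV[R]_n.+1, \sum_j a j q * u 0 j = 0 -> 'D_u f q = 0].
Proof.
move=> oU Uq0 as8 aq0 cl.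
pose U' := U `&` [set q | a j0 q != 0].
have oU' : open U' := Ck_open_neq0 oU (as8 j0 0).
pose alpha q (v : 'rV[R]_n.+1) := \sum_j a j q * v 0 j.
have alphas : Csmooth (fst @^-1` U' : set ('rV[R]_n.+1 * 'rV[R]_n.+1)) (fun p => alpha p.1 p.2).
  move=> k; have oF := open_fst (W := 'rV[R]_n.+1) oU'.
  apply: Ck_sum => // j; apply: CkM => //.
    apply: Ck_fst_comp => //; apply: Ck_subset (as8 j k); by move=> q [].
  exact: (Ck_affine _ _ (affine_map_comp (affine_map_snd _ _) (affine_map_coord j))).
have alphaD q v w (c : R) : U' q -> alpha q (v + c *: w) = alpha q v + c * alpha q w.
  move=> _; rewrite /alpha mulr_sumr -big_split; apply: eq_bigr => j _.
  by rewrite /= !mxE; ring.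
have alphae q : U' q -> alpha q (delta_mx 0 j0) != 0.
  move=> [_ aq]; rewrite /alpha (bigD1 j0) //= big1 => [|j jj0].
    by rewrite mxE !eqxx mulr1 addr0.
  by rewrite mxE (negbTE jj0) andbF mulr0.
have Da q u v : U' q -> 'D_u (alpha^~ v) q = \sum_j 'D_u (a j) q * v 0 j.
  move=> [Uq _]; apply: has_derE; rewrite /alpha.
  elim: (index_enum _) => [|j s IH].
    rewrite big_nil; rewrite (_ : (fun x => _) = cst 0); first exact: has_der_cst.
    by apply/funext => x; rewrite big_nil.
  rewrite big_cons (_ : (fun x => _) = fun x => v 0 j *: a j x + \sum_(j <- s) a j x * v 0 j).
    apply: has_derD IH; rewrite mulrC; apply: (@has_derZ _ _ _ (v 0 j)).
    exact: (Ck_has_der u (as8 j 1) Uq).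
  by apply/funext => x; rewrite big_cons mulrC.
have le1 : (delta_mx 0 j0 : 'rV[R]_n.+1) 0 j0 = 1 by rewrite mxE !eqxx.
have [|V [f [oV Vq0 VU fs Hf]]] := @frobenius_local R _ (@seq_complete_rV R n) U' q0 oU'
  (conj Uq0 aq0) (delta_mx 0 j0) _ (affine_map_coord j0) le1 alpha alphas alphaD alphae.
  move=> q u v Uq au av; rewrite !Da //; apply: cl => //; by case: Uq.
by exists V, f; split=> // q /VU[].
Qed.

End Coordinates.

(** * Smooth functions and vector fields on a manifold *)

Section RowValued.
Context {R : realType}.
Implicit Types (V W : normedModType R).

Lemma Ck_row V n k (U : set V) (g : V -> 'rV[R]_n.+1) : open U ->
  (forall i, Ck k U (fun u => g u 0 i)) -> Ck k U g.
Proof.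
move=> oU gk; rewrite (_ : g = fun u => \sum_i g u 0 i *: delta_mx 0 i).
  by apply: Ck_sum => // i; apply: Ck_affine_post (affine_map_scalel _) (gk i).
by apply/funext => u; exact: row_sum_delta.
Qed.

Lemma has_der_sum V W (I : Type) (s : seq I) (f : I -> V -> W) x v d :
  (forall i, has_der (f i) x v (d i)) ->
  has_der (fun y => \sum_(i <- s) f i y) x v (\sum_(i <- s) d i).
Proof.
move=> fd; elim: s => [|i s IH].
  rewrite big_nil (_ : (fun x => _) = cst 0); first exact: has_der_cst.
  by apply/funext => y; rewrite big_nil.
rewrite big_cons (_ : (fun x => _) = fun y => f i y + \sum_(j <- s) f j y).
  exact: has_derD.
by apply/funext => y; rewrite big_cons.
Qed.

Lemma has_der_row V n (g : V -> 'rV[R]_n.+1) x v (d : 'rV[R]_n.+1) :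
  (forall i, has_der (fun u => g u 0 i) x v (d 0 i)) -> has_der g x v d.
Proof.
move=> gd; rewrite (_ : g = fun u => \sum_i g u 0 i *: delta_mx 0 i); last first.
  by apply/funext => u; exact: row_sum_delta.
rewrite (row_sum_delta d); apply: has_der_sum => i.
exact: (has_der_affine_post (affine_map_scalel _) (gd i)).
Qed.

Lemma tangent_map_sum V n (U : set 'rV[R]_n.+1) (f : 'rV[R]_n.+1 -> V) x v :
  open U -> Ck 1 U f -> U x ->
  tangent_map f (x, v) = \sum_i v 0 i *: 'D_(delta_mx 0 i) f x.
Proof.
move=> oU f1 Ux; rewrite {1}(row_sum_delta v).
elim: (index_enum _) => [|i s IH]; first by rewrite !big_nil (tangent_map0 f1).
by rewrite !big_cons (tangent_mapD _ _ oU f1) // (tangent_map_scale _ _ f1) // IH.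
Qed.

End RowValued.

Section SmoothFunctions.
Context {R : realType} {n : nat} {M : smoothManifold R n}.
Implicit Types (U V : set M) (f g : M -> R) (x y z : M).

Lemma chart_image_sub_open x U : open U ->
  open (chart x @` (U `&` chart_dom x)).
Proof.
move=> oU; rewrite openE => u [y [Uy xy] <-].
have cx : {for chart x y, continuous (chart_inv x)}.
  by apply: chart_inv_continuous; exists y.
have oUx : open (U `&` chart_dom x) by apply: openI => //; exact: chart_dom_open.
have n1 : nbhs (chart x y) (chart_inv x @^-1` (U `&` chart_dom x)).
  by apply: cx; apply: open_nbhs_nbhs; split=> //; rewrite chartK.
have n2 : nbhs (chart x y) (chart x @` chart_dom x).
  by apply: open_nbhs_nbhs; split; [exact: chart_image_open|exists y].
apply: filterS (filterI n1 n2) => v /= [Uv [z xz zv]].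
by exists z => //; move: Uv; rewrite /= -zv chartK.
Qed.

Lemma chart_invK x u : (chart x @` chart_dom x) u -> chart x (chart_inv x u) = u.
Proof. by move=> [y xy <-]; rewrite chartK. Qed.

Lemma smooth_fun_onP U f : open U -> smooth_fun_on U f <->
  forall x, Csmooth (chart x @` (U `&` chart_dom x)) (f \o chart_inv x).
Proof.
by move=> oU; split=> H x; apply/Cinf_on_Csmooth; (try exact: H); exact: chart_image_sub_open.
Qed.

Lemma smooth_fun_sub U V f : open U -> open V -> V `<=` U ->
  smooth_fun_on U f -> smooth_fun_on V f.
Proof.
move=> oU oV VU /(smooth_fun_onP _ oU) fs; apply/smooth_fun_onP => // x.
apply: Csmooth_subset (fs x) => u [y [Vy xy] <-]; exists y => //; split=> //; exact: VU.
Qed.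

Lemma smooth_fun_eq U f g : open U -> (forall x, U x -> f x = g x) ->
  smooth_fun_on U f -> smooth_fun_on U g.
Proof.
move=> oU fg /(smooth_fun_onP _ oU) fs; apply/smooth_fun_onP => // x.
apply: Csmooth_eq (fs x); first exact: chart_image_sub_open.
by move=> u [y [Uy xy] <-] /=; rewrite chartK // fg.
Qed.

Lemma smooth_fun_local U f : open U ->
  (forall x, U x -> exists V, [/\ open V, V x & smooth_fun_on V f]) -> smooth_fun_on U f.
Proof.
move=> oU H; apply/smooth_fun_onP => // x k; apply: Ck_local => u [y [Uy xy] <-].
have [V [oV Vy /(smooth_fun_onP _ oV) fs]] := H y Uy.
by exists (chart x @` (V `&` chart_dom x)); [exists y|exact: fs].
Qed.

Lemma smooth_fun_comp_chart U x0 (F : 'rV[R]_n.+1 -> R) (W : set 'rV[R]_n.+1) :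
  open U -> U `<=` chart_dom x0 -> open W ->
  (forall y, U y -> W (chart x0 y)) -> Csmooth W F -> smooth_fun_on U (F \o chart x0).
Proof.
move=> oU Ux0 oW UW Fs; apply/smooth_fun_onP => // z k.
have oz : open (chart z @` (U `&` chart_dom z)) := chart_image_sub_open oU.
apply: (@Ck_comp R _ _ _ k W _ F (chart x0 \o chart_inv z)) => //; last first.
  apply: Ck_row => // i; apply: (@Ck_subset _ _ _ _ (chart z @` (chart_dom z `&` chart_dom x0))).
    by move=> u [y [Uy zy] <-]; exists y => //; split=> //; exact: Ux0.
  have := chart_transition_smooth z x0 i; rewrite Cinf_on_Csmooth; first exact.
  by rewrite setIC; apply: chart_image_sub_open; exact: chart_dom_open.
by move=> u [y [Uy zy] <-] /=; rewrite chartK //; exact: UW.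
Qed.

Lemma smooth_chart_coord x0 i : smooth_fun_on (chart_dom x0) (fun y => chart x0 y 0 i).
Proof. by move=> z; rewrite setIC; exact: chart_transition_smooth. Qed.

Lemma smooth_fun_cst U (c : R) : open U -> smooth_fun_on U (fun=> c).
Proof. by move=> oU; apply/smooth_fun_onP => // x k; exact: Ck_cst. Qed.

Lemma smooth_funD U f g : open U -> smooth_fun_on U f -> smooth_fun_on U g ->
  smooth_fun_on U (fun x => f x + g x).
Proof.
move=> oU /(smooth_fun_onP _ oU) fs /(smooth_fun_onP _ oU) gs.
apply/smooth_fun_onP => // x k; apply: CkD; [exact: chart_image_sub_open|exact: fs|exact: gs].
Qed.

Lemma smooth_funM U f g : open U -> smooth_fun_on U f -> smooth_fun_on U g ->
  smooth_fun_on U (fun x => f x * g x).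
Proof.
move=> oU /(smooth_fun_onP _ oU) fs /(smooth_fun_onP _ oU) gs.
apply/smooth_fun_onP => // x k; apply: CkM; [exact: chart_image_sub_open|exact: fs|exact: gs].
Qed.

Lemma smooth_funV U f : open U -> (forall x, U x -> f x != 0) -> smooth_fun_on U f ->
  smooth_fun_on U (fun x => (f x)^-1).
Proof.
move=> oU f0 /(smooth_fun_onP _ oU) fs; apply/smooth_fun_onP => // x k.
apply: CkV; [exact: chart_image_sub_open| |exact: fs].
by move=> u [y [Uy xy] <-] /=; rewrite chartK // f0.
Qed.

Lemma smooth_fun_sum U (I : Type) (s : seq I) (P : pred I) (F : I -> M -> R) : open U ->
  (forall i, smooth_fun_on U (F i)) -> smooth_fun_on U (fun x => \sum_(i <- s | P i) F i x).
Proof.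
move=> oU Fs; elim: s => [|i s IH].
  apply: (smooth_fun_eq oU _ (smooth_fun_cst 0 oU)) => x _; by rewrite big_nil.
have [Pi|Pi] := boolP (P i).
  by apply: (smooth_fun_eq oU _ (smooth_funD oU (Fs i) IH)) => x _; rewrite big_cons Pi.
by apply: (smooth_fun_eq oU _ IH) => x _; rewrite big_cons (negbTE Pi).
Qed.

Lemma smooth_fun_prod U (I : Type) (s : seq I) (F : I -> M -> R) : open U ->
  (forall i, smooth_fun_on U (F i)) -> smooth_fun_on U (fun x => \prod_(i <- s) F i x).
Proof.
move=> oU Fs; elim: s => [|i s IH].
  apply: (smooth_fun_eq oU _ (smooth_fun_cst 1 oU)) => x _; by rewrite big_nil.
by apply: (smooth_fun_eq oU _ (smooth_funM oU (Fs i) IH)) => x _; rewrite big_cons.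
Qed.

Lemma smooth_fun_det U m (A : M -> 'M[R]_m) : open U ->
  (forall i j, smooth_fun_on U (fun x => A x i j)) -> smooth_fun_on U (fun x => \det (A x)).
Proof.
move=> oU As; apply: smooth_fun_sum => // s; apply: smooth_funM => //.
  exact: smooth_fun_cst.
by apply: smooth_fun_prod.
Qed.

Lemma smooth_fun_invmx U m (A : M -> 'M[R]_m) i j : open U ->
  (forall i j, smooth_fun_on U (fun x => A x i j)) ->
  (forall x, U x -> A x \in unitmx) -> smooth_fun_on U (fun x => invmx (A x) i j).
Proof.
move=> oU As Au.
apply: (@smooth_fun_eq _ (fun x => (\det (A x))^-1 * cofactor (A x) j i)) => //.
  by move=> x /Au Ax; rewrite /invmx Ax !mxE.
apply: smooth_funM => //.
  apply: smooth_funV => //; last exact: smooth_fun_det.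
  by move=> x /Au; rewrite unitmxE unitfE.
apply: smooth_funM => //; first exact: smooth_fun_cst.
apply: smooth_fun_det => // i' j'.
by apply: (smooth_fun_eq oU _ (As (lift j i') (lift i j'))) => x _; rewrite !mxE.
Qed.

End SmoothFunctions.

(** * Tangent vectors as derivations, coordinate frames and the Lie bracket *)

Section TangentDerivative.
Context {R : realType} {n : nat} {M : smoothManifold R n}.
Implicit Types (U V : set M) (f g : M -> R) (x y z : M) (v w : 'rV[R]_n.+1)
  (X Y : vectorField M).

Lemma chart_image_mem x U : U x -> (chart x @` (U `&` chart_dom x)) (chart x x).
Proof. by move=> Ux; exists x => //; split=> //; exact: chart_dom_center. Qed.

Lemma smooth_fun_chart U f x : open U -> smooth_fun_on U f ->
  Csmooth (chart x @` (U `&` chart_dom x)) (f \o chart_inv x).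
Proof. by move=> oU /(smooth_fun_onP _ oU). Qed.

Lemma tder_has_der U f x v : open U -> smooth_fun_on U f -> U x ->
  has_der (f \o chart_inv x) (chart x x) v (tder f x v).
Proof.
move=> oU fs Ux.
exact: (Ck_has_der v (smooth_fun_chart x oU fs 1) (chart_image_mem Ux)).
Qed.

Lemma tder_linear U f x v w (c : R) : open U -> smooth_fun_on U f -> U x ->
  tder f x (v + c *: w) = tder f x v + c * tder f x w.
Proof.
move=> oU fs Ux; have f1 := smooth_fun_chart x oU fs 1.
have oc := chart_image_sub_open (x := x) oU; have cx := chart_image_mem Ux.
have := tangent_mapD v (c *: w) oc f1 cx; rewrite (tangent_map_scale _ _ f1) //.
Qed.

Lemma tder0 U f x : open U -> smooth_fun_on U f -> U x -> tder f x 0 = 0.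
Proof.
move=> oU fs Ux; have := tder_linear 0 0 1 oU fs Ux.
by rewrite scaler0 addr0 mul1r => /eqP; rewrite -subr_eq subrr eq_sym => /eqP.
Qed.

Lemma tderZ U f x v (c : R) : open U -> smooth_fun_on U f -> U x ->
  tder f x (c *: v) = c * tder f x v.
Proof.
by move=> oU fs Ux; rewrite -[c *: v]add0r (tder_linear _ _ _ oU fs Ux) (tder0 oU fs Ux) add0r.
Qed.

Lemma tder_sumv U f x (I : Type) (s : seq I) (a : I -> R) (e : I -> 'rV[R]_n.+1) :
  open U -> smooth_fun_on U f -> U x ->
  tder f x (\sum_(i <- s) a i *: e i) = \sum_(i <- s) a i * tder f x (e i).
Proof.
move=> oU fs Ux; elim: s => [|i s IH]; first by rewrite !big_nil (tder0 oU fs Ux).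
by rewrite !big_cons addrC (tder_linear _ _ _ oU fs Ux) IH addrC.
Qed.

Lemma chart_line_near x U u v : open U -> (chart x @` (U `&` chart_dom x)) u ->
  exists2 r : R, 0 < r & forall h : R, `|h| < r ->
    U (chart_inv x (u + h *: v)) /\ (chart x @` chart_dom x) (u + h *: v).
Proof.
move=> oU Ux; have [r r0 Hr] := open_line v (chart_image_sub_open oU) Ux.
exists r => // h /Hr [y [Uy xy] <-]; split; last by exists y.
by rewrite chartK.
Qed.

Lemma tder_eq U f g x v : open U -> (forall y, U y -> f y = g y) ->
  smooth_fun_on U f -> U x -> tder f x v = tder g x v.
Proof.
move=> oU fg fs Ux; apply/esym/has_derE.
apply: has_der_near (tder_has_der v oU fs Ux).
have [r r0 Hr] := chart_line_near v oU (chart_image_mem Ux).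
by exists r => // h /Hr [Uh _]; exact: fg.
Qed.

Lemma tderD U f g x v : open U -> smooth_fun_on U f -> smooth_fun_on U g -> U x ->
  tder (fun y => f y + g y) x v = tder f x v + tder g x v.
Proof.
move=> oU fs gs Ux; apply: has_derE.
exact: (has_derD (tder_has_der v oU fs Ux) (tder_has_der v oU gs Ux)).
Qed.

Lemma tderM U f g x v : open U -> smooth_fun_on U f -> smooth_fun_on U g -> U x ->
  tder (fun y => f y * g y) x v = f x * tder g x v + tder f x v * g x.
Proof.
move=> oU fs gs Ux; apply: has_derE.
have /is_derive_has_der Hf := tder_has_der v oU fs Ux.
have /is_derive_has_der Hg := tder_has_der v oU gs Ux.
apply/is_derive_has_der; apply: is_derive_eq => /=.
rewrite chartK; last exact: chart_dom_center.
by congr (_ + _); exact: mulrC.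
Qed.

Lemma tder_cst x v (c : R) : tder (fun=> c) x v = 0.
Proof. by apply: has_derE; exact: has_der_cst. Qed.

Lemma tder_sum U (I : Type) (s : seq I) (f : I -> M -> R) x v :
  open U -> (forall i, smooth_fun_on U (f i)) -> U x ->
  tder (fun y => \sum_(i <- s) f i y) x v = \sum_(i <- s) tder (f i) x v.
Proof.
move=> oU fs Ux; elim: s => [|i s IH].
  rewrite big_nil (_ : (fun y => _) = fun=> 0) ?tder_cst //.
  by apply/funext => y; rewrite big_nil.
rewrite big_cons -IH -(tderD v oU (fs i) _ Ux); last exact: smooth_fun_sum.
by congr (tder _ _ _); apply/funext => y; rewrite big_cons.
Qed.

Definition chart_coord x i : M -> R := fun y => chart x y 0 i.

(** The k-th coordinate field of the chart at [x]. Tangent vectors at [y] are read in the chart at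
    [y], so its components are partial derivatives of the transition map. *)
Definition coord_frame x (k : 'I_n.+1) : vectorField M := fun y =>
  \row_i 'D_(delta_mx 0 k) (chart_coord y i \o chart_inv x) (chart x y).

Lemma smooth_coord x i : smooth_fun_on (chart_dom x) (chart_coord x i).
Proof. exact: smooth_chart_coord. Qed.

Lemma tder_coord_center x i v : tder (chart_coord x i) x v = v 0 i.
Proof.
apply: has_derE; apply: (@has_der_near _ _ _ (fun u : 'rV[R]_n.+1 => u 0 i)).
  have [r r0 Hr] := chart_line_near v (@openT M) (chart_image_mem (I : [set: M] x)).
  by exists r => // h /Hr [_ Uh]; rewrite /= /chart_coord chart_invK.
by apply: has_der_affine => h; rewrite !mxE.
Qed.

Lemma tder_coord_frame U x k f y : open U -> smooth_fun_on U f -> U y -> chart_dom x y ->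
  tder f y (coord_frame x k y) = 'D_(delta_mx 0 k) (f \o chart_inv x) (chart x y).
Proof.
move=> oU fs Uy xy; apply/esym/has_derE.
have yx : (chart x @` (chart_dom y `&` chart_dom x)) (chart x y).
  by exists y => //; split=> //; exact: chart_dom_center.
have oyx : open (chart x @` (chart_dom y `&` chart_dom x)).
  by apply: chart_image_sub_open; exact: chart_dom_open.
have gD : has_der (chart y \o chart_inv x) (chart x y) (delta_mx 0 k) (coord_frame x k y).
  apply: has_der_row => i; rewrite mxE.
  have ys := smooth_fun_chart x (chart_dom_open y) (smooth_coord y i).
  exact: (Ck_has_der (delta_mx 0 k) (ys 1) yx).
have f1 := smooth_fun_chart y oU fs 1.
have oc := chart_image_sub_open (x := y) oU.
have cy : (chart y @` (U `&` chart_dom y)) ((chart y \o chart_inv x) (chart x y)).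
  by rewrite /= chartK //; exact: chart_image_mem.
have := has_der_comp oc f1 cy gD; rewrite /= chartK //.
apply: has_der_near.
have [r r0 Hr] := open_line (delta_mx 0 k) oyx yx; exists r => // h /Hr [z [yz xz] <-].
by rewrite /= !chartK.
Qed.

Lemma tder_expand U x f y v : open U -> smooth_fun_on U f -> U y -> chart_dom x y ->
  tder f y v = \sum_k tder (chart_coord x k) y v * tder f y (coord_frame x k y).
Proof.
move=> oU fs Uy xy.
under eq_bigr do rewrite (tder_coord_frame _ oU fs Uy xy).
have yx : (chart x @` (U `&` chart_dom x)) (chart x y) by exists y.
pose L := \row_k tder (chart_coord x k) y v.
have gD : has_der (chart x \o chart_inv y) (chart y y) v L.
  apply: has_der_row => i; rewrite mxE.
  exact: (tder_has_der v (chart_dom_open x) (smooth_coord x i) xy).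
have f1 := smooth_fun_chart x oU fs 1.
have oc := chart_image_sub_open (x := x) oU.
have yy := chart_dom_center y.
have cy : (chart x @` (U `&` chart_dom x)) ((chart x \o chart_inv y) (chart y y)).
  by rewrite /= chartK.
have := has_der_comp oc f1 cy gD; rewrite /= chartK // (tangent_map_sum _ oc f1 yx) => D.
have -> : tder f y v = \sum_i L 0 i *: 'D_(delta_mx 0 i) (f \o chart_inv x) (chart x y).
  apply: has_derE; apply: has_der_near D.
  have [r r0 Hr] := chart_line_near v (chart_dom_open x) (chart_image_mem xy).
  by exists r => // h /Hr [xh _]; rewrite /= chartK.
by apply: eq_bigr => i _; rewrite mxE.
Qed.

Lemma tangent_ext x y v w : chart_dom x y ->
  (forall k, tder (chart_coord x k) y v = tder (chart_coord x k) y w) -> v = w.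
Proof.
move=> xy H; apply/rowP => i; rewrite -!(tder_coord_center y).
rewrite !(tder_expand _ (chart_dom_open y) (smooth_coord y i) (chart_dom_center y) xy).
by apply: eq_bigr => k _; rewrite H.
Qed.

Lemma tder_coord_coord_frame x i k y : chart_dom x y ->
  tder (chart_coord x i) y (coord_frame x k y) = (i == k)%:R.
Proof.
move=> xy; rewrite (tder_coord_frame _ (chart_dom_open x) (smooth_coord x i) xy xy).
apply: has_derE; apply: (@has_der_near _ _ _ (fun u : 'rV[R]_n.+1 => u 0 i)).
  have [|r r0 Hr] := chart_line_near (x := x) (u := chart x y) (delta_mx 0 k) (@openT M).
    by exists y.
  by exists r => // h /Hr [_ Uh]; rewrite /= /chart_coord chart_invK.
by apply: has_der_affine => h; rewrite !mxE eqxx eq_sym.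
Qed.

Lemma tangent_expand x y v : chart_dom x y ->
  v = \sum_k tder (chart_coord x k) y v *: coord_frame x k y.
Proof.
move=> xy; apply: (tangent_ext xy) => k.
rewrite (tder_sumv _ _ _ (chart_dom_open x) (smooth_coord x k) xy).
rewrite (bigD1 k) //= tder_coord_coord_frame // eqxx mulr1 big1 ?addr0 // => j jk.
by rewrite tder_coord_coord_frame // eq_sym (negbTE jk) mulr0.
Qed.

Lemma smooth_coord_frame x k : smooth_vf_on (chart_dom x) (coord_frame x k).
Proof.
move=> V f oV Vx fs.
have oc : open (chart x @` V) by rewrite -(setIidl Vx); exact: chart_image_sub_open.
apply: (@smooth_fun_eq _ _ _ _ ((fun u => 'D_(delta_mx 0 k) (f \o chart_inv x) u) \o chart x)) => //.
  by move=> y Vy; rewrite /vf_act (tder_coord_frame _ oV fs Vy (Vx y Vy)).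
apply: (smooth_fun_comp_chart oV Vx oc); first by move=> y Vy; exists y.
move=> j; apply: Ck_tangent_at => //.
by have := smooth_fun_chart x oV fs j.+1; rewrite (setIidl Vx).
Qed.

Lemma vf_act_expand U x X f y : open U -> smooth_fun_on U f -> U y -> chart_dom x y ->
  vf_act X f y = \sum_k vf_act X (chart_coord x k) y * vf_act (coord_frame x k) f y.
Proof. by move=> oU fs Uy xy; exact: tder_expand oU fs Uy xy. Qed.

Lemma smooth_vf_sub U V X : V `<=` U -> smooth_vf_on U X -> smooth_vf_on V X.
Proof. by move=> VU Xs W f oW WV; apply: Xs => //; exact: subset_trans VU. Qed.

Lemma smooth_vf_act U X f : open U -> smooth_vf_on U X -> smooth_fun_on U f ->
  smooth_fun_on U (vf_act X f).
Proof. by move=> oU Xs fs; exact: Xs. Qed.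

Lemma smooth_vf_local U X : (forall x, U x -> exists V,
  [/\ open V, V x & smooth_vf_on V X]) -> smooth_vf_on U X.
Proof.
move=> H V f oV VU fs; apply: smooth_fun_local => // x Vx.
have [W [oW Wx Ws]] := H x (VU x Vx); exists (V `&` W); split=> //; first exact: openI.
apply: Ws => //; first exact: openI.
apply: smooth_fun_sub fs => //; exact: openI.
Qed.

Lemma smooth_vf_coords U x X : open U -> U `<=` chart_dom x ->
  (forall k, smooth_fun_on U (vf_act X (chart_coord x k))) -> smooth_vf_on U X.
Proof.
move=> oU Ux Xs V f oV VU fs.
apply: (@smooth_fun_eq _ _ _ _ (fun y =>
  \sum_k vf_act X (chart_coord x k) y * vf_act (coord_frame x k) f y)) => //.
  by move=> y Vy; rewrite (vf_act_expand _ oV fs Vy (Ux _ (VU _ Vy))).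
apply: smooth_fun_sum => // k; apply: smooth_funM => //.
  exact: smooth_fun_sub (Xs k).
by apply: smooth_coord_frame => //; exact: subset_trans Ux.
Qed.

Lemma smooth_vf_lin U X Y g : open U -> smooth_fun_on U g ->
  smooth_vf_on U X -> smooth_vf_on U Y -> smooth_vf_on U (fun x => X x + g x *: Y x).
Proof.
move=> oU gs Xs Ys V f oV VU fs.
apply: (@smooth_fun_eq _ _ _ _ (fun x => vf_act X f x + g x * vf_act Y f x)) => //.
  by move=> x Vx; rewrite /vf_act (tder_linear _ _ _ oV fs Vx).
apply: smooth_funD => //; first exact: Xs.
apply: smooth_funM => //; last exact: Ys.
exact: smooth_fun_sub gs.
Qed.

Lemma smooth_vf0 U : smooth_vf_on U (fun=> 0 : 'rV[R]_n.+1).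
Proof.
move=> V f oV VU fs; apply: (smooth_fun_eq oV _ (smooth_fun_cst 0 oV)) => x Vx.
by rewrite /vf_act (tder0 oV fs Vx).
Qed.

Lemma smooth_vf_sum U (I : Type) (s : seq I) (g : I -> M -> R) (X : I -> vectorField M) :
  open U -> (forall i, smooth_fun_on U (g i)) -> (forall i, smooth_vf_on U (X i)) ->
  smooth_vf_on U (fun x => \sum_(i <- s) g i x *: X i x).
Proof.
move=> oU gs Xs; elim: s => [|i s IH].
  rewrite (_ : (fun x => _) = fun=> 0); first exact: smooth_vf0.
  by apply/funext => x; rewrite big_nil.
rewrite (_ : (fun x => _) = fun x => \sum_(j <- s) g j x *: X j x + g i x *: X i x).
  exact: smooth_vf_lin.
by apply/funext => x; rewrite big_cons addrC.
Qed.

Lemma smooth_vf_eq U X Y : (forall x, U x -> X x = Y x) ->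
  smooth_vf_on U X -> smooth_vf_on U Y.
Proof.
move=> XY Xs V f oV VU fs; apply: smooth_fun_eq (Xs V f oV VU fs) => //.
by move=> x /VU Ux; rewrite /vf_act XY.
Qed.

(** The bracket is defined by its values on the coordinates of one chart. Expanding X(Y f) in that
    chart gives first-order terms, which reproduce this definition, and second-order terms symmetric
    in X and Y, which cancel. *)
Theorem bracket_act U X Y f x : open U -> smooth_vf_on U X -> smooth_vf_on U Y ->
  smooth_fun_on U f -> U x ->
  tder f x (bracket X Y x) = vf_act X (vf_act Y f) x - vf_act Y (vf_act X f) x.
Proof.
move=> oU Xs Ys fs Ux.
pose U' := U `&` chart_dom x; have xx := chart_dom_center x.
have oU' : open U' by apply: openI => //; exact: chart_dom_open.
have U'x : U' x by [].
have U'U : U' `<=` U by move=> y [].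
have U'd : U' `<=` chart_dom x by move=> y [].
have fs' := smooth_fun_sub oU oU' U'U fs.
pose E := coord_frame x.
have Es k : smooth_vf_on U' (E k) := smooth_vf_sub U'd (@smooth_coord_frame x k).
have cs k : smooth_fun_on U' (chart_coord x k).
  exact: (smooth_fun_sub (chart_dom_open x) oU' U'd (@smooth_coord x k)).
have Efs k : smooth_fun_on U' (vf_act (E k) f) by exact: Es.
have second Z W : smooth_vf_on U Z -> smooth_vf_on U W ->
    vf_act Z (vf_act W f) x = \sum_k vf_act Z (vf_act W (chart_coord x k)) x * vf_act (E k) f x
      + \sum_k \sum_j vf_act W (chart_coord x k) x * vf_act Z (chart_coord x j) x
          * vf_act (E j) (vf_act (E k) f) x.
  move=> Zs Ws.
  have Wcs k : smooth_fun_on U' (vf_act W (chart_coord x k)) by apply: Ws.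
  have -> : vf_act Z (vf_act W f) x =
      tder (fun y => \sum_k vf_act W (chart_coord x k) y * vf_act (E k) f y) x (Z x).
    apply: (tder_eq _ oU') => //; last by apply: Ws.
    by move=> y U'y; rewrite (vf_act_expand _ oU' fs' U'y (U'd y U'y)).
  rewrite (tder_sum _ _ oU') => [|k|//]; last exact: smooth_funM.
  rewrite -big_split; apply: eq_bigr => k _ /=.
  rewrite (tderM _ oU' (Wcs k) (Efs k) U'x) addrC; congr (_ + _).
  rewrite (tder_expand _ oU' (Efs k) U'x xx) mulr_sumr.
  by apply: eq_bigr => j _; rewrite mulrA.
rewrite (second X Y) // (second Y X) //.
rewrite (tder_expand _ oU fs Ux xx) opprD addrACA -sumrB.
have -> : \sum_k \sum_j vf_act Y (chart_coord x k) x * vf_act X (chart_coord x j) x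
      * vf_act (E j) (vf_act (E k) f) x =
   \sum_k \sum_j vf_act X (chart_coord x k) x * vf_act Y (chart_coord x j) x
      * vf_act (E j) (vf_act (E k) f) x.
  rewrite exchange_big; apply: eq_bigr => k _; apply: eq_bigr => j _ /=.
  have EE i l : vf_act (E i) (vf_act (E l) f) x =
     'D_(delta_mx 0 i) (fun u => 'D_(delta_mx 0 l) (f \o chart_inv x) u) (chart x x).
    rewrite /vf_act (tder_coord_frame _ oU' (Efs l) U'x xx).
    have fc2 := smooth_fun_chart x oU' fs' 2%N.
    have oc := chart_image_sub_open (x := x) oU'.
    apply: has_derE; apply: has_der_near (Ck_has_der _ (Ck_tangent_at _ oc fc2) (chart_image_mem U'x)).
    have [r r0 Hr] := open_line (delta_mx 0 i) oc (chart_image_mem U'x).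
    exists r => // h /Hr [y [U'y xy] <-].
    by rewrite /= /vf_act chartK // (tder_coord_frame _ oU' fs' U'y xy).
  have fc2 := smooth_fun_chart x oU' fs' 2%N.
  have sw : vf_act (E k) (vf_act (E j) f) x = vf_act (E j) (vf_act (E k) f) x.
    rewrite !EE.
    exact: (schwarz _ _ (chart_image_sub_open oU') fc2 (chart_image_mem U'x)).
  by rewrite sw (mulrC (vf_act Y (chart_coord x j) x)).
rewrite subrr addr0; apply: eq_bigr => k _.
by rewrite tder_coord_center mxE mulrBl.
Qed.

End TangentDerivative.

(** * Frames and coframes *)

Section LinearAlgebra.
Context {K : fieldType}.
Implicit Types (vT : vectType K).

Lemma unitmx_of_inj m (B : 'M[K]_m) :
  (forall v : 'rV_m, v *m B = 0 -> v = 0) -> B \in unitmx.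
Proof. by move=> H; rewrite -row_free_unit; exact: inj_row_free. Qed.

Lemma mktuple_nth vT m (w : 'I_m -> vT) (i : 'I_m) : [tuple w j | j < m]`_i = w i.
Proof. by rewrite -tnth_nth tnth_mktuple. Qed.

Lemma basis_expand vT m (U : {vspace vT}) (w : 'I_m -> vT) u :
  basis_of U [tuple w i | i < m] -> u \in U ->
  u = \sum_i coord [tuple w i | i < m] i u *: w i.
Proof.
move=> bw uU; rewrite {1}(coord_basis bw uU); apply: eq_bigr => i _.
by rewrite mktuple_nth.
Qed.

Lemma basis_coord vT m (U : {vspace vT}) (w : 'I_m -> vT) i j :
  basis_of U [tuple w i | i < m] -> coord [tuple w i | i < m] i (w j) = (j == i)%:R.
Proof. by move=> /basis_free fw; rewrite -(mktuple_nth w j) coord_free. Qed.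

Lemma basis_vec_mem vT m (U : {vspace vT}) (w : 'I_m -> vT) i :
  basis_of U [tuple w i | i < m] -> w i \in U.
Proof. by move=> bw; apply: (basis_mem bw); rewrite -(mktuple_nth w i) mem_nth // size_tuple. Qed.

Lemma basis_indep vT m (U : {vspace vT}) (w : 'I_m -> vT) (c : 'I_m -> K) :
  basis_of U [tuple w i | i < m] -> \sum_i c i *: w i = 0 -> forall i, c i = 0.
Proof.
move=> /basis_free /freeP fw cw; apply: fw.
by rewrite -[RHS]cw; apply: eq_bigr => i _; rewrite mktuple_nth.
Qed.

Lemma basis_build vT m (U : {vspace vT}) (w : 'I_m -> vT) :
  (forall i, w i \in U) ->
  (forall u, u \in U -> exists c : 'I_m -> K, u = \sum_i c i *: w i) ->
  (forall c : 'I_m -> K, \sum_i c i *: w i = 0 -> forall i, c i = 0) ->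
  basis_of U [tuple w i | i < m].
Proof.
move=> wU wspan wfree; rewrite basisEfree; apply/and3P; split.
- apply/freeP => c cw; apply: wfree; rewrite -[RHS]cw.
  by apply: eq_bigr => i _; rewrite mktuple_nth.
- by apply/span_subvP => v /mapP[i _ ->].
- apply: leq_trans (dim_span _); apply: dimvS; apply/subvP => u /wspan[c ->].
  by apply: memv_suml => i _; apply: memvZ; apply: memv_span; apply/mapP; exists i; rewrite ?mem_enum.
Qed.

Lemma linear_fun_exists vT (rT : vectType K) (g : vT -> rT) :
  (forall k u v, g (k *: u + v) = k *: g u + g v) ->
  exists h : 'Hom(vT, rT), forall v, h v = g v.
Proof.
move=> gl; pose m := GRing.isLinear.Build K vT rT *:%R g gl.
pose gL : {linear vT -> rT} := HB.pack g m.
by exists (linfun gL) => v; rewrite lfunE.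
Qed.

End LinearAlgebra.

Section Covectors.
Context {R : realType} {n : nat}.
Local Notation E := 'rV[R]_n.+1.
Local Notation covector := 'Hom('rV[R]_n.+1, R^o).

Lemma spans_annihilatorP (a : covector) (W : {vspace E}) :
  spans_annihilator a W -> forall w, w \in W <-> a w = 0.
Proof.
move=> aW w; split=> [wW|aw0].
  by have /aW : a \in <[a]>%VS by [exact: memv_line]; exact.
apply: contrapT => /negP wW.
(* A nonzero coordinate of w - proj(w) defines a covector that kills [W] but not [w]; being a
   multiple of [a], it would have to vanish at [w]. *)
have : w - projv W w != 0.
  by apply: contra wW; rewrite subr_eq0 => /eqP ->; exact: memv_proj.
case/rV0Pn => i ni.
have [b Hb] : exists b : covector, forall v, b v = (v - projv W v) 0 i.
  apply: linear_fun_exists => k u v.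
  by rewrite linearP !mxE /GRing.scale /=; ring.
have /aW/vlineP[k bk] : forall v, v \in W -> b v = 0.
  by move=> v vW; rewrite Hb projv_id // subrr mxE.
by move: ni; rewrite -Hb bk lfunE /= aw0 scaler0 eqxx.
Qed.

Lemma kernel_spans_annihilator (a : covector) (W : {vspace E}) v0 :
  a v0 != 0 -> (forall w, w \in W <-> a w = 0) -> spans_annihilator a W.
Proof.
move=> a0 aW b; split=> [/vlineP[k ->] v /aW av|bW].
  by rewrite lfunE /= av scaler0.
apply/vlineP; exists (b v0 / a v0); apply/lfunP => v; rewrite lfunE /=.
have : a (v - (a v / a v0) *: v0) = 0.
  by rewrite linearB linearZ /= /GRing.scale /= mulfVK // subrr.
move/aW/bW; rewrite linearB linearZ /= => /eqP; rewrite subr_eq0 => /eqP ->.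
by rewrite /GRing.scale /=; ring.
Qed.

Lemma coframe_inj (a : 'I_n.+1 -> covector) v :
  basis_of fullv [tuple a i | i < n.+1] -> (forall i, a i v = 0) -> v = 0.
Proof.
move=> ba av; apply/rowP => k; rewrite mxE.
have [b Hb] : exists b : covector, forall v, b v = v 0 k.
  by apply: linear_fun_exists => c u w; rewrite !mxE.
rewrite -Hb (basis_expand ba (memvf b)) sum_lfunE big1 // => i _.
by rewrite lfunE /= av scaler0.
Qed.

Lemma coframe_dual (a : 'I_n.+1 -> covector) :
  basis_of fullv [tuple a i | i < n.+1] ->
  exists e : 'I_n.+1 -> E, forall i j, a i (e j) = (i == j)%:R.
Proof.
move=> ba; pose A := \matrix_(k, i) (a i (delta_mx 0 k) : R).
have aE v i : a i v = (v *m A) 0 i.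
  rewrite {1}(row_sum_delta v) linear_sum mxE; apply: eq_bigr => k _.
  by rewrite linearZ /= mxE.
have Au : A \in unitmx.
  apply: unitmx_of_inj => v vA; apply: (coframe_inj ba) => i.
  by rewrite aE vA mxE.
exists (fun j => row j (invmx A)) => i j.
by rewrite aE -row_mul mulVmx // !mxE eq_sym.
Qed.

Lemma coframe_expand (a : 'I_n.+1 -> covector) (e : 'I_n.+1 -> E) v :
  basis_of fullv [tuple a i | i < n.+1] -> (forall i j, a i (e j) = (i == j)%:R) ->
  v = \sum_i a i v *: e i.
Proof.
move=> ba ae; apply/eqP; rewrite -subr_eq0; apply/eqP; apply: (coframe_inj ba) => i.
rewrite linearB linear_sum /= (bigD1 i) //= linearZ /= ae eqxx big1 ?addr0.
  by rewrite /GRing.scale /= mulr1 subrr.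
by move=> j ji; rewrite linearZ /= ae eq_sym (negbTE ji) scaler0.
Qed.

Lemma coframe_of_dual (a : 'I_n.+1 -> covector) (e : 'I_n.+1 -> E) :
  (forall i j, a i (e j) = (i == j)%:R) -> (forall v, (forall i, a i v = 0) -> v = 0) ->
  basis_of fullv [tuple a i | i < n.+1].
Proof.
move=> ae ainj; apply: basis_build => [i|b _|c ca i]; first exact: memvf.
  have ex v : v = \sum_i a i v *: e i.
    apply/eqP; rewrite -subr_eq0; apply/eqP; apply: ainj => i.
    rewrite linearB linear_sum /= (bigD1 i) //= linearZ /= ae eqxx big1 ?addr0.
      by rewrite /GRing.scale /= mulr1 subrr.
    by move=> j ji; rewrite linearZ /= ae eq_sym (negbTE ji) scaler0.
  exists (fun i => b (e i)); apply/lfunP => v; rewrite {1}(ex v) linear_sum sum_lfunE.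
  by apply: eq_bigr => i _; rewrite linearZ lfunE /= /GRing.scale /= mulrC.
have := congr1 (fun b : covector => b (e i)) ca.
rewrite sum_lfunE (bigD1 i) //= lfunE /= ae eqxx big1 ?addr0.
  by rewrite lfunE /GRing.scale /= mulr1.
by move=> j ji; rewrite lfunE /= ae (negbTE ji) scaler0.
Qed.

Lemma poly_vanish (p : {poly R}) N : (size p <= N)%N ->
  (forall i, (i < N)%N -> p.[i%:R] = 0) -> p = 0.
Proof.
move=> sp p0; apply: (@roots_geq_poly_eq0 _ p [seq i%:R | i <- iota 0 N]).
- by apply/allP => x /mapP[i]; rewrite mem_iota /= => iN ->; apply/eqP; exact: p0.
- by rewrite map_inj_uniq ?iota_uniq // => i j /eqP; rewrite eqr_nat => /eqP.
- by rewrite size_map size_iota.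
Qed.

(* With a i = alpha_i(v) and b i = alpha_i(u), this says when u - l v is tangent
   to the leaf of parameter l for every l. *)
Lemma pencil_coefficients (a b : 'I_n.+1 -> R) :
  (forall l : R, \sum_(i < n.+1) l ^+ i * b i = l * \sum_(i < n.+1) l ^+ i * a i) <->
  [/\ b ord0 = 0, a ord_max = 0 &
      forall i : 'I_n, b (lift ord0 i) = a (widen_ord (leqnSn n) i)].
Proof.
have sumb (l : R) : \sum_(i < n.+1) l ^+ i * b i = b ord0 + \sum_(i < n) l ^+ i.+1 * b (lift ord0 i).
  by rewrite big_ord_recl expr0 mul1r.
have suma (l : R) : l * \sum_(i < n.+1) l ^+ i * a i =
    \sum_(i < n) l ^+ i.+1 * a (widen_ord (leqnSn n) i) + l ^+ n.+1 * a ord_max.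
  rewrite big_ord_recr /= mulrDr mulrA -exprS mulr_sumr; congr (_ + _).
  by apply: eq_bigr => i _; rewrite mulrA -exprS.
split=> [H|[b0 am ba] l]; last first.
  rewrite sumb suma b0 am mulr0 add0r addr0.
  by apply: eq_bigr => i _; rewrite ba.
(* The identity in l says that b(t) - t a(t) is the zero polynomial; its coefficients of degree 0, n
   + 1 and i + 1 are the three clauses. *)
pose p := \poly_(i < n.+1) b (inord i) - 'X * \poly_(i < n.+1) a (inord i).
have p0 : p = 0.
  apply: (@poly_vanish _ n.+3) => [|k _].
    apply: leq_trans (size_polyD _ _) _; rewrite size_polyN geq_max; apply/andP; split.
      by apply: leq_trans (size_poly _ _) _; rewrite ltnW.
    apply: leq_trans (size_polyMleq _ _) _; rewrite size_polyX /=.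
    by apply: leq_ltn_trans (size_poly _ _) _; rewrite ltnW.
  rewrite hornerD hornerN hornerM hornerX !horner_poly.
  have E1 (c : 'I_n.+1 -> R) : \sum_(i < n.+1) c (inord i) * k%:R ^+ i = \sum_(i < n.+1) k%:R ^+ i * c i.
    by apply: eq_bigr => i _; rewrite inord_val mulrC.
  by rewrite !E1 H subrr.
have cf i : (if (i < n.+1)%N then b (inord i) else 0) =
    (if i is j.+1 then (if (j < n.+1)%N then a (inord j) else 0) else 0).
  have := congr1 (fun q : {poly R} => q`_i) p0.
  rewrite coefB coef0 coefXM !coef_poly => /eqP; rewrite subr_eq0 => /eqP ->.
  by case: i.
split=> [| |i].
- by have := cf 0%N; rewrite /= => <-; congr b; apply/val_inj; rewrite /= inordK.
- have := cf n.+1; rewrite ltnn ltnSn => ->; congr a; apply/val_inj; by rewrite /= inordK.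
- have := cf i.+1; rewrite ltnS ltn_ord (ltn_trans (ltn_ord i)) // => H1.
  rewrite (_ : lift ord0 i = inord i.+1) ?H1; last first.
    by apply/val_inj; rewrite /= inordK // ltnS.
  by congr a; apply/val_inj; rewrite /= inordK // ltnS ltnW.
Qed.

End Covectors.

(** * Frobenius on a manifold *)

Section FramesAndFrobenius.
Context {R : realType} {n : nat} {M : smoothManifold R n}.
Implicit Types (U V : set M) (f g : M -> R) (x y z : M) (v w : 'rV[R]_n.+1)
  (X Y : vectorField M) (L : M -> 'rV[R]_n.+1 -> R).

(** Covector fields as plain functions, so that differentials [tder f] and evaluated 1-forms are
    handled by the same lemmas. *)
Definition linear_family U L := forall y v w (c : R), U y ->
  L y (v + c *: w) = L y v + c * L y w.

Definition smooth_family U L := forall V X, open V -> V `<=` U ->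
  smooth_vf_on V X -> smooth_fun_on V (fun y => L y (X y)).

Lemma linear_family_sum U L y (I : Type) (s : seq I) (a : I -> R) (e : I -> 'rV[R]_n.+1) :
  linear_family U L -> U y ->
  L y (\sum_(i <- s) a i *: e i) = \sum_(i <- s) a i * L y (e i).
Proof.
move=> lL Uy; have L0 : L y 0 = 0.
  have := lL y 0 0 1 Uy; rewrite scaler0 addr0 mul1r => /eqP.
  by rewrite -subr_eq subrr eq_sym => /eqP.
elim: s => [|i s IH]; first by rewrite !big_nil L0.
by rewrite !big_cons addrC lL // IH addrC.
Qed.

Lemma tder_linear_family U f : open U -> smooth_fun_on U f -> linear_family U (tder f).
Proof. by move=> oU fs y v w c Uy; exact: tder_linear oU fs Uy. Qed.

Lemma tder_smooth_family U f : open U -> smooth_fun_on U f -> smooth_family U (tder f).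
Proof.
by move=> oU fs V X oV VU Xs; apply: smooth_vf_act => //; exact: smooth_fun_sub fs.
Qed.

(** The matrix of the functionals in a coordinate frame is smooth and, by joint injectivity,
    invertible; the components of [X] are recovered through the inverse, smooth by the cofactor
    formula. *)
Lemma smooth_vf_of_functionals U (L : 'I_n.+1 -> M -> 'rV[R]_n.+1 -> R) X : open U ->
  (forall i, linear_family U (L i)) -> (forall i, smooth_family U (L i)) ->
  (forall y v, U y -> (forall i, L i y v = 0) -> v = 0) ->
  (forall i, smooth_fun_on U (fun y => L i y (X y))) -> smooth_vf_on U X.
Proof.
move=> oU lL sL injL LX; apply: smooth_vf_local => x Ux.
pose V := U `&` chart_dom x.
have oV : open V by apply: openI => //; exact: chart_dom_open.
have VU : V `<=` U by move=> y [].
have Vx : V `<=` chart_dom x by move=> y [].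
exists V; split=> //; first by split=> //; exact: chart_dom_center.
pose B y := \matrix_(k, i) L i y (coord_frame x k y).
have Bs k i : smooth_fun_on V (fun y => B y k i).
  apply: (@smooth_fun_eq _ _ _ _ (fun y => L i y (coord_frame x k y))) => //.
    by move=> y _; rewrite mxE.
  by apply: sL => //; exact: smooth_vf_sub (@smooth_coord_frame _ _ _ x k).
have mulB y (c : 'rV[R]_n.+1) i : V y ->
    (c *m B y) 0 i = L i y (\sum_k c 0 k *: coord_frame x k y).
  move=> [Uy _]; rewrite (linear_family_sum _ _ _ (lL i) Uy) mxE.
  by apply: eq_bigr => k _; rewrite mxE.
have Bu y : V y -> B y \in unitmx.
  move=> Vy; apply: unitmx_of_inj => c cB; have [Uy xy] := Vy.
  have c0 : \sum_k c 0 k *: coord_frame x k y = 0.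
    by apply: (injL y) => // i; rewrite -mulB // cB mxE.
  apply/rowP => j; rewrite mxE.
  have := congr1 (tder (chart_coord x j) y) c0.
  have cs := smooth_coord x j; have od := chart_dom_open x.
  rewrite (tder_sumv _ _ _ od cs xy) (tder0 od cs xy) (bigD1 j) //=.
  rewrite tder_coord_coord_frame // eqxx mulr1 big1 ?addr0 // => k kj.
  by rewrite tder_coord_coord_frame // eq_sym (negbTE kj) mulr0.
apply: (smooth_vf_coords oV Vx) => k.
apply: (@smooth_fun_eq _ _ _ _ (fun y => \sum_i L i y (X y) * invmx (B y) i k)) => //.
  move=> y Vy; have [Uy xy] := Vy.
  pose c : 'rV[R]_n.+1 := \row_k vf_act X (chart_coord x k) y.
  have -> : vf_act X (chart_coord x k) y = (c *m B y *m invmx (B y)) 0 k.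
    by rewrite -mulmxA mulmxV ?Bu // mulmx1 mxE.
  rewrite mxE; apply: eq_bigr => i _; rewrite mulB //; congr (L _ _ _ * _).
  by rewrite {1}(tangent_expand (X y) xy); apply: eq_bigr => j _; rewrite mxE.
apply: smooth_fun_sum => // i; apply: smooth_funM => //; last exact: smooth_fun_invmx.
exact: smooth_fun_sub (LX i).
Qed.

Lemma smooth_frame_coef U (w : 'I_n.+1 -> vectorField M) (t : 'I_n.+1 -> M -> R) X i :
  open U -> (forall i, smooth_vf_on U (w i)) ->
  (forall y (c : 'I_n.+1 -> R), U y -> \sum_i c i *: w i y = 0 -> forall i, c i = 0) ->
  smooth_vf_on U X -> (forall y, U y -> X y = \sum_i t i y *: w i y) ->
  smooth_fun_on U (t i).
Proof.
move=> oU ws indep Xs XE; apply: smooth_fun_local => // x Ux.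
pose V := U `&` chart_dom x.
have oV : open V by apply: openI => //; exact: chart_dom_open.
have VU : V `<=` U by move=> y [].
have Vx : V `<=` chart_dom x by move=> y [].
exists V; split=> //; first by split=> //; exact: chart_dom_center.
have cs k : smooth_fun_on V (chart_coord x k).
  exact: smooth_fun_sub (chart_dom_open x) oV Vx (@smooth_coord _ _ _ x k).
pose B y := \matrix_(j, k) vf_act (w j) (chart_coord x k) y.
have Bs j k : smooth_fun_on V (fun y => B y j k).
  apply: (@smooth_fun_eq _ _ _ _ (vf_act (w j) (chart_coord x k))) => //.
    by move=> y _; rewrite mxE.
  by apply: ws.
have mulB y (c : 'I_n.+1 -> R) k : V y ->
    ((\row_j c j) *m B y) 0 k = tder (chart_coord x k) y (\sum_j c j *: w j y).
  move=> Vy; rewrite (tder_sumv _ _ _ oV (cs k) Vy) mxE.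
  by apply: eq_bigr => j _; rewrite !mxE.
have Bu y : V y -> B y \in unitmx.
  move=> Vy; apply: unitmx_of_inj => c cB; have [Uy xy] := Vy.
  have cE : c = \row_j c 0 j by apply/rowP => j; rewrite mxE.
  apply/rowP => j; rewrite mxE; apply: (indep y (c 0)) => //.
  apply: (tangent_ext xy) => k; rewrite -mulB // -cE cB mxE.
  by rewrite (tder0 oV (cs k) Vy).
apply: (@smooth_fun_eq _ _ _ _
    (fun y => \sum_k vf_act X (chart_coord x k) y * invmx (B y) k i)) => //.
  move=> y Vy; have [Uy xy] := Vy.
  have -> : t i y = ((\row_j t j y) *m B y *m invmx (B y)) 0 i.
    by rewrite -mulmxA mulmxV ?Bu // mulmx1 mxE.
  by rewrite mxE; apply: eq_bigr => k _; rewrite mulB // -XE.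
apply: smooth_fun_sum => // k; apply: smooth_funM => //; last exact: smooth_fun_invmx.
by apply: Xs.
Qed.

Lemma smooth_funB U f g : open U -> smooth_fun_on U f -> smooth_fun_on U g ->
  smooth_fun_on U (fun x => f x - g x).
Proof.
move=> oU fs gs.
apply: (@smooth_fun_eq _ _ _ _ (fun x => f x + (-1) * g x)) => //.
  by move=> x _; rewrite mulN1r.
apply: smooth_funD => //; apply: smooth_funM => //; exact: smooth_fun_cst.
Qed.

Lemma smooth_bracket U X Y : open U -> smooth_vf_on U X -> smooth_vf_on U Y ->
  smooth_vf_on U (bracket X Y).
Proof.
move=> oU Xs Ys V f oV VU fs.
have XV := smooth_vf_sub VU Xs; have YV := smooth_vf_sub VU Ys.
apply: (@smooth_fun_eq _ _ _ _
    (fun y => vf_act X (vf_act Y f) y - vf_act Y (vf_act X f) y)) => //.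
  by move=> y Vy; exact/esym/(bracket_act oV XV YV fs Vy).
by apply: smooth_funB => //; apply: smooth_vf_act => //; apply: smooth_vf_act.
Qed.

Lemma bracket_anti X Y x : bracket X Y x = - bracket Y X x.
Proof. by apply/rowP => i; rewrite !mxE opprB. Qed.

#[local] Opaque bracket tder.

Lemma vf_act_lin U X Y f y (c : R) : open U -> smooth_fun_on U f -> U y ->
  vf_act (fun x => X x + c *: Y x) f y = vf_act X f y + c * vf_act Y f y.
Proof. by move=> oU fs Uy; exact: tder_linear oU fs Uy. Qed.

Lemma tder_lin_fun U f g x v (c : R) : open U -> smooth_fun_on U f -> smooth_fun_on U g ->
  U x -> tder (fun y => f y + c * g y) x v = tder f x v + c * tder g x v.
Proof.
move=> oU fs gs Ux; have cs := smooth_fun_cst (M := M) c oU.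
rewrite (tderD _ oU fs (smooth_funM oU cs gs) Ux) (tderM _ oU cs gs Ux).
by rewrite tder_cst mul0r addr0.
Qed.

(** The common mechanism of both torsion computations: with [l] constant, X f = l Y f on an open set
    may be differentiated by Z. It is used for the operator on a leaf and for the diagonal
    extension. *)
Lemma vf_act_eigen U f X Y Z x (l : R) : open U -> U x -> smooth_fun_on U f ->
  smooth_vf_on U Y -> (forall y, U y -> tder f y (X y) = l * tder f y (Y y)) ->
  vf_act Z (vf_act X f) x = l * vf_act Z (vf_act Y f) x.
Proof.
move=> oU Ux fs Ys XY; have fY : smooth_fun_on U (vf_act Y f) by exact: smooth_vf_act.
have cs := smooth_fun_cst (M := M) l oU.
have -> : vf_act Z (vf_act X f) x = tder (fun y => l * vf_act Y f y) x (Z x).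
  apply/esym; apply: (tder_eq _ oU) => //; last exact: smooth_funM.
  by move=> y Uy; rewrite /vf_act XY.
by rewrite (tderM _ oU cs fY Ux) tder_cst mul0r addr0.
Qed.

Lemma bracket_lin_l U X Y Z x (c : R) : open U -> smooth_vf_on U X -> smooth_vf_on U Y ->
  smooth_vf_on U Z -> U x ->
  bracket (fun y => X y + c *: Y y) Z x = bracket X Z x + c *: bracket Y Z x.
Proof.
move=> oU Xs Ys Zs Ux; have xx := chart_dom_center x.
pose V := U `&` chart_dom x.
have oV : open V by apply: openI => //; exact: chart_dom_open.
have VU : V `<=` U by move=> y [].
have Vx : V x by [].
have cs k : smooth_fun_on V (chart_coord x k).
  by apply: smooth_fun_sub (chart_dom_open x) oV _ (@smooth_coord _ _ _ x k) => y [].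
have XV := smooth_vf_sub VU Xs; have YV := smooth_vf_sub VU Ys.
have ZV := smooth_vf_sub VU Zs.
have sV := smooth_vf_lin oV (smooth_fun_cst c oV) XV YV.
apply: (tangent_ext xx) => k.
have e1 := bracket_act oV sV ZV (cs k) Vx.
have e2 := tder_linear (bracket X Z x) (bracket Y Z x) c oV (cs k) Vx.
apply: (etrans e1); apply/esym; apply: (etrans e2); apply/esym.
have e3 := bracket_act oV XV ZV (cs k) Vx; have e4 := bracket_act oV YV ZV (cs k) Vx.
apply: etrans (congr2 (fun s t => s + c * t) (esym e3) (esym e4)); rewrite {e1 e2 e3 e4} /=.
rewrite (vf_act_lin _ _ _ oV _ Vx); last exact: smooth_vf_act.
have -> : vf_act Z (vf_act (fun y => X y + c *: Y y) (chart_coord x k)) x =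
    tder (fun y => vf_act X (chart_coord x k) y + c * vf_act Y (chart_coord x k) y) x (Z x).
  apply: (tder_eq _ oV) => //; last exact: smooth_vf_act.
  by move=> y Vy; rewrite (vf_act_lin _ _ _ oV (cs k) Vy).
rewrite (tder_lin_fun _ _ oV _ _ Vx); try exact: smooth_vf_act.
rewrite -/(vf_act Z (vf_act X (chart_coord x k)) x) -/(vf_act Z (vf_act Y (chart_coord x k)) x).
move: (vf_act X (vf_act Z _) x) (vf_act Y (vf_act Z _) x) (vf_act Z _ x) (vf_act Z _ x).
move=> p q r s; ring.
Qed.

Lemma bracket_lin_r U X Y Z x (c : R) : open U -> smooth_vf_on U X -> smooth_vf_on U Y ->
  smooth_vf_on U Z -> U x ->
  bracket Z (fun y => X y + c *: Y y) x = bracket Z X x + c *: bracket Z Y x.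
Proof.
move=> oU Xs Ys Zs Ux; rewrite bracket_anti (bracket_lin_l _ oU Xs Ys Zs Ux).
by rewrite (bracket_anti Z X) (bracket_anti Z Y) opprD scalerN.
Qed.

(** Involutivity is asked pointwise, with tangent extensions X, Y allowed to depend on the point and
    the two vectors. As L(X) and L(Y) vanish identically, their derivatives express d L(u, v)
    through second-order terms whose difference is L([X, Y]). *)
Lemma frobenius_manifold x0 U L : open U -> U x0 ->
  linear_family U L -> smooth_family U L -> (forall y, U y -> exists v, L y v != 0) ->
  (forall y u v, U y -> L y u = 0 -> L y v = 0 -> exists X Y,
     [/\ smooth_vf_on U X /\ smooth_vf_on U Y, X y = u, Y y = v,
         forall z, U z -> L z (X z) = 0 /\ L z (Y z) = 0 & L y (bracket X Y y) = 0]) ->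
  exists V g, [/\ open V, V x0, V `<=` U, smooth_fun_on V g &
    forall y, V y -> (exists v, tder g y v != 0) /\ forall v, L y v = 0 <-> tder g y v = 0].
Proof.
move=> oU Ux0 lL sL L0 inv.
pose V := U `&` chart_dom x0.
have oV : open V by apply: openI => //; exact: chart_dom_open.
have VU : V `<=` U by move=> y [].
have Vd : V `<=` chart_dom x0 by move=> y [].
have Vx0 : V x0 by split=> //; exact: chart_dom_center.
pose E := coord_frame x0.
pose a k y := L y (E k y).
have as8 k : smooth_fun_on V (a k).
  by apply: sL => //; exact: smooth_vf_sub (@smooth_coord_frame _ _ _ x0 k).
have LE y v : V y -> L y v = \sum_k a k y * tder (chart_coord x0 k) y v.
  move=> Vy; rewrite {1}(tangent_expand v (Vd _ Vy)).
  rewrite (linear_family_sum _ _ _ lL (VU _ Vy)).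
  by apply: eq_bigr => k _; rewrite mulrC.
have cs k : smooth_fun_on V (chart_coord x0 k).
  exact: smooth_fun_sub (chart_dom_open x0) oV Vd (@smooth_coord _ _ _ x0 k).
pose W := chart x0 @` V.
have oW : open W by rewrite /W -(setIidl Vd); exact: chart_image_sub_open.
pose b k := a k \o chart_inv x0.
have bs k : Csmooth W (b k).
  by have := smooth_fun_chart x0 oV (as8 k); rewrite (setIidl Vd).
have [j0 aj0] : exists j, a j x0 != 0.
  apply: contrapT => /forallNP H; have [v] := L0 x0 Ux0.
  rewrite LE // big1 ?eqxx // => k _.
  by have /negP := H k; rewrite negbK => /eqP ->; rewrite mul0r.
have tderW f y k : smooth_fun_on V f -> V y ->
    tder f y (E k y) = 'D_(delta_mx 0 k) (f \o chart_inv x0) (chart x0 y).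
  by move=> fs Vy; rewrite (tder_coord_frame k oV fs Vy (Vd _ Vy)).
have tderL f y (u : 'rV[R]_n.+1) : smooth_fun_on V f -> V y ->
    tder f y (\sum_k u 0 k *: E k y) = 'D_u (f \o chart_inv x0) (chart x0 y).
  move=> fs Vy; rewrite (tder_sumv _ _ _ oV fs Vy).
  have fW : Csmooth W (f \o chart_inv x0).
    by have := smooth_fun_chart x0 oV fs; rewrite (setIidl Vd).
  have Wy : W (chart x0 y) by exists y.
  have := tangent_map_sum u oW (fW 1%N) Wy; rewrite /tangent_map /= => ->.
  by apply: eq_bigr => k _; rewrite tderW.
have coordE y (u : 'rV[R]_n.+1) k : V y ->
    tder (chart_coord x0 k) y (\sum_j u 0 j *: E j y) = u 0 k.
  move=> Vy; rewrite (tder_sumv _ _ _ oV (cs k) Vy) (bigD1 k) //=.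
  rewrite (tder_coord_coord_frame _ _ (Vd _ Vy)) eqxx mulr1 big1 ?addr0 // => j jk.
  by rewrite (tder_coord_coord_frame _ _ (Vd _ Vy)) eq_sym (negbTE jk) mulr0.
have Wx0 : W (chart x0 x0) by exists x0.
have bj0 : b j0 (chart x0 x0) != 0 by rewrite /b /= chartK //; exact: Vd.
have [|V' [F [oV' V'x0 V'W Fs HF]]] := frobenius_rV oW Wx0 bs bj0.
  move=> q u v [y Vy <-]; rewrite /b /= !chartK; last exact: Vd.
  move=> au av; have Uy := VU _ Vy.
  have Lu (u' : 'rV[R]_n.+1) : \sum_j a j y * u' 0 j = 0 ->
      L y (\sum_k u' 0 k *: E k y) = 0.
    by move=> <-; rewrite LE //; apply: eq_bigr => k _; rewrite coordE.
  have [X [Y [[Xs Ys] Xy Yy tan Lbr]]] := inv y _ _ Uy (Lu u au) (Lu v av).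
  have XV := smooth_vf_sub VU Xs; have YV := smooth_vf_sub VU Ys.
  (* The derivative of L(Z) = 0 along Z', expanded in the coordinates at [x0]. *)
  have Zero Z Z' : smooth_vf_on V Z -> (forall z, U z -> L z (Z z) = 0) ->
      0 = \sum_k (a k y * vf_act Z' (vf_act Z (chart_coord x0 k)) y
        + tder (a k) y (Z' y) * vf_act Z (chart_coord x0 k) y).
    move=> ZV LZ; have Zc k : smooth_fun_on V (vf_act Z (chart_coord x0 k)) by apply: ZV.
    have T0 : tder (fun y => \sum_k a k y * vf_act Z (chart_coord x0 k) y) y (Z' y) = 0.
      rewrite -[RHS](tder_cst y (Z' y) 0); apply/esym; apply: (tder_eq _ oV) => //.
        by move=> z Vz; rewrite -LE // LZ //; exact: VU.
      exact: smooth_fun_cst.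
    rewrite -[LHS]T0 (tder_sum _ _ oV) => [|k|//]; last exact: smooth_funM.
    by apply: eq_bigr => k _; rewrite (tderM _ oV (as8 k) (Zc k) Vy).
  have ZX := Zero X Y XV (fun z Uz => (tan z Uz).1).
  have ZY := Zero Y X YV (fun z Uz => (tan z Uz).2).
  move: Lbr; rewrite LE // => Lbr.
  have D1 (Z : vectorField M) (u' : 'rV[R]_n.+1) k : Z y = \sum_k u' 0 k *: E k y ->
     vf_act Z (chart_coord x0 k) y = u' 0 k /\ tder (a k) y (Z y) = 'D_u' (b k) (chart x0 y).
    by move=> Zy; rewrite /vf_act Zy (coordE y u' k Vy) (tderL _ _ _ (as8 k) Vy).
  have e1 : \sum_k 'D_u (b k) (chart x0 y) * v 0 k =
       - \sum_k a k y * vf_act X (vf_act Y (chart_coord x0 k)) y.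
    apply/eqP; rewrite -addr_eq0 addrC -big_split /=; apply/eqP.
    rewrite [RHS]ZY; apply: eq_bigr => k _; congr (_ + _).
    by have [-> _] := D1 Y v k Yy; have [_ ->] := D1 X u k Xy.
  have e2 : \sum_k 'D_v (b k) (chart x0 y) * u 0 k =
       - \sum_k a k y * vf_act Y (vf_act X (chart_coord x0 k)) y.
    apply/eqP; rewrite -addr_eq0 addrC -big_split /=; apply/eqP.
    rewrite [RHS]ZX; apply: eq_bigr => k _; congr (_ + _).
    by have [-> _] := D1 X u k Xy; have [_ ->] := D1 Y v k Yy.
  rewrite e1 e2; apply/eqP; rewrite eqr_opp -subr_eq0 -sumrB -[X in _ == X]Lbr.
  apply/eqP; apply: eq_bigr => k _; rewrite -mulrBr; congr (_ * _).
  by rewrite (bracket_act oV XV YV (cs k) Vy).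
pose V2 := V `&` (chart x0 @^-1` V').
have oV2 : open V2.
  rewrite openE => y [Vy V'y]; apply: filterI; first exact: open_nbhs_nbhs.
  by apply: (chart_continuous (Vd _ Vy)); exact: open_nbhs_nbhs.
have V2V : V2 `<=` V by move=> y [].
have gs : smooth_fun_on V2 (F \o chart x0).
  apply: (smooth_fun_comp_chart oV2 _ oV' _ Fs); first exact: subset_trans Vd.
  by move=> y [].
exists V2, (F \o chart x0); split=> //; first exact: subset_trans VU.
move=> y V2y; have Vy := V2V y V2y; have [_ V'y] := V2y; have [D0 DL] := HF _ V'y.
have gE v : tder (F \o chart x0) y v = 'D_(\row_k tder (chart_coord x0 k) y v) F (chart x0 y).
  rewrite {1}(tangent_expand v (Vd _ Vy)).
  rewrite (tder_sumv _ _ _ oV2 gs V2y).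
  have := tangent_map_sum (\row_k tder (chart_coord x0 k) y v) oV' (Fs 1%N) V'y.
  rewrite /tangent_map /= => ->; apply: eq_bigr => k _.
  rewrite mxE (tder_coord_frame k oV2 gs V2y (Vd _ Vy)) /GRing.scale /=; congr (_ * _).
  apply: has_derE; apply: (has_der_near _ (Ck_has_der _ (Fs 1%N) V'y)).
  have [r r0 Hr] := open_line (delta_mx 0 k) oW (ex_intro2 _ _ y Vy erefl : W (chart x0 y)).
  by exists r => // h /Hr [z Vz <-]; rewrite /= chartK //; exact: Vd.
have ker v : L y v = 0 -> tder (F \o chart x0) y v = 0.
  rewrite LE // gE => Lv; apply: DL; rewrite -[RHS]Lv; apply: eq_bigr => k _.
  by rewrite mxE /b /= chartK //; exact: Vd.
have nz : exists v, tder (F \o chart x0) y v != 0.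
  exists (E j0 y); rewrite gE; suff -> : \row_k tder (chart_coord x0 k) y (E j0 y) = delta_mx 0 j0 by [].
  by apply/rowP => k; rewrite !mxE (tder_coord_coord_frame _ _ (Vd _ Vy)).
split=> // v; split; first exact: ker.
(* If L v were nonzero, every [u] would be a kernel vector of L plus a multiple of v, so dg would
   vanish altogether. *)
move=> gv; apply/eqP; apply: contrapT => /negP Lv; have [u gu] := nz.
have := ker (u + (- (L y u / L y v)) *: v).
rewrite (lL y _ _ _ (VU _ Vy)) mulNr mulfVK // subrr => /(_ erefl).
rewrite (tder_linear _ _ _ oV2 gs V2y) gv mulr0 addr0 => gu0.
by rewrite gu0 eqxx in gu.
Qed.

End FramesAndFrobenius.

(** * From webs to partial Nijenhuis operators *)

Section WebToNijenhuis.
Context {R : realType} {n : nat} {M : smoothManifold R n}.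
Implicit Types (U V : set M) (x y : M) (v u : 'rV[R]_n.+1) (X Y : vectorField M)
  (D : Defs.distribution M).

#[local] Opaque bracket tder.

Lemma foliation1P D U x : foliation_on U 1 D -> U x -> exists V f,
  [/\ open V, V x, V `<=` U, smooth_fun_on V f & forall y, V y ->
     (exists v, tder f y v != 0) /\ forall v, v \in D y <-> tder f y v = 0].
Proof.
move=> /[apply] -[V [f [oV Vx VU fs H]]]; exists V, (f ord0); split=> // y Vy.
have [surj ker] := H y Vy; split.
  by have [v Hv] := surj (fun=> 1); exists v; rewrite Hv oner_neq0.
move=> v; rewrite ker; split=> [->//|fv i].
by rewrite (ord1 i).
Qed.

Lemma foliation1_of D U : (forall x, U x -> exists V f,
  [/\ open V, V x, V `<=` U, smooth_fun_on V f & forall y, V y ->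
     (exists v, tder f y v != 0) /\ forall v, v \in D y <-> tder f y v = 0]) ->
  foliation_on U 1 D.
Proof.
move=> H x /H[V [f [oV Vx VU fs Hf]]]; exists V, (fun=> f); split=> // y Vy.
have [[v fv] ker] := Hf y Vy; split=> [c|w].
  exists ((c ord0 / tder f y v) *: v) => i.
  by rewrite (tderZ _ _ oV fs Vy) mulfVK // (ord1 i).
by rewrite ker; split=> [fw i //|/(_ ord0)].
Qed.

(** Fields tangent to the leaves annihilate the defining functions identically, hence so does their
    commutator. *)
Lemma foliation_bracket D U X Y q : open U -> foliation_on setT q D ->
  section_on U D X -> section_on U D Y -> forall x, U x -> bracket X Y x \in D x.
Proof.
move=> oU fD [Xs XD] [Ys YD] x Ux.
have [V [f [oV Vx _ fs H]]] := fD x I.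
have [_ ker] := H x Vx; apply/ker => i.
pose W := U `&` V; have oW : open W := openI oU oV.
have WU : W `<=` U by move=> y [].
have WV : W `<=` V by move=> y [].
have Wx : W x by [].
have fW := smooth_fun_sub oV oW WV (fs i).
have zero Z : smooth_vf_on U Z -> (forall x, U x -> Z x \in D x) ->
    forall y, W y -> vf_act Z (f i) y = 0.
  by move=> _ ZD y [Uy Vy]; have [_ k] := H y Vy; apply: (k (Z y)).1; exact: ZD.
have XW := smooth_vf_sub WU Xs; have YW := smooth_vf_sub WU Ys.
have z0 Z Z' : smooth_vf_on U Z' -> (forall x, U x -> Z' x \in D x) ->
    vf_act Z (vf_act Z' (f i)) x = 0.
  move=> Zs ZD; rewrite /vf_act -[RHS](tder_cst x (Z x) 0); apply/esym.
  apply: (tder_eq _ oW) => //; last exact: smooth_fun_cst.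
  by move=> y Wy; rewrite -/(vf_act Z' (f i) y) zero.
by apply: (etrans (bracket_act oW XW YW fW Wx)); rewrite !z0 // subrr.
Qed.

Definition web_coframe_at (W : veroneseWeb M) y (a : 'I_n.+1 -> 'Hom('rV[R]_n.+1, R^o)) :=
  [/\ basis_of fullv [tuple a i | i < n.+1],
      forall l : R, spans_annihilator (\sum_(i < n.+1) l ^+ i *: a i) (W (Some l) y) &
      spans_annihilator (a ord_max) (W None y)].

Lemma web_pencil W y a v u : web_coframe_at W y a ->
  (forall l : R, u - l *: v \in W (Some l) y) <->
  [/\ a ord0 u = 0, a ord_max v = 0 &
      forall i : 'I_n, a (lift ord0 i) u = a (widen_ord (leqnSn n) i) v].
Proof.
case=> _ sa _; rewrite -(pencil_coefficients (fun i => a i v) (fun i => a i u)).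
have E l : (\sum_(i < n.+1) l ^+ i *: a i) (u - l *: v) =
    (\sum_(i < n.+1) l ^+ i * a i u) - l * (\sum_(i < n.+1) l ^+ i * a i v).
  rewrite sum_lfunE mulr_sumr -sumrB; apply: eq_bigr => i _.
  rewrite lfunE /= linearB linearZ /= /GRing.scale /=; ring.
split=> H l.
  by apply/eqP; rewrite -subr_eq0 -E; apply/eqP/(spans_annihilatorP (sa l)).
by apply/(spans_annihilatorP (sa l)); rewrite E H subrr.
Qed.

(** A coframe at x serves only to exhibit J: the components of J v are those of v shifted by one.
    The characterisation by leaves does not mention it, so a pointwise choice is consistent and may
    be examined in any local coframe. *)
Lemma web_map_exists (W : veroneseWeb M) x :
  exists J : 'Hom(subvs_of (W None x), 'rV[R]_n.+1),
    forall (v : subvs_of (W None x)) (u : 'rV[R]_n.+1),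
      (forall l : R, u - l *: vsval v \in W (Some l) x) <-> u = J v.
Proof.
have [U [a [_ Ux _ /(_ x Ux) ca]]] := web_coframe W x.
pose b i := a i x; have {}ca : web_coframe_at W x b by [].
have [bb _ sn] := ca; have [e be] := coframe_dual bb.
have [|J HJ] := @linear_fun_exists R (subvs_of (W None x)) 'rV[R]_n.+1
    (fun v : subvs_of (W None x) =>
       \sum_(i < n) (b (widen_ord (leqnSn n) i) (vsval v) : R) *: e (lift ord0 i)).
  move=> k u v; rewrite scaler_sumr -big_split; apply: eq_bigr => i _ /=.
  by rewrite linearP scalerDl scalerA.
exists J => v u; rewrite (web_pencil _ _ ca) HJ; split.
  move=> [b0 bm bi]; rewrite {1}(coframe_expand u bb be) big_ord_recl b0 scale0r add0r.
  by apply: eq_bigr => i _; rewrite bi.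

move=> ->; split.
- rewrite linear_sum big1 // => i _; rewrite linearZ /= be.
  by rewrite (_ : (ord0 == lift ord0 i) = false) ?scaler0.
- by apply/(spans_annihilatorP sn); exact: subvsP.
- move=> j; rewrite linear_sum (bigD1 j) //= linearZ /= be eqxx big1 ?addr0.
    by rewrite /GRing.scale /= mulr1.
  move=> i ij; rewrite linearZ /= be (inj_eq lift_inj) eq_sym (negbTE ij) scaler0 //.
Qed.

Definition web_map (W : veroneseWeb M) : partialTensor (W None) :=
  fun x => sval (cid (web_map_exists W x)).

Lemma web_mapP (W : veroneseWeb M) x (v : subvs_of (W None x)) (u : 'rV[R]_n.+1) :
  (forall l : R, u - l *: vsval v \in W (Some l) x) <-> u = web_map W x v.
Proof. exact: svalP (cid (web_map_exists W x)) v u. Qed.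

(** The coefficient of l^(n+1) in the pencil identity: tangency at all finite parameters implies the
    condition at infinity. *)
Lemma web_pencil_leaf (W : veroneseWeb M) x v u :
  (forall l : R, u - l *: v \in W (Some l) x) -> v \in W None x.
Proof.
have [U [a [_ Ux _ /(_ x Ux) ca]]] := web_coframe W x.
move=> /(web_pencil _ _ (ca : web_coframe_at W x (a^~ x)))[_ am _].
by have [_ _ sn] := ca; apply/(spans_annihilatorP sn).
Qed.

Lemma web_pappP (W : veroneseWeb M) X x u : X x \in W None x ->
  (forall l : R, u - l *: X x \in W (Some l) x) <-> u = papp (web_map W) X x.
Proof. by move=> XD; rewrite -web_mapP vsprojK. Qed.

Lemma web_papp_smooth (W : veroneseWeb M) U X : open U -> section_on U (W None) X ->
  smooth_vf_on U (papp (web_map W) X).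
Proof.
move=> oU [Xs XD]; apply: smooth_vf_local => x Ux.
have [U1 [a [oU1 U1x as8 ca]]] := web_coframe W x.
pose V := U `&` U1; have oV : open V := openI oU oU1.
have VU : V `<=` U by move=> y [].
have VU1 : V `<=` U1 by move=> y [].
have XV := smooth_vf_sub VU Xs.
exists V; split=> //.
apply: (@smooth_vf_of_functionals R n M V (fun i y v => a i y v)) => //.
- by move=> i y v w c _; rewrite linearD linearZ.
- by move=> i V' Y oV' V'V Ys; apply: as8 => //; exact: subset_trans VU1.
- by move=> y v /VU1/ca[ba _ _]; exact: coframe_inj.
have coef y : V y -> [/\ a ord0 y (papp (web_map W) X y) = 0, a ord_max y (X y) = 0 &
    forall i, a (lift ord0 i) y (papp (web_map W) X y) = a (widen_ord (leqnSn n) i) y (X y)].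
  move=> [Uy U1y]; apply/(web_pencil _ _ (ca y U1y : web_coframe_at W y (a^~ y))).
  by apply/web_pappP => //; exact: XD.
move=> i; have [j ->|->] := unliftP ord0 i.
  apply: (@smooth_fun_eq _ _ _ _ (fun y => a (widen_ord (leqnSn n) j) y (X y))) => //.
    by move=> y /coef[_ _ ->].
  by apply: as8.
apply: (@smooth_fun_eq _ _ _ _ (fun=> 0)) => //; last exact: smooth_fun_cst.
by move=> y /coef[-> _ _].
Qed.

(* For f cutting out the leaf W_l, the identities (JX) f = l X f give
   Z f = JX (Y f) - JY (X f) and T f = l Z f, where Z = [X, Y]_J and T = [JX, JY].
   As l is arbitrary, the pencil forces Z to be tangent to W_oo and JZ = T. *)
Lemma web_nijenhuis (W : veroneseWeb M) U X Y x : open U ->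
  section_on U (W None) X -> section_on U (W None) Y -> U x ->
  forall l : R, bracket (papp (web_map W) X) (papp (web_map W) Y) x
    - l *: pbracket (web_map W) X Y x \in W (Some l) x.
Proof.
move=> oU sX sY Ux l; have [Xs XD] := sX; have [Ys YD] := sY.
have JXs := web_papp_smooth oU sX; have JYs := web_papp_smooth oU sY.
have [V [f [oV Vx _ fs H]]] := foliation1P (web_foliation W (Some l)) (I : setT x).
have [_ ker] := H x Vx; apply/ker.
pose W' := U `&` V; have oW : open W' := openI oU oV.
have WU : W' `<=` U by move=> y [].
have WV : W' `<=` V by move=> y [].
have Wx : W' x by [].
have fW := smooth_fun_sub oV oW WV fs.
have XW := smooth_vf_sub WU Xs; have YW := smooth_vf_sub WU Ys.
have JXW := smooth_vf_sub WU JXs; have JYW := smooth_vf_sub WU JYs.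
have Jl Z y : W' y -> Z y \in W None y ->
    tder f y (papp (web_map W) Z y) = l * tder f y (Z y).
  move=> [Uy Vy] ZD; have [_ k] := H y Vy.
  have /(web_pappP _ ZD)/(_ l)/k := erefl (papp (web_map W) Z y).
  rewrite -scaleNr (tder_linear _ _ _ oV fs Vy) mulNr => /eqP.
  by rewrite subr_eq0 => /eqP.
have JJ Z Z' : smooth_vf_on W' Z' -> section_on U (W None) Z' ->
    vf_act Z (vf_act (papp (web_map W) Z') f) x = l * vf_act Z (vf_act Z' f) x.
  move=> Z's [_ Z'D]; apply: (vf_act_eigen _ oW Wx fW Z's) => y Wy.
  by apply: Jl => //; apply: Z'D; exact: WU.
have BD : bracket X Y x \in W None x.
  exact: (foliation_bracket oU (web_foliation W None) sX sY).
have eT := bracket_act oW JXW JYW fW Wx; have eB := bracket_act oW XW YW fW Wx.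
have e1 := bracket_act oW JXW YW fW Wx; have e2 := bracket_act oW XW JYW fW Wx.
have e3 := Jl (bracket X Y) x Wx BD.
rewrite {}eB in e3; rewrite (JJ _ _ XW sX) in e1; rewrite (JJ _ _ YW sY) in e2.
rewrite (JJ _ _ YW sY) (JJ _ _ XW sX) in eT.
rewrite /pbracket -[papp _ (bracket X Y) x]scale1r -!scaleNr.
move: eT e1 e2 e3; set T := bracket _ _ x; set B1 := bracket _ Y x; set B2 := bracket X _ x.
set B3 := papp _ _ x => eT e1 e2 e3.
have tl := tder_linear _ _ _ oW fW Wx.
clearbody T B1 B2 B3.
have -> : B1 + B2 = B1 + 1 *: B2 by rewrite scale1r.
rewrite (tl T) (tl (B1 + _)) (tl B1) eT e1 e2 e3.
move: (vf_act _ (vf_act Y f) x) => p; move: (vf_act _ (vf_act Y f) x) => q.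
move: (vf_act _ (vf_act X f) x) => r; move: (vf_act _ (vf_act X f) x) => s.
ring.
Qed.

Lemma web_pbracket (W : veroneseWeb M) U X Y : open U ->
  section_on U (W None) X -> section_on U (W None) Y ->
  section_on U (W None) (pbracket (web_map W) X Y).
Proof.
move=> oU sX sY; have [Xs XD] := sX; have [Ys YD] := sY; split; last first.
  by move=> x Ux; exact: web_pencil_leaf (web_nijenhuis oU sX sY Ux).
have JXs := web_papp_smooth oU sX; have JYs := web_papp_smooth oU sY.
have sB : section_on U (W None) (bracket X Y).
  split; first exact: smooth_bracket.
  exact: (foliation_bracket oU (web_foliation W None) sX sY).
have JB := web_papp_smooth oU sB.
have s1 := smooth_bracket oU JXs Ys; have s2 := smooth_bracket oU Xs JYs.
have one := smooth_fun_cst (M := M) 1 oU; have mone := smooth_fun_cst (M := M) (-1) oU.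
apply: smooth_vf_eq (smooth_vf_lin oU mone (smooth_vf_lin oU one s1 s2) JB) => x Ux.
by rewrite /pbracket scale1r scaleN1r.
Qed.

Lemma web_torsion (W : veroneseWeb M) U X Y : open U ->
  section_on U (W None) X -> section_on U (W None) Y -> forall x, U x ->
  bracket (papp (web_map W) X) (papp (web_map W) Y) x
    - papp (web_map W) (pbracket (web_map W) X Y) x = 0.
Proof.
move=> oU sX sY x Ux; apply/eqP; rewrite subr_eq0; apply/eqP.
apply/web_pappP; last exact: (web_nijenhuis oU sX sY Ux).
exact: web_pencil_leaf (web_nijenhuis oU sX sY Ux).
Qed.

Definition web_partialNijenhuis (W : veroneseWeb M) : partialNijenhuis M :=
  @PartialNijenhuis R n M (W None) (web_map W)
    (ex_intro _ 1%N (web_foliation W None)) (@web_papp_smooth W)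
    (@web_pbracket W) (@web_torsion W).

Lemma web_generic (W : veroneseWeb M) : generic_type (web_partialNijenhuis W).
Proof.
move=> x; have [U [a [oU Ux as8 ca]]] := web_coframe W x.
have [e He] : {e : 'I_n.+1 -> vectorField M & forall y, U y ->
    forall i j, a i y (e j y) = (i == j)%:R}.
  have H y : exists e : 'I_n.+1 -> 'rV[R]_n.+1, U y ->
      forall i j, a i y (e j) = (i == j)%:R.
    have [/ca[ba _ _]|nU] := pselect (U y); last by exists (fun=> 0).
    by have [e He] := coframe_dual ba; exists e.
  by exists (fun j y => sval (cid (H y)) j) => y; exact: svalP (cid (H y)).
have es j : smooth_vf_on U (e j).
  apply: (@smooth_vf_of_functionals R n M U (fun i y v => a i y v)) => //.
  - by move=> i y v w c _; rewrite linearD linearZ.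
  - by move=> y v /ca[ba _ _]; exact: coframe_inj.
  move=> i; apply: (@smooth_fun_eq _ _ _ _ (fun=> (i == j)%:R)) => //.
    by move=> y Uy; rewrite He.
  exact: smooth_fun_cst.
(* In the dual frame J sends e_i to e_(i+1), whereas a generic frame lowers the index; reversing the
   order reconciles the two. T F_oo is spanned by all of the [w] except w_0 = e_n. *)
pose w i := e (rev_ord i); pose v (i : 'I_n) := w (lift ord0 i).
have vD i y : U y -> v i y \in W None y.
  move=> Uy; have [_ _ sn] := ca y Uy; apply/(spans_annihilatorP sn).
  rewrite He // (_ : (_ == _) = false) //; apply/eqP => /(congr1 val) /=.
  by rewrite /bump /= add1n subSS => /eqP; rewrite eq_sym ltn_eqF // ltn_subrL //= (leq_ltn_trans _ (ltn_ord i)).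
exists U, v, w; split=> // [i|i|y Uy].
- by split; [exact: es|move=> y; exact: vD].
- exact: es.
have [ba _ sn] := ca y Uy.
have indep (c : 'I_n.+1 -> R) : \sum_i c i *: w i y = 0 -> forall i, c i = 0.
  move=> cw i; have := congr1 (a (rev_ord i) y) cw.
  rewrite linear_sum linear0 (bigD1 i) //= linearZ /= He // eqxx big1.
    by rewrite addr0 /GRing.scale /= mulr1.
  move=> j ji; rewrite linearZ /= He // (inj_eq rev_ord_inj) eq_sym (negbTE ji).
  by rewrite scaler0.
have expand u : u = \sum_i (a (rev_ord i) y u : R) *: w i y.
  rewrite {1}(coframe_expand u ba (He y Uy)) (reindex_inj rev_ord_inj) /=.
  by apply: eq_bigr.
split.
- apply: basis_build => [i|u uD|c cv i]; first exact: vD.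
    exists (fun i => a (rev_ord (lift ord0 i)) y u).
    rewrite {1}(expand u) big_ord_recl (_ : rev_ord ord0 = ord_max); last first.
      by apply/val_inj; rewrite /= subn1.
    by rewrite (spans_annihilatorP sn u).1 // scale0r add0r.
  pose c' (k : 'I_n.+1) : R := if unlift ord0 k is Some j then c j else 0.
  have := indep c' _ (lift ord0 i); rewrite /c' liftK; apply.
  by rewrite big_ord_recl unlift_none scale0r add0r -[RHS]cv; apply: eq_bigr => j _; rewrite liftK.
- apply: basis_build => [i|u _|c cw i]; first exact: memvf.
    by exists (fun i => a (rev_ord i) y u); exact: expand.
  exact: indep.
- move=> i; apply/esym/web_pappP; first exact: vD.
  apply/(web_pencil _ _ (ca y Uy : web_coframe_at W y (a^~ y))); split.
  + rewrite He // (_ : (_ == _) = false) //; apply/eqP => /(congr1 val) /=.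
    by move/eqP; rewrite subSS eq_sym subn_eq0 leqNgt ltn_ord.
  + by apply/(spans_annihilatorP sn); exact: vD.
  + move=> j; rewrite !He //; congr (_%:R); congr nat_of_bool.
    apply/eqP/eqP => /(congr1 val) /=; rewrite /bump /= !add1n !subSS => ji.
      apply/val_inj => /=; rewrite /bump /= add1n subSS.
      by move: ji; have := ltn_ord i; have := ltn_ord j; lia.
    apply/val_inj => /=; rewrite /bump /= !add1n !subSS.
    by move: ji; have := ltn_ord i; have := ltn_ord j; lia.
- by [].
Qed.

End WebToNijenhuis.

(** * From partial Nijenhuis operators to webs *)

Section NijenhuisToWeb.
Context {R : realType} {n : nat} {M : smoothManifold R n}.
Implicit Types (U V : set M) (x y : M) (X Y : vectorField M)
  (P : partialNijenhuis M) (w : 'I_n.+1 -> 'rV[R]_n.+1) (l : option R).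

#[local] Opaque bracket tder.

Definition pn_leaf P l : Defs.distribution M := fun y =>
  if l is Some c then limg (pn_map P y - c *: linfun (@vsval R _ (pn_fol P y)))%VF
  else pn_fol P y.

Lemma pn_leafP P (c : R) y u : u \in pn_leaf P (Some c) y <->
  exists v : subvs_of (pn_fol P y), u = pn_map P y v - c *: vsval v.
Proof.
have E (v : subvs_of (pn_fol P y)) :
    (pn_map P y - c *: linfun (@vsval R _ (pn_fol P y)))%VF v = pn_map P y v - c *: vsval v.
  by rewrite add_lfunE opp_lfunE scale_lfunE lfunE.
split=> [/memv_imgP[v _ ->]|[v ->]]; first by exists v.
by apply/memv_imgP; exists v; rewrite ?memvf.
Qed.

Lemma pn_leaf_papp P (c : R) y X : X y \in pn_fol P y ->
  papp (pn_map P) X y - c *: X y \in pn_leaf P (Some c) y.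
Proof. by move=> Xy; apply/pn_leafP; exists (vsproj _ (X y)); rewrite vsprojK. Qed.

(* Reversing the order makes the pencil polynomial: the covector vanishing on
   w_(i-1) - l w_i for all i is the sum of the l^(n-i) w^i. *)
Definition dual_coframe w i : 'Hom('rV[R]_n.+1, R^o) :=
  linfun (coord [tuple w j | j < n.+1] (rev_ord i) : 'rV[R]_n.+1 -> R^o).

Definition pencil_covector w l : 'Hom('rV[R]_n.+1, R^o) :=
  if l is Some c then (\sum_(i < n.+1) c ^+ i *: dual_coframe w i)%R
  else dual_coframe w ord_max.

Arguments pencil_covector : simpl never.

Lemma dual_coframeE w i u : dual_coframe w i u = coord [tuple w j | j < n.+1] (rev_ord i) u.
Proof. by rewrite lfunE. Qed.

Lemma dual_coframe_frame w i j : basis_of fullv [tuple w j | j < n.+1] ->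
  dual_coframe w i (w j) = (i == rev_ord j)%:R.
Proof.
move=> bw; rewrite dual_coframeE (basis_coord _ _ bw) -(inj_eq rev_ord_inj) rev_ordK.
by rewrite eq_sym.
Qed.

Lemma pencil_covector_frame w (c : R) j : basis_of fullv [tuple w j | j < n.+1] ->
  pencil_covector w (Some c) (w j) = c ^+ (n - j).
Proof.
move=> bw; rewrite sum_lfunE (bigD1 (rev_ord j)) //= lfunE /= dual_coframe_frame //.
rewrite eqxx subSS big1 ?addr0 => [|i /negbTE ij].
  by rewrite /GRing.scale /= mulr1.
by rewrite lfunE /= dual_coframe_frame // ij scaler0.
Qed.

Lemma rev_ord0_max : rev_ord ord0 = ord_max :> 'I_n.+1.
Proof. by apply/val_inj; rewrite /= subn1. Qed.

Definition pn_frame_at P y (v : 'I_n -> 'rV[R]_n.+1) w :=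
  [/\ basis_of (pn_fol P y) [tuple v i | i < n],
      basis_of fullv [tuple w i | i < n.+1],
      forall i : 'I_n, pn_map P y (vsproj (pn_fol P y) (v i)) = w (widen_ord (leqnSn n) i) &
      forall i : 'I_n, v i = w (lift ord0 i)].

Lemma pn_frame_covector0 P y v w l : pn_frame_at P y v w ->
  exists u, pencil_covector w l u != 0.
Proof.
move=> [_ bw _ _]; case: l => [c|].
  by exists (w ord_max); rewrite pencil_covector_frame // subnn expr0 oner_neq0.
by exists (w ord0); rewrite dual_coframe_frame // rev_ord0_max eqxx oner_neq0.
Qed.

(** For a finite parameter c the leaf is generated by the vectors w_i - c w_(i+1). Modulo them w_i
    is c^(n-i) w_n, so [u] is congruent to its value under the pencil covector times w_n. *)
Lemma pn_leaf_kernel P y v w l u : pn_frame_at P y v w ->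
  u \in pn_leaf P l y <-> pencil_covector w l u = 0.
Proof.
move=> [bv bw Jv vw]; have vD i : v i \in pn_fol P y by exact: basis_vec_mem.
have exu u' := basis_expand bw (memvf u').
case: l => [c|]; last first.
  split=> [uD|u0].
    rewrite (basis_expand bv uD) linear_sum big1 // => i _.
    by rewrite linearZ /= vw dual_coframe_frame // -rev_ord0_max (inj_eq rev_ord_inj) scaler0.
  rewrite (exu u) big_ord_recl memvD //.
    move: u0; rewrite /pencil_covector dual_coframeE -rev_ord0_max rev_ordK => ->.
    by rewrite scale0r mem0v.
  by apply: memv_suml => i _; rewrite -vw memvZ.
have leaf i : w (widen_ord (leqnSn n) i) - c *: w (lift ord0 i) \in pn_leaf P (Some c) y.
  apply/pn_leafP; exists (vsproj (pn_fol P y) (v i)).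
  by rewrite Jv vsprojK // vw.
split=> [/pn_leafP[u' ->]|u0].
  have -> : u' = \sum_i coord [tuple v j | j < n] i (vsval u') *: vsproj (pn_fol P y) (v i).
    apply/val_inj; rewrite /= [LHS](basis_expand bv (subvsP u')) linear_sum /=.
    by apply: eq_bigr => i _; rewrite vsprojK.
  rewrite [pn_map _ _ (\sum_i _)]linear_sum [vsval (\sum_i _)]linear_sum scaler_sumr -sumrB linear_sum big1 // => i _.
  set k := coord _ _ _; rewrite /=; rewrite [pn_map _ _ (_ *: _)]linearZ /= vsprojK // Jv vw.
  rewrite scalerA [c * k]mulrC -scalerA -scalerBr linearZ linearB linearZ /=.
  rewrite !pencil_covector_frame //= /bump /= add1n /GRing.scale /= -exprS -subSn // subSS subrr.
  exact: mulr0.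
(* Induction downwards from w_n with k = n - i, adding one generator at each step. *)
have down k : (k <= n)%N -> forall i : 'I_n.+1, (i + k)%N = n ->
    w i - c ^+ k *: w ord_max \in pn_leaf P (Some c) y.
  elim: k => [_ i|k IH kn i ik].
    rewrite addn0 => ik; rewrite (_ : i = ord_max) ?scale1r ?subrr ?mem0v //.
    exact: val_inj.
  have ilt : (i < n)%N by lia.
  pose j := Ordinal ilt.
  have -> : i = widen_ord (leqnSn n) j by exact: val_inj.
  have := memvD (leaf j) (memvZ c (IH (ltnW kn) (lift ord0 j) _)).
  rewrite scalerBr scalerA -exprS addrA subrK; apply.
  by rewrite /= /bump /= add1n addSnnS.
have -> : u = \sum_i coord [tuple w j | j < n.+1] i u *: (w i - c ^+ (n - i) *: w ord_max).
  rewrite [LHS]exu; apply/eqP; rewrite -subr_eq0 -sumrB.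
  rewrite (eq_bigr (fun i => (coord [tuple w j | j < n.+1] i u *
     pencil_covector w (Some c) (w i)) *: w ord_max)).
    rewrite -scaler_suml (_ : \sum_i _ = 0) ?scale0r //.
    rewrite -[RHS]u0 [in RHS](exu u) linear_sum; apply: eq_bigr => i _.
    by rewrite linearZ.
  by move=> i _; rewrite pencil_covector_frame // -scalerBr opprB addrC subrK scalerA.
apply: memv_suml => i _; apply/memvZ/down; first exact: leq_subr.
by rewrite subnKC // -ltnS ltn_ord.
Qed.

Lemma pn_frame_annihilator P y v w l : pn_frame_at P y v w ->
  spans_annihilator (pencil_covector w l) (pn_leaf P l y).
Proof.
move=> fr; have [u u0] := pn_frame_covector0 l fr.
by apply: (kernel_spans_annihilator u0) => u'; exact: pn_leaf_kernel fr.
Qed.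

Lemma pn_frame_coframe P y v w : pn_frame_at P y v w ->
  basis_of fullv [tuple dual_coframe w i | i < n.+1].
Proof.
move=> [_ bw _ _]; apply: (@coframe_of_dual _ _ _ (fun j => w (rev_ord j))).
  by move=> i j; rewrite dual_coframe_frame // rev_ordK.
move=> u u0; rewrite (basis_expand bw (memvf u)) big1 // => i _.
by rewrite -(rev_ordK i) -dual_coframeE u0 scale0r.
Qed.

Lemma pn_frame P : generic_type P -> forall x, exists U
    (v : 'I_n -> vectorField M) (w : 'I_n.+1 -> vectorField M),
  [/\ open U, U x, forall i, section_on U (pn_fol P) (v i),
      forall i, smooth_vf_on U (w i) & forall y, U y -> pn_frame_at P y (v^~ y) (w^~ y)].
Proof. by move=> gP x; exact: gP x. Qed.

Lemma dual_coframe_smooth U (w : 'I_n.+1 -> vectorField M) : open U ->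
  (forall i, smooth_vf_on U (w i)) ->
  (forall y, U y -> basis_of fullv [tuple w i y | i < n.+1]) ->
  forall i, smooth_form_on U (fun y => dual_coframe (w^~ y) i).
Proof.
move=> oU ws bw i V X oV VU Xs.
apply: (@smooth_fun_eq _ _ _ _ (fun y => coord [tuple w j y | j < n.+1] (rev_ord i) (X y))) => //.
  by move=> y _; rewrite dual_coframeE.
apply: (@smooth_frame_coef _ _ _ V w
  (fun k y => coord [tuple w j y | j < n.+1] k (X y)) X (rev_ord i)) => //.
- by move=> k; exact: smooth_vf_sub VU (ws k).
- by move=> y c /VU/bw b; exact: basis_indep b.
- by move=> y /VU/bw b; exact: basis_expand b (memvf _).
Qed.

Lemma pn_leaf_coframe P : generic_type P -> forall x : M,
  exists (U : set M) (a : 'I_n.+1 -> oneForm M),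
    [/\ open U, U x, forall i, smooth_form_on U (a i) &
        forall y, U y ->
          [/\ basis_of fullv [tuple a i y | i < n.+1],
              forall c : R, spans_annihilator (\sum_(i < n.+1) c ^+ i *: a i y)
                              (pn_leaf P (Some c) y) &
              spans_annihilator (a ord_max y) (pn_leaf P None y)]].
Proof.
move=> gP x; have [U [v [w [oU Ux vs ws fr]]]] := pn_frame gP x.
exists U, (fun i y => dual_coframe (w^~ y) i); split=> //.
  by apply: dual_coframe_smooth => // y /fr[].
move=> y /fr fry; split=> [|c|]; first exact: pn_frame_coframe fry.
  exact: (pn_frame_annihilator (Some c) fry).
exact: (pn_frame_annihilator None fry).
Qed.

Lemma pencil_bracket_identity (T B1 B2 J B : 'rV[R]_n.+1) (c : R) :
  T - c *: (B1 + B2 - J) - c *: (J - c *: B) = T + (- c) *: B1 + (- c) *: (B2 + (- c) *: B).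
Proof. by apply/rowP => k; rewrite !mxE; ring. Qed.

(* [(J-l)A, (J-l)B] = (J-l)([A,B]_J - l [A,B]) when the torsion vanishes. *)
Lemma pn_leaf_bracket P U (c : R) A B x : open U ->
  section_on U (pn_fol P) A -> section_on U (pn_fol P) B -> U x ->
  bracket (fun y => papp (pn_map P) A y + (- c) *: A y)
          (fun y => papp (pn_map P) B y + (- c) *: B y) x \in pn_leaf P (Some c) x.
Proof.
move=> oU sA sB Ux; have [As _] := sA; have [Bs _] := sB.
have JAs := pn_smooth oU sA; have JBs := pn_smooth oU sB.
have [_ ZD] := pn_bracket oU sA sB; have T := pn_torsion oU sA sB Ux.
have one := smooth_fun_cst (M := M) (- c) oU.
rewrite (bracket_lin_l _ oU JAs As (smooth_vf_lin oU one JBs Bs) Ux).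
rewrite (bracket_lin_r _ oU JBs Bs JAs Ux) (bracket_lin_r _ oU JBs Bs As Ux).
have [q fD] := pn_integrable P.
have BD := foliation_bracket oU fD sA sB Ux.
have m1 := pn_leaf_papp c (ZD x Ux); have m2 := pn_leaf_papp c BD.
have := memvB m1 (memvZ c m2).
move/eqP: T; rewrite subr_eq0 => /eqP <-.
rewrite /pbracket; move: (bracket _ _ x) (bracket _ B x) (bracket A _ x).
move=> T B1 B2.
by rewrite pencil_bracket_identity.
Qed.

Lemma pn_leaf_foliation P : generic_type P -> forall l, foliation_on setT 1 (pn_leaf P l).
Proof.
move=> gP l; apply: foliation1_of => x _.
have [U [v [w [oU Ux vs ws fr]]]] := pn_frame gP x.
have as8 : forall i, smooth_form_on U (fun y => dual_coframe (w^~ y) i).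
  by apply: dual_coframe_smooth => // y /fr[].
have lins : linear_family U (fun y u => pencil_covector (w^~ y) l u).
  by move=> y u u' c _; rewrite linearD linearZ.
have [| |y u u' Uy u0 u'0|V [g [oV Vx VU gs Hg]]] := frobenius_manifold oU Ux lins.
- move=> V X oV VU Xs; case: l {lins} => [c|]; last exact: as8.
  apply: (@smooth_fun_eq _ _ _ _ (fun y => \sum_(i < n.+1) c ^+ i * dual_coframe (w^~ y) i (X y))) => //.
    by move=> y _; rewrite sum_lfunE; apply: eq_bigr => i _; rewrite scale_lfunE.
  apply: smooth_fun_sum => // i; apply: smooth_funM => //; first exact: smooth_fun_cst.
  exact: as8.
- by move=> y /fr fry; exact: pn_frame_covector0 fry.
(* Tangent vectors at [y] are extended with constant coefficients in the frame [v]; for a finite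
   parameter, J - c is applied to such an extension. *)
- pose S (c : 'I_n -> R) : vectorField M := fun z => \sum_i c i *: v i z.
  have sS c : section_on U (pn_fol P) (S c).
    split; last first.
      by move=> z Uz; apply: memv_suml => i _; apply: memvZ; have [_] := vs i; exact.
    apply: (@smooth_vf_sum _ _ _ U _ _ (fun i=> (fun=> c i)) v) => // i.
      exact: smooth_fun_cst.
    by have [] := vs i.
  have exS z u1 : U z -> u1 \in pn_fol P z -> exists c, u1 = S c z.
    move=> /fr[bv _ _ _] uD; exists (fun i => coord [tuple v j z | j < n] i u1).
    exact: basis_expand bv uD.
  have fry := fr y Uy.
  move/(pn_leaf_kernel _ _ fry): u0 => uL; move/(pn_leaf_kernel _ _ fry): u'0 => u'L.
  case: l {lins} uL u'L => [c|] uL u'L; last first.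
    have [a ua] := exS _ _ Uy uL; have [b ub] := exS _ _ Uy u'L.
    exists (S a), (S b); split=> //; first by split; [have [] := sS a|have [] := sS b].
      move=> z Uz; have frz := fr z Uz.
      by split; apply/(pn_leaf_kernel None _ frz); [have [_] := sS a|have [_] := sS b]; exact.
    apply/(pn_leaf_kernel None _ fry); have [q fD] := pn_integrable P.
    exact: (foliation_bracket oU fD (sS a) (sS b) Uy).
  have lift u1 : u1 \in pn_leaf P (Some c) y -> exists a,
      u1 = papp (pn_map P) (S a) y + (- c) *: S a y.
    move=> /pn_leafP[v1 ->]; have [a va] := exS _ _ Uy (subvsP v1).
    by exists a; rewrite /papp -va vsvalK scaleNr.
  have [a ua] := lift _ uL; have [b ub] := lift _ u'L.
  have cs := smooth_fun_cst (M := M) (- c) oU.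
  exists (fun z => papp (pn_map P) (S a) z + (- c) *: S a z),
         (fun z => papp (pn_map P) (S b) z + (- c) *: S b z); split=> //.
  + by split; apply: smooth_vf_lin => //; [exact: pn_smooth|have [] := sS a|exact: pn_smooth|have [] := sS b].
  + move=> z Uz; have frz := fr z Uz.
    split; apply/(pn_leaf_kernel (Some c) _ frz); rewrite scaleNr; apply: pn_leaf_papp.
      by have [_] := sS a; exact.
    by have [_] := sS b; exact.
  + by apply/(pn_leaf_kernel (Some c) _ fry); exact: pn_leaf_bracket oU (sS a) (sS b) Uy.
exists V, g; split=> // y Vy; have [gn gk] := Hg y Vy; split=> // u.
by rewrite (pn_leaf_kernel _ _ (fr y (VU y Vy))).
Qed.

Definition pn_web P (gP : generic_type P) : veroneseWeb M :=
  VeroneseWeb (pn_leaf_foliation gP) (pn_leaf_coframe gP).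

End NijenhuisToWeb.

(** * The local extension *)

Section LocalNijenhuis.
Context {R : realType} {n : nat} {M : smoothManifold R n}.
Implicit Types (U V : set M) (x y : M) (X Y Z : vectorField M) (f : M -> R)
  (P : partialNijenhuis M) (w : 'I_n.+1 -> 'rV[R]_n.+1).

#[local] Opaque bracket tder.

(** A Vandermonde argument: the pencil value is a polynomial of degree at most n in the parameter,
    with the dual coordinates of [u] as coefficients, and it vanishes at n + 1 points. *)
Lemma pencil_covector_inj w u : basis_of fullv [tuple w j | j < n.+1] ->
  (forall i : 'I_n.+1, pencil_covector w (Some i%:R) u = 0) -> u = 0.
Proof.
move=> bw u0; rewrite (basis_expand bw (memvf u)).
suff a0 i : dual_coframe w i u = 0.
  by rewrite big1 // => i _; rewrite -(rev_ordK i) -dual_coframeE a0 scale0r.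
pose p := \poly_(i < n.+1) (dual_coframe w (inord i) u : R).
have pE (c : R) : p.[c] = pencil_covector w (Some c) u.
  rewrite horner_poly sum_lfunE; apply: eq_bigr => j _.
  by rewrite inord_val scale_lfunE mulrC.
have p0 : p = 0.
  apply: (@poly_vanish _ _ n.+1) => [|k kn]; first exact: size_poly.
  by rewrite pE; exact: (u0 (Ordinal kn)).
by have := congr1 (fun q : {poly R} => q`_i) p0; rewrite coef_poly ltn_ord inord_val coef0.
Qed.

Lemma diagonalizing_functions P : generic_type P -> forall x, exists U
    (v : 'I_n -> vectorField M) (w : 'I_n.+1 -> vectorField M) (f : 'I_n.+1 -> M -> R),
  [/\ open U, U x, forall i, smooth_fun_on U (f i),
      forall y, U y -> pn_frame_at P y (v^~ y) (w^~ y) &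
      forall y i, U y -> (exists u, tder (f i) y u != 0) /\
        forall u, u \in pn_leaf P (Some i%:R) y <-> tder (f i) y u = 0].
Proof.
move=> gP x; have [U0 [v [w [oU0 U0x _ _ fr]]]] := pn_frame gP x.
have /choice[Vf HV] i : exists Vf : set M * (M -> R),
    [/\ open Vf.1, Vf.1 x, smooth_fun_on Vf.1 Vf.2 & forall y, Vf.1 y ->
     (exists u, tder Vf.2 y u != 0) /\
     forall u, u \in pn_leaf P (Some (i : 'I_n.+1)%:R) y <-> tder Vf.2 y u = 0].
  have [V [f [oV Vx _ fs H]]] := foliation1P (pn_leaf_foliation gP (Some i%:R)) (I : setT x).
  by exists (V, f).
pose N : set M := fun y => forall i, (Vf i).1 y.
have Nx : nbhs x N.
  by apply: filter_forall => i; have [oV Vx _ _] := HV i; exact: open_nbhs_nbhs.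
pose U := U0 `&` N^°; have oU : open U by apply: openI => //; exact: open_interior.
have UV i : U `<=` (Vf i).1 by move=> y [_ /interior_subset]; exact.
exists U, v, w, (fun i => (Vf i).2); split=> // [i|y [U0y _]|y i Uy].
- by have [oV _ fs _] := HV i; exact: smooth_fun_sub oV oU (UV i) fs.
- exact: fr.
- by have [_ _ _] := HV i; apply; exact: UV.
Qed.

Lemma smooth_of_diagonal U (f : 'I_n.+1 -> M -> R) (l : 'I_n.+1 -> R) (J : tensor11 M) :
  open U -> (forall i, smooth_fun_on U (f i)) ->
  (forall y u, U y -> (forall i, tder (f i) y u = 0) -> u = 0) ->
  (forall y i u, U y -> tder (f i) y (J y u) = l i * tder (f i) y u) ->
  smooth_tensor11_on U J.
Proof.
move=> oU fs finj fJ V X oV VU Xs.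
have fV i : smooth_fun_on V (f i) by exact: smooth_fun_sub oU oV VU (fs i).
apply: (@smooth_vf_of_functionals R n M V (fun i => tder (f i))) => //.
- by move=> i; exact: tder_linear_family.
- by move=> i; exact: tder_smooth_family.
- by move=> y u /VU Uy; exact: finj.
move=> i; apply: (@smooth_fun_eq _ _ _ _ (fun y => l i * vf_act X (f i) y)) => //.
  by move=> y /VU Uy; rewrite fJ.
by apply: smooth_funM => //; [exact: smooth_fun_cst|exact: Xs].
Qed.

Lemma tder_alternating U f x t1 t2 t3 t4 (a1 a2 a3 a4 : R) :
  open U -> smooth_fun_on U f -> U x ->
  tder f x t1 = a1 -> tder f x t2 = a2 -> tder f x t3 = a3 -> tder f x t4 = a4 ->
  tder f x (t1 - t2 - t3 + t4) = a1 - a2 - a3 + a4.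
Proof.
move=> oU fs Ux <- <- <- <-; have tl := tder_linear _ _ _ oU fs Ux.
have -> : t1 - t2 - t3 + t4 = t1 + (-1) *: t2 + (-1) *: t3 + 1 *: t4.
  by rewrite scale1r !scaleN1r.
by rewrite (tl (t1 + _ + _)) (tl (t1 + _)) (tl t1) mul1r !mulN1r.
Qed.

(** Tested on f_i, the torsion consists of terms l_i JX(Y f_i), l_i JY(X f_i) and l_i^2 times second
    derivatives along X and Y; each kind cancels separately. Constancy of l_i lets it leave the
    derivations. *)
Lemma nijenhuis_of_diagonal U (f : 'I_n.+1 -> M -> R) (l : 'I_n.+1 -> R) (J : tensor11 M) :
  open U -> (forall i, smooth_fun_on U (f i)) ->
  (forall y u, U y -> (forall i, tder (f i) y u = 0) -> u = 0) ->
  (forall y i u, U y -> tder (f i) y (J y u) = l i * tder (f i) y u) ->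
  nijenhuis_on U J.
Proof.
move=> oU fs finj fJ; have Js := smooth_of_diagonal oU fs finj fJ; split=> //.
move=> V X Y oV VU Xs Ys x Vx; apply: (finj x) => [|i]; first exact: VU.
have fV : smooth_fun_on V (f i) by exact: smooth_fun_sub oU oV VU (fs i).
have JXs : smooth_vf_on V (tapp J X) by exact: Js.
have JYs : smooth_vf_on V (tapp J Y) by exact: Js.
have Jf Z y : V y -> tder (f i) y (tapp J Z y) = l i * tder (f i) y (Z y).
  by move=> /VU Uy; exact: fJ.
have eJ Z Z' : smooth_vf_on V Z' ->
    vf_act Z (vf_act (tapp J Z') (f i)) x = l i * vf_act Z (vf_act Z' (f i)) x.
  by move=> Z's; apply: (vf_act_eigen _ oV Vx fV Z's) => y; exact: Jf.
have e1 := bracket_act oV JXs JYs fV Vx; have e2 := bracket_act oV JXs Ys fV Vx.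
have e3 := bracket_act oV Xs JYs fV Vx; have e4 := bracket_act oV Xs Ys fV Vx.
rewrite (eJ _ _ Ys) (eJ _ _ Xs) in e1; rewrite (eJ _ _ Xs) in e2.
rewrite (eJ _ _ Ys) in e3.
have j2 := Jf (bracket (tapp J X) Y) x Vx; have j3 := Jf (bracket X (tapp J Y)) x Vx.
have j4 := Jf (tapp J (bracket X Y)) x Vx; have j5 := Jf (bracket X Y) x Vx.
rewrite {}e2 in j2; rewrite {}e3 in j3; rewrite {}j5 {}e4 in j4.
apply: etrans (tder_alternating oV fV Vx e1 j2 j3 j4) _.
move: (vf_act _ (vf_act _ (f i)) x) => p; move: (vf_act _ (vf_act _ (f i)) x) => q.
move: (vf_act _ (vf_act _ (f i)) x) => r; move: (vf_act _ (vf_act _ (f i)) x) => s.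
ring.
Qed.

Lemma pn_frame_injective P y v w (u : subvs_of (pn_fol P y)) : pn_frame_at P y v w ->
  pn_map P y u = 0 -> u = 0.
Proof.
move=> [bv bw Jv _] Ju; apply/val_inj; rewrite [LHS](basis_expand bv (subvsP u)) /=.
have uE : u = \sum_i coord [tuple v j | j < n] i (vsval u) *: vsproj (pn_fol P y) (v i).
  apply/val_inj; rewrite /= [LHS](basis_expand bv (subvsP u)) linear_sum /=.
  by apply: eq_bigr => i _; rewrite vsprojK // (basis_vec_mem _ bv).
rewrite big1 // => i _; suff -> : coord [tuple v j | j < n] i (vsval u) = 0 by rewrite scale0r.
have := congr1 (dual_coframe w (rev_ord (widen_ord (leqnSn n) i))) Ju.
rewrite linear0 {1}uE linear_sum linear_sum (bigD1 i) //= linearZ linearZ /= Jv.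
rewrite dual_coframe_frame // eqxx big1 => [|j ji].
  by rewrite addr0 /GRing.scale /= mulr1.
rewrite linearZ linearZ /= Jv dual_coframe_frame // (inj_eq rev_ord_inj).
rewrite (_ : (_ == _) = false) ?scaler0 //; apply/negP => /eqP/(congr1 val)/= ij.
by rewrite (_ : j = i) ?eqxx // in ji; exact: val_inj.
Qed.

Lemma local_nijenhuis P : generic_type P -> forall x : M,
  exists (U : set M) (J : tensor11 M),
    [/\ open U, U x, nijenhuis_on U J,
        forall y, U y ->
          (forall v : subvs_of (pn_fol P y), pn_map P y v = J y (vsval v)) /\
          {in pn_fol P y &, injective (J y)} &
        integrable_on U (fun y => (J y @: pn_fol P y)%VS)].
Proof.
move=> gP x; have [U [v [w [f [oU Ux fs fr ker]]]]] := diagonalizing_functions gP x.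
have finj y u : U y -> (forall i, tder (f i) y u = 0) -> u = 0.
  move=> Uy u0; have fry := fr y Uy; have [_ bw _ _] := fry.
  apply: (pencil_covector_inj bw) => i; apply/(pn_leaf_kernel _ _ fry).
  by have [_ k] := ker y i Uy; apply/k.
pose A y := \matrix_(k, i) tder (f i) y (delta_mx 0 k).
have AE y (u : 'rV[R]_n.+1) i : U y -> (u *m A y) 0 i = tder (f i) y u.
  move=> Uy; rewrite {2}(row_sum_delta u) (tder_sumv _ _ _ oU (fs i) Uy) mxE.
  by apply: eq_bigr => k _; rewrite mxE.
have Au y : U y -> A y \in unitmx.
  move=> Uy; apply: unitmx_of_inj => u uA; apply: (finj y) => // i.
  by rewrite -AE // uA mxE.
(* Vectors are rows and [u *m A y] lists the numbers df_i(u); right multiplication by A D A^-1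
   therefore scales the i-th differential by i. *)
pose D : 'M[R]_n.+1 := diag_mx (\row_i i%:R).
pose J : tensor11 M := fun y => linfun (mulmxr (A y *m D *m invmx (A y))).
have fJ y i u : U y -> tder (f i) y (J y u) = i%:R * tder (f i) y u.
  move=> Uy; rewrite -!AE // lfunE /= -!mulmxA mulVmx ?Au // mulmx1 mulmxA.
  by rewrite mul_mx_diag mxE [X in _ * X]mxE mulrC.
(* Both sides have the same image under every df_i, because (J - i) u is tangent to the leaf of
   parameter i, whose first integral is f_i. *)
have JP y (u : subvs_of (pn_fol P y)) : U y -> pn_map P y u = J y (vsval u).
  move=> Uy; apply/eqP; rewrite -subr_eq0; apply/eqP; apply: (finj y) => // i.
  have [_ k] := ker y i Uy.
  have /k : pn_map P y u - i%:R *: vsval u \in pn_leaf P (Some i%:R) y.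
    by apply/pn_leafP; exists u.
  have tB a b : tder (f i) y (a - b) = tder (f i) y a - tder (f i) y b.
    by rewrite -scaleN1r (tder_linear _ _ _ oU (fs i) Uy) mulN1r.
  by rewrite !tB fJ // (tderZ _ _ oU (fs i) Uy).
exists U, J; split=> //.
- exact: nijenhuis_of_diagonal oU fs finj fJ.
- move=> y Uy; split=> [u|u u' uD u'D Juu']; first exact: JP.
  apply/eqP; rewrite -subr_eq0; apply/eqP; have := memvB uD u'D => zD.
  rewrite -(vsprojK zD) (@pn_frame_injective P y (v^~ y) (w^~ y) (vsproj _ (u - u'))) //.
    exact: fr.
  by rewrite JP // vsprojK // linearB /= Juu' subrr.
(* J(T F) is the leaf of parameter 0, and 0 is the eigenvalue attached to f_0. *)
- exists 1%N; apply: foliation1_of => y Uy; exists U, (f ord0); split=> // z Uz.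
  have [nz k] := ker z ord0 Uz; split=> // u; rewrite -k; split.
    move=> /memv_imgP[t tD ->]; apply/pn_leafP; exists (vsproj _ t).
    by rewrite JP // vsprojK // scale0r subr0.
  move=> /pn_leafP[t ->]; rewrite scale0r subr0 JP //.
  by apply: memv_img; exact: subvsP.
Qed.

End LocalNijenhuis.

(** * The two constructions are inverse to each other *)

Section Correspondence.
Context {R : realType} {n : nat} {M : smoothManifold R n}.
Implicit Types (W : veroneseWeb M) (P : partialNijenhuis M).

Lemma veroneseWeb_ext W W' : web_leaf W = web_leaf W' -> W = W'.
Proof.
case: W => l f c; case: W' => l' f' c' /= e; subst l'.
by congr VeroneseWeb; exact: Prop_irrelevance.
Qed.

(** The two maps live on fibres of distributions that are equal but not convertible; comparing them
    through the ambient vector, by [vsval] and then [vsproj], avoids a transport along the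
    equality. *)
Lemma partialNijenhuis_ext P (D : Defs.distribution M) (J : partialTensor D) i s b t :
  forall e : pn_fol P = D,
  (forall y (v : subvs_of (pn_fol P y)), pn_map P y v = J y (vsproj _ (vsval v))) ->
  P = @PartialNijenhuis R n M D J i s b t.
Proof.
case: P => D' J' i' s' b' t' /= e; subst D' => JJ.
have {}JJ : J' = J.
  apply: functional_extensionality_dep => y; apply/lfunP => v.
  by rewrite JJ vsvalK.
by subst J'; congr PartialNijenhuis; exact: Prop_irrelevance.
Qed.

(** Inclusion in the web leaf is the definition of the operator. Conversely the web covector kills
    the reconstructed leaf, so it is a multiple of the pencil covector; the factor is not 0 because
    the web covector takes the value 1 on e_0. *)
Lemma web_leafE W l x : pn_leaf (web_partialNijenhuis W) l x = W l x.
Proof.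
case: l => [c|//]; have [U [v [w [_ Ux _ _ fr]]]] := pn_frame (web_generic W) x.
have ann := pn_frame_annihilator (Some c) (fr x Ux).
have [U' [a [_ U'x _ /(_ x U'x)[ba sa _]]]] := web_coframe W x.
have sub u : u \in pn_leaf (web_partialNijenhuis W) (Some c) x -> u \in W (Some c) x.
  move=> /pn_leafP[u' ->]; exact: (web_mapP u' (web_map W x u')).2 erefl c.
have [e ae] := coframe_dual ba.
have {sa} := sa c; set b := (X in spans_annihilator X _) => sb.
have be : b (e ord0) = 1.
  rewrite sum_lfunE big_ord_recl scale_lfunE ae expr0 scale1r big1 ?addr0 // => i _.
  by rewrite scale_lfunE ae scaler0.
have /ann/vlineP[k bk] : forall u, u \in pn_leaf (web_partialNijenhuis W) (Some c) x -> b u = 0.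
  by move=> u /sub/(spans_annihilatorP sb).
apply/vspaceP => u; apply/idP/idP; first exact: sub.
move=> /(spans_annihilatorP sb); rewrite bk scale_lfunE => /eqP.
rewrite mulf_eq0 => /orP[/eqP k0|/eqP ?]; last exact/(spans_annihilatorP ann).
by move: be; rewrite bk k0 scale0r zero_lfunE => /eqP; rewrite eq_sym oner_eq0.
Qed.

Lemma pn_webK W : pn_web (web_generic W) = W.
Proof.
by apply: veroneseWeb_ext; apply/funext => l; apply/funext => x; exact: web_leafE.
Qed.

(** By the very definition of the leaves, J itself satisfies the condition that characterises the
    operator of its web. *)
Lemma web_partialNijenhuisK P (gP : generic_type P) :
  web_partialNijenhuis (pn_web gP) = P.
Proof.
apply/esym; apply: partialNijenhuis_ext => // y v; rewrite vsvalK.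
by apply/(web_mapP (W := pn_web gP)) => l; apply/pn_leafP; exists v.
Qed.

End Correspondence.

Theorem mainTheorem1 (R : realType) (n : nat) (M : smoothManifold R n) :
  (exists Phi : veroneseWeb M -> {P : partialNijenhuis M | generic_type P},
     bijective Phi /\
     forall W : veroneseWeb M,
       W None = pn_fol (sval (Phi W)) /\
       forall x : M, W (Some 0) x = limg (pn_map (sval (Phi W)) x)) /\
  (forall P : partialNijenhuis M, generic_type P ->
     forall x : M, exists (U : set M) (J : tensor11 M),
       [/\ open U, U x, nijenhuis_on U J,
           forall y, U y ->
             (forall v : subvs_of (pn_fol P y), pn_map P y v = J y (vsval v)) /\
             {in pn_fol P y &, injective (J y)} &
           integrable_on U (fun y => (J y @: pn_fol P y)%VS)]).
Proof.
split; last exact: local_nijenhuis.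
exists (fun W => exist _ (web_partialNijenhuis W) (web_generic W)); split.
  exists (fun p : {P : partialNijenhuis M | generic_type P} =>
      let: exist _ gP := p in pn_web gP).
    exact: pn_webK.
  move=> [P gP] /=; move: (web_generic _); rewrite web_partialNijenhuisK => g.
  by congr exist; exact: Prop_irrelevance.
by move=> W; split=> // x; rewrite -web_leafE /pn_leaf scale0r subr0.
Qed.
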